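(* Let $\Lambda$ be any row-finite higher-rank graph with no sources, let $\mathcal{G}_\Lambda$ be its path groupoid, and let $\mathcal{A}$ be any right $\Lambda$-module, with associated $\mathcal{G}_\Lambda$-sheaf $\underline{\mathcal{A}}$. With the groups and maps defined in the context, for $n\le2$ the diagram formed by the top row $$H^n(\Lambda,\mathcal{A})\xrightarrow{\ \theta^n\ }H^n_{\underline{P}}(\mathcal{G}_\Lambda,\underline{\mathcal{A}})\xrightarrow{\ \rho^n_{\underline{P}}\ }H^n(\mathcal{G}_\Lambda,\underline{\mathcal{A}}),$$ the bottom row and diagonal $$H^n_c(\mathcal{G}_\Lambda,\underline{\mathcal{A}})\xrightarrow[\cong]{\ \eta^n\ }H^n_{\mathscr{P}}(\mathcal{G}_\Lambda,\underline{\mathcal{A}})\xrightarrow{\ \rho^n_{\mathscr{P}}\ }H^n(\mathcal{G}_\Lambda,\underline{\mathcal{A}}),$$ the left vertical map $\kappa^n:H^n(\Lambda,\mathcal{A})\to H^n_c(\mathcal{G}_\Lambda,\underline{\mathcal{A}})$ of Kumjian, Pask and Sims, and the vertical map $\psi_n^*:H^n_{\mathscr{P}}(\mathcal{G}_\Lambda,\underline{\mathcal{A}})\to H^n_{\underline{P}}(\mathcal{G}_\Lambda,\underline{\mathcal{A}})$ commutes. That is, $$\psi_n^*\circ\eta^n\circ\kappa^n=\theta^n\qquad\text{and}\qquad\rho^n_{\underline{P}}\circ\psi_n^*=\rho^n_{\mathscr{P}}.$$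
   Context: **$\Lambda$-modules and their cohomology.** Categories are viewed arrows-only: $\lambda\in\Lambda$ is a morphism with range $r(\lambda)$ and source $s(\lambda)$; objects are identified with identity morphisms; $\lambda\mu$ is defined when $s(\lambda)=r(\mu)$. A right $\Lambda$-module is a contravariant functor $\mathcal{A}:\Lambda\to\mathbf{Ab}$, with groups $\mathcal{A}_v$ and maps $\mathcal{A}(\lambda):\mathcal{A}_{r(\lambda)}\to\mathcal{A}_{s(\lambda)}$; morphisms are natural transformations. For an abelian group $A$, $A^\Lambda$ is the constant module ($A^\Lambda_v=A$, $A^\Lambda(\lambda)=\mathrm{id}$). $\Lambda^{*n}$ is the set of composable $n$-tuples $(\lambda_1,\dots,\lambda_n)$, $s(\lambda_i)=r(\lambda_{i+1})$, and $\Lambda^{*0}=\operatorname{Obj}(\Lambda)$. $P^n$ is the $\Lambda$-module with $P^n_v$ free abelian on the tuples $(\lambda_0,\dots,\lambda_n)\in\Lambda^{*(n+1)}$ with $s(\lambda_n)=v$ (generators $[\lambda_0,\dots,\lambda_n]$), $P^n(\lambda)[\lambda_0,\dots,\lambda_n]=[\lambda_0,\dots,\lambda_n\lambda]$. For $n\ge1$, $d_n[\lambda_0,\dots,\lambda_n]=[\lambda_1,\dots,\lambda_n]+\sum_{i=1}^n(-1)^i[\lambda_0,\dots,\lambda_{i-1}\lambda_i,\dots,\lambda_n]$, and $d_0:P^0\to\mathbb{Z}^\Lambda$, $d_0[\lambda]=1$. $H^n(\Lambda,\mathcal{A})$ is the $n$th cohomology of $\operatorname{Hom}_\Lambda(P^*,\mathcal{A})$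 with boundary $c\mapsto c\circ d_{n+1}$. A cochain $f\in\operatorname{Hom}_\Lambda(P^n,\mathcal{A})$ corresponds bijectively to the function $c$ on $\Lambda^{*n}$ given by $c(\lambda_1,\dots,\lambda_n)=f([\lambda_1,\dots,\lambda_n,s(\lambda_n)])\in\mathcal{A}_{s(\lambda_n)}$ (for $n=0$: $c(v)=f([v])$); $c$ is then called a categorical cochain (cocycle, if $f$ is one). **$k$-graphs and path groupoid.** A higher-rank graph, or $k$-graph, is a countable category $\Lambda$ with a functor $d:\Lambda\to\mathbb{N}^k$ such that $d(\lambda)=m+n$ implies there are unique $\mu,\nu$ with $\lambda=\mu\nu$, $d(\mu)=m$, $d(\nu)=n$. It is row-finite with no sources if $0<|\{\lambda:d(\lambda)=m,r(\lambda)=v\}|<\infty$ for all $m\in\mathbb{N}^k$ and vertices $v$. $\Omega_k$ is the $k$-graph with objects $\mathbb{N}^k$, morphisms $(m,n)$ with $m\le n$, $r(m,n)=m$, $s(m,n)=n$, $d(m,n)=n-m$. $\Lambda^\infty$ is the set of degree-preserving functors $x:\Omega_k\to\Lambda$, with basic compact open sets $Z(\lambda)=\{x:x(0,d(\lambda))=\lambda\}$; $x(p)=x(p,p)$, $r(x)=x(0)$, $\sigma^p(x)(m,n)=x(m+p,n+p)$; if $s(\lambda)=r(y)$, $\lambda y$ is the unique $x\in\Lambda^\infty$ with $x(0,d(\lambda))=\lambda$, $\sigma^{d(\lambda)}(x)=y$. $\mathcal{G}_\Lambda=\{(x,j-\ell,y):x,y\in\Lambda^\infty,\ j,\ell\in\mathbb{N}^k,\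 \sigma^j(x)=\sigma^\ell(y)\}$, $r(x,n,y)=x$, $s(x,n,y)=y$, $(x,n,y)(y,m,z)=(x,n+m,z)$, unit space $\Lambda^\infty$, with basic compact open sets $Z(\lambda,\mu)=\{(\lambda z,d(\lambda)-d(\mu),\mu z):z\in\Lambda^\infty,\ r(z)=s(\lambda)\}$ for $s(\lambda)=s(\mu)$. It is a locally compact Hausdorff étale groupoid. **$\mathcal{G}$-sheaves.** For an étale groupoid $\mathcal{G}$ (range and source maps are local homeomorphisms) a $\mathcal{G}$-sheaf is a space $\mathscr{A}$ with a local homeomorphism $\pi:\mathscr{A}\to\mathcal{G}^{(0)}$, abelian group fibers $\mathscr{A}(x)$ with continuous operations, and isomorphisms $a\mapsto\gamma\cdot a$, $\mathscr{A}(s(\gamma))\to\mathscr{A}(r(\gamma))$, functorial in $\gamma\in\mathcal{G}$ and jointly continuous in $(\gamma,a)$. Morphisms are continuous, fiber-preserving, fiberwise additive, equivariant maps; $\operatorname{Hom}_{\mathcal{G}}$ denotes their group. $\mathcal{G}$-sheaves form an abelian category with enough injectives. $\underline{\mathbb{Z}}$ (or $\underline{A}$) is the constant sheaf with trivial action. **The functor $\mathcal{A}\mapsto\underline{\mathcal{A}}$.** $\underline{\mathcal{A}}(x)=\varinjlim(\mathcal{A}_{x(p)},\mathcal{A}(x(p,q)))$ over $p\le q$ in $\mathbb{N}^k$, with natural maps $\varphi^x_p:\mathcal{A}_{x(p)}\to\underline{\mathcal{A}}(x)$; $\underline{\mathcal{A}}=\bigsqcup_x\underline{\mathcal{A}}(x)$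 has basic open sets $S_{a,\lambda}=\{\varphi^y_{d(\lambda)}(a):y\in Z(\lambda)\}$, $a\in\mathcal{A}_{s(\lambda)}$, and action $(x,p-q,y)\cdot\varphi^y_q(b)=\varphi^x_p(b)$ whenever $\sigma^p(x)=\sigma^q(y)$ and $b\in\mathcal{A}_{y(q)}$. For $\eta\in\operatorname{Hom}_\Lambda(\mathcal{A},\mathcal{B})$, $\underline{\eta}(\varphi^x_p(a))=\varphi^x_p(\eta(a))$. This is an exact functor to $\mathcal{G}_\Lambda$-sheaves, and $\underline{A^\Lambda}=\underline{A}$. Thus $\{\underline{P^n},\underline{d_n}\}$ is a resolution of $\underline{\mathbb{Z}}$. One identifies $\underline{P^n}(x)$ with the free abelian group on $\{((x,m,y),(\lambda_1,\dots,\lambda_n))\in\mathcal{G}_\Lambda\times\Lambda^{*n}:s(\lambda_n)=r(y)\}$ (for $n=0$: on the $(x,m,y)\in\mathcal{G}_\Lambda$) via $\varphi^x_p([\lambda_0,\dots,\lambda_n])\leftrightarrow[(x,p-d(\lambda_n),\lambda_n\sigma^p(x)),(\lambda_0,\dots,\lambda_{n-1})]$. **The resolution $\mathscr{P}$.** $\mathcal{G}^{(n)}$ is the space of composable $n$-tuples of an étale groupoid $\mathcal{G}$. $\mathscr{P}_n=\mathbb{Z}[\mathcal{G}^{(n+1)}]$ is the $\mathcal{G}$-sheaf whose stalk at $x$ is free abelian on the tuples $(\gamma_0,\dots,\gamma_n)$ with $r(\gamma_0)=x$, with action $\gamma\cdot[\gamma_0,\dots,\gamma_n]=[\gamma\gamma_0,\gamma_1,\dots,\gamma_n]$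 and with topology having as basis the sets $\{\sum_i a_i[e_i(z)]:z\in U\}$, where $U\subseteq\mathcal{G}^{(0)}$ is open, $a_i\in\mathbb{Z}$ (finite sum) and the $e_i$ are continuous local sections over $U$ of $(\gamma_0,\dots,\gamma_n)\mapsto r(\gamma_0)$ with open image. For $n\ge1$, $\partial_n[\gamma_0,\dots,\gamma_n]=(-1)^n[\gamma_0,\dots,\gamma_{n-1}]+\sum_{i=1}^n(-1)^{i-1}[\gamma_0,\dots,\gamma_{i-1}\gamma_i,\dots,\gamma_n]$, and $\partial_0:\mathscr{P}_0\to\underline{\mathbb{Z}}$, $\partial_0[\gamma]=1_{r(\gamma)}$. This is a resolution of $\underline{\mathbb{Z}}$. **Cohomology groups.** For a resolution $\{\mathscr{Q}_n,\vartheta_n\}$ of $\underline{\mathbb{Z}}$ (with augmentation $\vartheta_0:\mathscr{Q}_0\to\underline{\mathbb{Z}}$), $H^n_{\mathscr{Q}}(\mathcal{G},\mathscr{A})$ is the $n$th cohomology of $\operatorname{Hom}_{\mathcal{G}}(\mathscr{Q}_*,\mathscr{A})$ with boundary $f\mapsto f\circ\vartheta_{n+1}$; this defines $H^n_{\mathscr{P}}$ and $H^n_{\underline{P}}$. $H^n_c(\mathcal{G},\mathscr{A})$ is the cohomology of the complex of continuous $f:\mathcal{G}^{(n)}\to\mathscr{A}$ with $f(\gamma_1,\dots,\gamma_n)\in\mathscr{A}(r(\gamma_1))$ and $\delta_c^nf(\gamma_0,\dots,\gamma_n)=\gamma_0\cdot f(\gamma_1,\dots,\gamma_n)+\sum_{i=1}^n(-1)^if(\gamma_0,\dots,\gamma_{i-1}\gamma_i,\dots,\gamma_n)+(-1)^{n+1}f(\gamma_0,\dots,\gamma_{n-1})$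 for $n\ge 1$, $\delta^0_cf(\gamma)=\gamma\cdot f(s(\gamma))-f(r(\gamma))$. $H^n(\mathcal{G},\mathscr{A})$ is equivariant sheaf cohomology, the right derived functors of $\operatorname{Hom}_{\mathcal{G}}(\underline{\mathbb{Z}},\cdot)$, identified with Yoneda $\operatorname{Ext}^n_{\mathcal{G}}(\underline{\mathbb{Z}},\mathscr{A})$: for $n\ge1$, classes of exact sequences $0\to\mathscr{A}\to\mathscr{R}_{n-1}\to\cdots\to\mathscr{R}_0\to\underline{\mathbb{Z}}\to0$ under the equivalence relation generated by morphisms of sequences that are identities on $\mathscr{A}$ and $\underline{\mathbb{Z}}$; $H^0(\mathcal{G},\mathscr{A})=\operatorname{Hom}_{\mathcal{G}}(\underline{\mathbb{Z}},\mathscr{A})$. **The maps.** - $\theta^n$ is induced by $c\mapsto\underline{c}$ for cocycles $c\in\operatorname{Hom}_\Lambda(P^n,\mathcal{A})$. - $\eta^n$ is the isomorphism induced by $(\eta^nf)([\gamma_0,\dots,\gamma_n])=\gamma_0\cdot f(\gamma_1,\dots,\gamma_n)$ (for $n=0$: $(\eta^0f)([\gamma_0])=\gamma_0\cdot f(s(\gamma_0))$). - $\rho^n_{\mathscr{Q}}:H^n_{\mathscr{Q}}(\mathcal{G},\mathscr{A})\to H^n(\mathcal{G},\mathscr{A})$: for $n\ge1$ it sends the class of a cocycle $c$ to the class of $0\to\mathscr{A}\to\mathscr{R}_c\to\mathscr{Q}_{n-2}\to\cdots\to\mathscr{Q}_0\to\underline{\mathbb{Z}}\to0$ (with $\mathscr{Q}_{-1}:=\underline{\mathbb{Z}}$),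 where $\mathscr{R}_c=(\mathscr{A}\oplus\mathscr{Q}_{n-1})/\{(c(q),-\vartheta_n(q)):q\in\mathscr{Q}_n\}$, the first map is $a\mapsto[a,0]$, the second $[a,p]\mapsto\vartheta_{n-1}(p)$, and the others are the $\vartheta_i$; for $n=0$, $\rho^0_{\mathscr{Q}}(c)$ is the unique $\tilde{c}$ with $c=\tilde{c}\circ\vartheta_0$. $\rho^n_{\mathscr{P}}$ and $\rho^n_{\underline{P}}$ are the cases $\mathscr{Q}=\mathscr{P}$ and $\mathscr{Q}=\{\underline{P^n},\underline{d_n}\}$. - $\psi_n^*$ is induced by $c\mapsto c\circ\psi_n$, where $\psi_n:\underline{P^n}\to\mathscr{P}_n$ is $\psi_n([(x,m,y),(\lambda_1,\dots,\lambda_n)])=(-1)^{\lceil n/2\rceil}[\gamma_0,\dots,\gamma_n]$ with $\gamma_0=(x,m,y)$, $\gamma_1=(y,-d(\lambda_n),\lambda_ny)$, $\gamma_2=(\lambda_ny,-d(\lambda_{n-1}),\lambda_{n-1}\lambda_ny)$, …, $\gamma_n=(\lambda_2\cdots\lambda_ny,-d(\lambda_1),\lambda_1\cdots\lambda_ny)$. - $\kappa^n$ ($n\le2$) is the map of Kumjian, Pask and Sims, given on categorical cocycles by their formulas, the values being read in the stalks of $\underline{\mathcal{A}}$ through the maps $\varphi^x_p$ (which are identities when $\mathcal{A}=A^\Lambda$ is constant, the case in which they wrote the formulas). $\kappa^0[f]$ is the class of $y\mapsto\varphi^y_0(f(r(y)))$. $\kappa^1[c]$ is the class of $(y,\ell-j,z)\mapsto\varphi^y_\ell\big(c(y(0,\ell))-c(z(0,j))\big)$,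 where $\sigma^\ell(y)=\sigma^j(z)$. $\kappa^2[c]$, for $c$ a normalized representative (i.e. $c(r(\lambda),\lambda)=0=c(\lambda,s(\lambda))$; every class has one), is the class of $\sigma_c$ defined as follows. Choose a set $\mathcal{P}$ of pairs $(\mu,\nu)$ with $s(\mu)=s(\nu)$ such that the sets $Z(\mu,\nu)$, $(\mu,\nu)\in\mathcal{P}$, partition $\mathcal{G}_\Lambda$ and such that $(\lambda,s(\lambda))\in\mathcal{P}$ for all $\lambda\in\Lambda$; let $(\mu_g,\nu_g)\in\mathcal{P}$ be the pair with $g\in Z(\mu_g,\nu_g)$. For composable $(g,h)$ there are $\alpha,\beta,\gamma\in\Lambda$ and $y\in\Lambda^\infty$ with $\nu_g\alpha=\mu_h\beta$, $\mu_g\alpha=\mu_{gh}\gamma$, $\nu_h\beta=\nu_{gh}\gamma$, such that $g=(\mu_g\alpha y,d(\mu_g)-d(\nu_g),\nu_g\alpha y)$ and $h=(\mu_h\beta y,d(\mu_h)-d(\nu_h),\nu_h\beta y)$. Then, with $x=\mu_g\alpha y=r(g)$, $\sigma_c(g,h)=\varphi^x_{d(\mu_g\alpha)}\big(c(\mu_g,\alpha)-c(\nu_g,\alpha)+c(\mu_h,\beta)-c(\nu_h,\beta)-c(\mu_{gh},\gamma)+c(\nu_{gh},\gamma)\big)$; all six terms lie in $\mathcal{A}_{r(y)}$. This is well defined, a continuous 2-cocycle, and its class is independent of $\mathcal{P}$ and of the normalized representative. *)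

(* Defs.v *)
From HB Require Import structures.
From Stdlib Require Import Relation_Operators.
From mathcomp Require Import all_boot all_order all_algebra.
From mathcomp Require Import all_classical topology.
From mathcomp Require Import freeg.

Set Implicit Arguments.
Unset Strict Implicit.
Unset Printing Implicit Defensive.

Import Order.TTheory GRing.Theory Num.Theory.

Local Open Scope classical_set_scope.
Local Open Scope ring_scope.
Local Open Scope quotient_scope.

(* Categories, "arrows-only": one type of morphisms with range and source.    *)
(* [comp] is a total function, but it is only meaningful (and only            *)
(* axiomatised) on composable pairs.                                          *)

Record is_category (O M : Type) (rng src : M -> O) (idm : O -> M)
    (comp : M -> M -> M) : Prop := IsCategory {
  cat_rng_id : forall v, rng (idm v) = v;
  cat_src_id : forall v, src (idm v) = v;
  cat_rng_comp : forall a b, src a = rng b -> rng (comp a b) = rng a;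
  cat_src_comp : forall a b, src a = rng b -> src (comp a b) = src b;
  cat_idl : forall a, comp (idm (rng a)) a = a;
  cat_idr : forall a, comp a (idm (src a)) = a;
  cat_compA : forall a b c, src a = rng b -> src b = rng c ->
    comp a (comp b c) = comp (comp a b) c }.

Record category := Category {
  obj : choiceType;
  mor : choiceType;
  rng : mor -> obj;
  src : mor -> obj;
  idm : obj -> mor;
  comp : mor -> mor -> mor;
  categoryP : is_category rng src idm comp }.

Arguments rng {c}.
Arguments src {c}.
Arguments idm {c}.
Arguments comp {c}.

(* [hom v w] is the set of morphisms with range v and source w. *)
Record hom (C : category) (v w : obj C) := Hom {
  harr :> mor C;
  hom_rng : rng harr == v;
  hom_src : src harr == w }.

Section Hom.
Variable C : category.
Implicit Types u v w : obj C.

Definition hom_of (a : mor C) : hom (rng a) (src a) :=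
  Hom (eqxx (rng a)) (eqxx (src a)).

Lemma idh_rng v : rng (idm v) == v.
Proof. by rewrite (cat_rng_id (categoryP C)). Qed.

Lemma idh_src v : src (idm v) == v.
Proof. by rewrite (cat_src_id (categoryP C)). Qed.

Definition idh v : hom v v := Hom (idh_rng v) (idh_src v).

Lemma hom_composable u v w (a : hom u v) (b : hom v w) : src a = rng b.
Proof. by rewrite (eqP (hom_src a)) (eqP (hom_rng b)). Qed.

Lemma comph_rng u v w (a : hom u v) (b : hom v w) : rng (comp a b) == u.
Proof.
by rewrite (cat_rng_comp (categoryP C)) ?hom_rng//; exact: hom_composable.
Qed.

Lemma comph_src u v w (a : hom u v) (b : hom v w) : src (comp a b) == w.
Proof.
by rewrite (cat_src_comp (categoryP C)) ?hom_src//; exact: hom_composable.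
Qed.

Definition comph u v w (a : hom u v) (b : hom v w) : hom u w :=
  Hom (comph_rng a b) (comph_src a b).

Lemma hom_inj v w (a b : hom v w) : a = b :> mor C -> a = b.
Proof.
case: a b => [a ra sa] [b rb sb] /= ab; subst b.
by rewrite (bool_irrelevance ra rb) (bool_irrelevance sa sb).
Qed.

End Hom.

Record functor (C D : category) := Functor {
  fobj :> obj C -> obj D;
  fmor : mor C -> mor D;
  fmor_rng : forall a, rng (fmor a) = fobj (rng a);
  fmor_src : forall a, src (fmor a) = fobj (src a);
  fmor_id : forall v, fmor (idm v) = idm (fobj v);
  fmor_comp : forall a b, src a = rng b ->
    fmor (comp a b) = comp (fmor a) (fmor b) }.

Section FunctorComp.
Variables (C D E : category) (G : functor D E) (F : functor C D).

Lemma fcomp_rng a : rng (fmor G (fmor F a)) = G (F (rng a)).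
Proof. by rewrite !fmor_rng. Qed.

Lemma fcomp_src a : src (fmor G (fmor F a)) = G (F (src a)).
Proof. by rewrite !fmor_src. Qed.

Lemma fcomp_id v : fmor G (fmor F (idm v)) = idm (G (F v)).
Proof. by rewrite !fmor_id. Qed.

Lemma fcomp_comp a b : src a = rng b ->
  fmor G (fmor F (comp a b)) =
  comp (fmor G (fmor F a)) (fmor G (fmor F b)).
Proof.
by move=> ab; rewrite !fmor_comp//; rewrite fmor_src fmor_rng ab.
Qed.

Definition fcomp : functor C E :=
  Functor fcomp_rng fcomp_src fcomp_id fcomp_comp.

End FunctorComp.

(* Composable tuples are represented by sequences of morphisms. The boolean   *)
(* [ischain v t] says that t is composable and that its first entry has range *)
(* v. Since it also makes sense for the empty tuple,                          *)
(* {v & chainfrom n v} is C^{*n}, with C^{*0} = Obj(C).                       *)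
Section Chains.
Variable C : category.
Implicit Types (v w : obj C) (a b : mor C) (t : seq (mor C)).

Fixpoint ischain v t : bool :=
  if t is a :: t' then (rng a == v) && ischain (src a) t' else true.

Definition chainfrom (n : nat) v := {t : seq (mor C) | (size t == n) && ischain v t}.

Definition endsat v t : bool :=
  if t is a :: t' then ischain (rng a) t && (src (last a t') == v) else false.

(* n-tuples with source v; meant for n >= 1 *)
Definition chainto (n : nat) v := {t : seq (mor C) | (size t == n) && endsat v t}.

HB.instance Definition _ n v := Choice.on (chainfrom n v).
HB.instance Definition _ n v := Choice.on (chainto n v).

(* [merge i t] composes the entries of index i and i+1 of t. *)
Fixpoint merge (i : nat) t : seq (mor C) :=
  match i, t with
  | 0%N, a :: b :: t' => comp a b :: t'
  | j.+1, a :: t' => a :: merge j t'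
  | _, _ => t
  end.

Definition mulhead a t : seq (mor C) :=
  if t is b :: t' then comp a b :: t' else [::].

Fixpoint mullast t a : seq (mor C) :=
  match t with
  | [::] => [::]
  | [:: b] => [:: comp b a]
  | b :: t' => b :: mullast t' a
  end.

End Chains.

Definition fam (I : Type) (Q : I -> Type) (A : I -> zmodType) :=
  forall i, Q i -> A i.

Section Fam.
Variables (I : Type) (Q : I -> Type) (A : I -> zmodType).
Local Notation F := (fam Q A).

HB.instance Definition _ := gen_eqMixin F.
HB.instance Definition _ := gen_choiceMixin F.

Definition fam0 : F := fun i q => 0.
Definition famN (f : F) : F := fun i q => - f i q.
Definition famD (f g : F) : F := fun i q => f i q + g i q.

Lemma famDA : associative famD.
Proof. by move=> f g h; apply/functional_extensionality_dep => i; apply/funext => q; exact: addrA. Qed.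

Lemma famDC : commutative famD.
Proof. by move=> f g; apply/functional_extensionality_dep => i; apply/funext => q; exact: addrC. Qed.

Lemma fam0D : left_id fam0 famD.
Proof. by move=> f; apply/functional_extensionality_dep => i; apply/funext => q; exact: add0r. Qed.

Lemma famND : left_inverse fam0 famN famD.
Proof. by move=> f; apply/functional_extensionality_dep => i; apply/funext => q; exact: addNr. Qed.

HB.instance Definition _ := GRing.isZmodule.Build F famDA famDC fam0D famND.

End Fam.

(* [{freeg K}] is the free abelian group on K; [flift f] is the additive      *)
(* extension of f.                                                            *)
Section FreeLift.
Variables (K : choiceType) (V : zmodType) (f : K -> V).

Definition flift (D : {freeg K}) : V :=
  fglift (f : K -> zmodule V) D.

Lemma flift_is_zmod_morphism : zmod_morphism flift.
Proof. exact: (lift_is_additive (M := zmodule V) f). Qed.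

HB.instance Definition _ :=
  GRing.isZmodMorphism.Build {freeg K} V flift flift_is_zmod_morphism.

Lemma fliftU k : flift << k >> = f k.
Proof. by rewrite /flift liftU scale1r. Qed.

End FreeLift.

Section FreeExt.
Variables (K : choiceType) (V : zmodType).

Lemma freeg_ext (f g : {additive {freeg K} -> V}) :
  (forall k, f << k >> = g << k >>) -> f =1 g.
Proof.
move=> fg D; rewrite -[D]freeg_sumE !raddf_sum; apply: eq_bigr => k _.
have -> : << coeff k D *g k >> = << k >> *~ coeff k D :> {freeg K}.
  by rewrite freegU_mulz intz.
by rewrite !raddfMz fg.
Qed.

End FreeExt.

(* Quotient of V by the subgroup generated by the set N. *)
Section QuotientGroup.
Variables (V : zmodType) (N : set V).

Definition gensub : set V :=
  [set z | forall H : set V,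
     H 0 -> (forall a b, H a -> H b -> H (a - b)) -> N `<=` H -> H z].

Lemma gensub0 : gensub 0.
Proof. by move=> H H0. Qed.

Lemma gensubB a b : gensub a -> gensub b -> gensub (a - b).
Proof.
by move=> ga gb H H0 HB NH; exact: HB (ga H H0 HB NH) (gb H H0 HB NH).
Qed.

Lemma gensubN a : gensub a -> gensub (- a).
Proof. by move=> ga; rewrite -sub0r; apply: gensubB => //; exact: gensub0. Qed.

Lemma gensubD a b : gensub a -> gensub b -> gensub (a + b).
Proof. by move=> ga gb; rewrite -[b]opprK; apply: gensubB; last exact: gensubN. Qed.

Definition qrel (a b : V) : bool := `[< gensub (a - b) >].

Lemma qrel_refl : reflexive qrel.
Proof. by move=> a; apply/asboolP; rewrite subrr; exact: gensub0. Qed.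

Lemma qrel_sym : symmetric qrel.
Proof.
by move=> a b; apply/asboolP/asboolP => ab; rewrite -opprB; exact: gensubN.
Qed.

Lemma qrel_trans : transitive qrel.
Proof.
move=> b a c /asboolP ab /asboolP bc; apply/asboolP.
by rewrite -[a - c](subrKA b); exact: gensubD.
Qed.

Canonical qrel_equiv := EquivRel qrel qrel_refl qrel_sym qrel_trans.

Definition qgroup := {eq_quot qrel}.

HB.instance Definition _ := Choice.on qgroup.
HB.instance Definition _ := EqQuotient.on qgroup.

Definition qpi (a : V) : qgroup := \pi_qgroup a.

Lemma qpiE a b : qpi a = qpi b <-> gensub (a - b).
Proof.
rewrite /qpi; split=> [/eqP|/asboolP ab]; first by rewrite piE => /asboolP.
by apply/eqP; rewrite piE.
Qed.

Definition q0 : qgroup := qpi 0.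
Definition qN (x : qgroup) : qgroup := qpi (- repr x).
Definition qD (x y : qgroup) : qgroup := qpi (repr x + repr y).

Lemma repr_qpi a : gensub (repr (qpi a) - a).
Proof. by apply/qpiE; rewrite /qpi reprK. Qed.

Lemma qND a : qN (qpi a) = qpi (- a).
Proof. by apply/qpiE; rewrite -opprD; exact: gensubN (repr_qpi a). Qed.

Lemma qDD a b : qD (qpi a) (qpi b) = qpi (a + b).
Proof.
apply/qpiE; rewrite opprD addrACA.
exact: gensubD (repr_qpi a) (repr_qpi b).
Qed.

Lemma qpi_surj (x : qgroup) : x = qpi (repr x).
Proof. by rewrite /qpi reprK. Qed.

Lemma qDA : associative qD.
Proof.
by move=> x y z; rewrite (qpi_surj x) (qpi_surj y) (qpi_surj z) !qDD addrA.
Qed.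

Lemma qDC : commutative qD.
Proof. by move=> x y; rewrite (qpi_surj x) (qpi_surj y) !qDD addrC. Qed.

Lemma q0D : left_id q0 qD.
Proof. by move=> x; rewrite (qpi_surj x) qDD add0r. Qed.

Lemma qNDl : left_inverse q0 qN qD.
Proof. by move=> x; rewrite (qpi_surj x) qND qDD addNr. Qed.

HB.instance Definition _ := GRing.isZmodule.Build qgroup qDA qDC q0D qNDl.

End QuotientGroup.

Definition transp (I : Type) (A : I -> zmodType) (i j : I) (e : i = j) (a : A i) :
  A j := ecast l (A l) e a.

(* Cohomology. A cochain complex consists, in each degree, of a set of        *)
(* cochains [cmem n] inside an ambient group, and of a boundary map.          *)
(* Cohomology classes are represented as sets of cocycles, so H^n is a set of *)
(* sets of cocycles.                                                          *)
Record cochain_complex := CochainComplex {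
  cgrp : nat -> zmodType;
  cmem : forall n, set (cgrp n);
  cdiff : forall n, cgrp n -> cgrp n.+1 }.

Section Cohomology.
Variable C : cochain_complex.

Definition cocycles n : set (cgrp C n) :=
  [set c | cmem c /\ cdiff c = 0].

Definition coboundaries n : set (cgrp C n) :=
  match n return set (cgrp C n) with
  | 0%N => [set 0]
  | m.+1 => @cdiff C m @` @cmem C m
  end.

Definition cls n (c : cgrp C n) : set (cgrp C n) :=
  [set c' | cocycles c' /\ coboundaries (c' - c)].

Definition cohomology n : set (set (cgrp C n)) := @cls n @` @cocycles n.

End Cohomology.

Arguments cls {C n}.
Arguments cohomology : clear implicits.

(* The map on cohomology classes induced by a relation between cochains: the  *)
(* image of K is the union of the classes of all c' related to some c in K.   *)
(* Since cochains that are not cocycles have an empty class, it is a          *)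
(* cohomology class exactly when some c' is a cocycle and any two such c'     *)
(* that are cocycles are cohomologous.                                        *)
Definition induced_rel (C D : cochain_complex) n
    (R : cgrp C n -> cgrp D n -> Prop) (K : set (cgrp C n)) : set (cgrp D n) :=
  \bigcup_(c' in [set c' | exists2 c, K c & R c c']) cls c'.

Definition induced (C D : cochain_complex) n
    (F : cgrp C n -> cgrp D n) : set (cgrp C n) -> set (cgrp D n) :=
  induced_rel (fun c c' => c' = F c).

Record rmodule (C : category) := RModule {
  mob :> obj C -> zmodType;
  mmap : forall v w, hom v w -> {additive mob v -> mob w};
  mmap_id : forall v a, mmap (idh v) a = a;
  mmap_comp : forall u v w (x : hom u v) (y : hom v w) a,
    mmap (comph x y) a = mmap y (mmap x a) }.

Arguments mmap {C} r {v w}.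

Section ConstModule.
Variables (C : category) (A : zmodType).

Definition const_rmodule : rmodule C :=
  @RModule C (fun=> A) (fun _ _ _ => idfun) (fun _ _ => erefl)
    (fun _ _ _ _ _ _ => erefl).

End ConstModule.

Section FreeResolution.
Variable C : category.
Implicit Types (u v w : obj C) (t : seq (mor C)).

Definition Pob (n : nat) v : zmodType := {freeg (chainto n.+1 v)}.

(* The generator [t] of P^n_v; by convention [t] = 0 if t is not one of the   *)
(* (n+1)-tuples generating P^n_v.                                             *)
Definition Pgen (n : nat) v t : Pob n v :=
  if insub t is Some u then << u : chainto n.+1 v >> else 0.

Lemma mullast_chain v a t : ischain v t -> rng a = src (last a t) ->
  t != [::] -> ischain v (mullast t a).
Proof.
elim: t v => // b [|c t] IH v /=.
  move=> /andP[/eqP rb _] ra _.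
  by rewrite (cat_rng_comp (categoryP C))// rb eqxx.
move=> /andP[rb ct] ra _; rewrite rb /=.
exact: IH.
Qed.

Lemma size_mullast t a : size (mullast t a) = size t.
Proof. by elim: t => // b [|c t] //= ->. Qed.

Lemma rng_mullast a b t : src (last b t) = rng a ->
  rng (head b (mullast (b :: t) a)) = rng b.
Proof. by case: t => [|c t] //= h; rewrite (cat_rng_comp (categoryP C)). Qed.

Lemma src_mullast a b t x : src (last b t) = rng a ->
  src (last x (mullast (b :: t) a)) = src a.
Proof.
elim: t b x => [|c t IH] b x h.
  by rewrite /= (cat_src_comp (categoryP C)).
exact: IH.
Qed.

Lemma endsat_mullast v w (a : hom v w) t :
  endsat v t -> endsat w (mullast t a).
Proof.
case: t => // b t; rewrite [endsat v _]/= eqxx => /andP[ct /eqP lt].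
have sl : src (last b t) = rng a by rewrite lt (eqP (hom_rng a)).
have cm : ischain (rng b) (mullast (b :: t) a).
  by apply: mullast_chain => //=; rewrite ?eqxx.
have := src_mullast b sl; have := rng_mullast sl; move: cm.
have := size_mullast (b :: t) a; case: (mullast (b :: t) a) => [|c s] // _.
rewrite /= => /andP[_ ->] _ ->; by rewrite eqxx (eqP (hom_src a)) eqxx.
Qed.

Lemma mullast_id v t : endsat v t -> mullast t (idh v) = t.
Proof.
case: t => // b t /= /andP[_]; elim: t b => [|c t IH] b /= /eqP h.
  by rewrite -h (cat_idr (categoryP C)).
by rewrite -[in RHS](IH c)//; apply/eqP.
Qed.

Lemma mullast_comp u v w (x : hom u v) (y : hom v w) t : endsat u t ->
  mullast t (comph x y) = mullast (mullast t x) y.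
Proof.
case: t => // b t /= /andP[_]; elim: t b => [|c t IH] b /eqP h.
  rewrite /= (cat_compA (categoryP C))//; last exact: hom_composable.
  by rewrite [LHS]h (eqP (hom_rng x)).
have {}IH : mullast (c :: t) (comph x y) = mullast (mullast (c :: t) x) y.
  by apply: IH; apply/eqP.
rewrite [LHS]/= -/(mullast (c :: t) (comph x y)) IH.
by case: t {IH h} => [|d t].
Qed.

Definition Pmap (n : nat) v w (a : hom v w) : Pob n v -> Pob n w :=
  flift (fun t : chainto n.+1 v => Pgen n w (mullast (val t) a)).

Arguments Pmap n {v w}.

HB.instance Definition _ n v w (a : hom v w) :=
  GRing.Additive.copy (Pmap n a)
    (flift (fun t : chainto n.+1 v => Pgen n w (mullast (val t) a))).

Lemma PgenE n v (t : chainto n.+1 v) : Pgen n v (val t) = << t >>.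
Proof. by rewrite /Pgen valK. Qed.

Lemma Pmap_gen n v w (a : hom v w) (t : chainto n.+1 v) :
  Pmap n a << t >> = Pgen n w (mullast (val t) a).
Proof. by rewrite /Pmap fliftU. Qed.

Lemma mullast_chainto n v w (a : hom v w) (t : chainto n.+1 v) :
  (size (mullast (val t) a) == n.+1) && endsat w (mullast (val t) a).
Proof.
by case: t => t /= /andP[st et]; rewrite size_mullast st endsat_mullast.
Qed.

Lemma Pmap_id n v a : Pmap n (idh v) a = a.
Proof.
apply: (freeg_ext (f := Pmap n (idh v)) (g := idfun)) => t.
by rewrite /= Pmap_gen mullast_id ?PgenE//; case: t => t /= /andP[].
Qed.

Lemma Pmap_comp n u v w (x : hom u v) (y : hom v w) a :
  Pmap n (comph x y) a = Pmap n y (Pmap n x a).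
Proof.
apply: (freeg_ext (f := Pmap n (comph x y)) (g := Pmap n y \o Pmap n x)) => t.
rewrite /= !Pmap_gen mullast_comp; last by case: t => t /= /andP[].
have h := mullast_chainto x t.
pose t' : chainto n.+1 v :=
  exist (fun s => is_true ((size s == n.+1) && endsat v s)) _ h.
by rewrite -[mullast (val t) x]/(val t') PgenE Pmap_gen.
Qed.

Definition Pmod (n : nat) : rmodule C :=
  @RModule C (Pob n) (fun v w a => Pmap n a) (@Pmap_id n) (@Pmap_comp n).

(* [Pd n] is d_{n+1} and [Pd0] is d_0. *)
Definition Pd (n : nat) v : Pmod n.+1 v -> Pmod n v :=
  flift (fun t : chainto n.+2 v => Pgen n v (behead (val t)) +
    \sum_(1 <= i < n.+2) Pgen n v (merge i.-1 (val t)) *~ (-1) ^+ i).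

Definition Pd0 v : Pmod 0 v -> const_rmodule C int v := flift (fun=> 1 : int).

Definition modfam (A B : rmodule C) : zmodType :=
  fam (fun v => mob A v : Type) (mob B).

Definition is_natural (A B : rmodule C) (f : modfam A B) : Prop :=
  (forall v, zmod_morphism (f v)) /\
  (forall v w (x : hom v w) a, f w (mmap A x a) = mmap B x (f v a)).

Definition mod_complex (A : rmodule C) : cochain_complex :=
  @CochainComplex (fun n => modfam (Pmod n) A)
    (fun n => [set f | is_natural f])
    (fun n f => fun v q => f v (Pd q)).

(* The categorical cochain of f: c(t) = f([t, s(t)]), where w is the source   *)
(* of t, or t is empty and c(w) = f([w]). For t with source other than w the  *)
(* value is 0.                                                                *)
Definition catcochain (A : rmodule C) n (f : modfam (Pmod n) A) w t : A w :=
  f w (Pgen n w (rcons t (idm w))).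

End FreeResolution.

Arguments Pmod {C} n.

(* Groupoids with a topology on the unit space and on the arrows. Continuity  *)
(* of the structure maps and etaleness are not part of the record.            *)

Record groupoid := Groupoid {
  unit_space : topologicalType;
  arrow : topologicalType;
  grng : arrow -> unit_space;
  gsrc : arrow -> unit_space;
  gid : unit_space -> arrow;
  gmul : arrow -> arrow -> arrow;
  ginv : arrow -> arrow;
  groupoidP : is_category grng gsrc gid gmul;
  grng_inv : forall g, grng (ginv g) = gsrc g;
  gsrc_inv : forall g, gsrc (ginv g) = grng g;
  gmulV : forall g, gmul g (ginv g) = gid (grng g);
  gmulVg : forall g, gmul (ginv g) g = gid (gsrc g) }.

Coercion cat_of_groupoid (G : groupoid) : category := Category (groupoidP G).

Record total (X : Type) (S : X -> zmodType) := Total {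
  tpt : X;
  tval : S tpt }.

Arguments Total {X S} tpt tval.
Arguments tpt {X S}.
Arguments tval {X S}.

HB.instance Definition _ X S := gen_eqMixin (@total X S).
HB.instance Definition _ X S := gen_choiceMixin (@total X S).

(* The data of a G-sheaf: stalks, action, and a subbase of the topology of    *)
(* the total space. The axioms are in [is_sheaf].                             *)
Record sheaf (G : groupoid) := Sheaf {
  stalk :> unit_space G -> zmodType;
  act : forall x y : unit_space G, @hom G x y -> stalk y -> stalk x;
  subbase : set (set (total stalk)) }.

Arguments act {G} s {x y}.
Arguments subbase {G} s.

Definition etale (G : groupoid) (A : sheaf G) := total (stalk A).

HB.instance Definition _ G A := Choice.on (@etale G A).
HB.instance Definition _ G A :=
  @isSubBaseTopological.Build (@etale G A)
    (set (total (stalk A))) (subbase A) id.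

Definition local_homeomorphism (X Y : topologicalType) (f : X -> Y) : Prop :=
  forall x, exists U : set X, [/\ open U, U x, open (f @` U) &
    exists g : Y -> X, [/\ {within U, continuous f},
      {within f @` U, continuous g} & forall u, U u -> g (f u) = u]].

Section Sheaves.
Variable G : groupoid.
Implicit Types (A B : sheaf G).

Definition shproj A : etale A -> unit_space G := fun e => tpt e.

(* The sum A + B; its total space is the fibre product of those of A and B.   *)
Definition sum_stalk A B (x : unit_space G) : zmodType := (A x * B x)%type.

Definition sum_pair A B : total (sum_stalk A B) -> etale A * etale B :=
  fun e => (Total (tpt e) (tval e).1 : etale A,
            Total (tpt e) (tval e).2 : etale B).

Definition sum_sheaf A B : sheaf G :=
  @Sheaf G (sum_stalk A B)
    (fun x y g ab => (act A g ab.1, act B g ab.2))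
    [set W | exists2 V : set (etale A * etale B), open V &
       W = @sum_pair A B @^-1` V].

Definition shadd A : etale (sum_sheaf A A) -> etale A :=
  fun e => Total (tpt e) ((tval e).1 + (tval e).2).

Definition shopp A : etale A -> etale A := fun e => Total (tpt e) (- tval e).

Definition shzero A : unit_space G -> etale A := fun x => Total x 0.

(* The set of pairs (g, a) with a in the stalk at s(g), topologised as a      *)
(* subspace of the product of the arrow space and of the total space.         *)
Definition action_dom A := {g : arrow G & A (gsrc g)}.

Definition action_pair A : action_dom A -> arrow G * etale A :=
  fun e => (tag e, Total (gsrc (tag e)) (tagged e) : etale A).

Definition action_map A : initial_topology (@action_pair A) -> etale A :=
  fun e => Total (grng (tag e)) (act A (@hom_of G (tag e)) (tagged e)).

Definition is_sheaf A : Prop :=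
  [/\ local_homeomorphism (@shproj A),
      [/\ continuous (@shadd A), continuous (@shopp A) &
          continuous (@shzero A)],
      (forall (x y : unit_space G) (g : @hom G x y), zmod_morphism (act A g)),
      (forall (x : unit_space G) (a : A x), act A (@idh G x) a = a) /\
      (forall (x y z : unit_space G) (g : @hom G x y) (h : @hom G y z) (a : A z),
         act A (comph g h) a = act A g (act A h a)) &
      continuous (@action_map A)].

Definition shfam A B : zmodType := fam (fun x => stalk A x : Type) (stalk B).

Definition tmap A B (f : shfam A B) : etale A -> etale B :=
  fun e => Total (tpt e) (f _ (tval e)).

Definition is_shmor A B (f : shfam A B) : Prop :=
  [/\ continuous (tmap f), (forall x, zmod_morphism (f x)) &
      (forall (x y : unit_space G) (g : @hom G x y) (a : A y),
         f x (act A g a) = act B g (f y a))].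

(* The constant sheaf: the total space is the product of the unit space and   *)
(* of the discrete group V.                                                   *)
Definition const_sheaf (V : zmodType) : sheaf G :=
  @Sheaf G (fun=> V) (fun x y g a => a)
    [set W | exists (U : set (unit_space G)) (a : V), open U /\
       W = [set e | U (tpt e) /\ tval e = a]].

Definition ZZ : sheaf G := const_sheaf int.

Record augcomplex := AugComplex {
  rterm :> nat -> sheaf G;
  rbd : forall n, shfam (rterm n.+1) (rterm n);
  raug : shfam (rterm 0) ZZ }.

Arguments rbd a n i _ : clear implicits.
Arguments raug a i _ : clear implicits.

(* H^n_Q(G, A) is the cohomology of [hom_complex Q A]. *)
Definition hom_complex (Q : augcomplex) A : cochain_complex :=
  @CochainComplex (fun n => shfam (Q n) A)
    (fun n => [set f | is_shmor f])
    (fun n f => fun x q => f x (rbd Q n x q)).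

(* The space G^(n) of composable n-tuples; its topology is induced from the   *)
(* product of n copies of the arrow space, together with the range of the     *)
(* first entry (which only matters when n = 0).                               *)
Record gtuple (n : nat) := GTuple {
  gstart : unit_space G;
  gchain : @chainfrom G n gstart }.

HB.instance Definition _ n := gen_eqMixin (gtuple n).
HB.instance Definition _ n := gen_choiceMixin (gtuple n).

Definition gtuple_coord n (t : gtuple n) :
    unit_space G * prod_topology (fun _ : 'I_n => arrow G) :=
  (gstart t, fun i : 'I_n => nth (gid (gstart t)) (val (gchain t)) i).

HB.instance Definition _ n :=
  Topological.copy (gtuple n) (initial_topology (@gtuple_coord n)).

Definition gP_stalk (n : nat) (x : unit_space G) : zmodType :=
  {freeg (@chainfrom G n.+1 x)}.

(* The generator [t]; by convention [t] = 0 if t is not a composable          *)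
(* (n+1)-tuple with range x.                                                  *)
Definition gP_gen (n : nat) (x : unit_space G) (t : seq (arrow G)) : gP_stalk n x :=
  if insub t is Some u then << u : @chainfrom G n.+1 x >> else 0.

(* A local section e over U of (g_0, ..., g_n) |-> r(g_0) is given by its     *)
(* values in the fibres; its values outside of U are irrelevant.              *)
Definition local_section n (U : set (unit_space G))
    (e : forall z, @chainfrom G n.+1 z) : Prop :=
  {within U, continuous (fun z => GTuple (e z))} /\
  open ((fun z => GTuple (e z)) @` U).

Definition gP_act n (x y : unit_space G) (g : @hom G x y) :
    gP_stalk n y -> gP_stalk n x :=
  flift (fun t : @chainfrom G n.+1 y => gP_gen n x (mulhead (harr g) (val t))).

Definition gP_term (n : nat) : sheaf G :=
  @Sheaf G (gP_stalk n) (@gP_act n)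
    [set W | exists (U : set (unit_space G)) (k : nat) (a : 'I_k -> int)
        (e : 'I_k -> forall z, @chainfrom G n.+1 z),
      [/\ open U, (forall i, local_section U (e i)) &
          W = [set Total z (\sum_(i < k) << e i z >> *~ a i) | z in U]]].

Definition gP_bd n : shfam (gP_term n.+1) (gP_term n) := fun x =>
  flift (fun t : @chainfrom G n.+2 x =>
    gP_gen n x (take n.+1 (val t)) *~ (-1) ^+ n.+1 +
    \sum_(1 <= i < n.+2) gP_gen n x (merge i.-1 (val t)) *~ (-1) ^+ i.-1).

Definition gP_aug : shfam (gP_term 0) ZZ := fun x => flift (fun=> 1 : int).

Definition gP : augcomplex := @AugComplex gP_term gP_bd gP_aug.

Definition ccochain A (n : nat) : zmodType :=
  fam (fun x => @chainfrom G n x : Type) (stalk A).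

(* The value f(t) at a composable n-tuple t with range x; 0 for other t. *)
Definition ceval A n (f : ccochain A n) (x : unit_space G) (t : seq (arrow G)) : A x :=
  if insub t is Some u then f x u else 0.

(* The action of g on the stalk at s(g), with values in the stalk at r(g),    *)
(* for r(g) = x.                                                              *)
Definition act_at A (x : unit_space G) (g : arrow G) (a : A (gsrc g)) : A x :=
  if pselect (grng g == x) is left gx
  then act A (@Hom G x (gsrc g) g gx (eqxx _)) a else 0.

Definition cc_diff A n (f : ccochain A n) : ccochain A n.+1 := fun x u =>
  if val u is g :: t then
    act_at x (ceval f (gsrc g) t)
    + \sum_(1 <= i < n.+1) ceval f x (merge i.-1 (g :: t)) *~ (-1) ^+ i
    + ceval f x (take n (g :: t)) *~ (-1) ^+ n.+1
  else 0.

Definition ccochain_map A n (f : ccochain A n) : gtuple n -> etale A :=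
  fun t => Total (gstart t) (f _ (gchain t)).

(* H^n_c(G, A) is the cohomology of [cont_complex A]. *)
Definition cont_complex A : cochain_complex :=
  @CochainComplex (ccochain A) (fun n => [set f | continuous (ccochain_map f)])
    (fun n f => cc_diff f).

Definition eta_cochain A n (f : ccochain A n) : shfam (gP_term n) A := fun x =>
  flift (fun u : @chainfrom G n.+1 x =>
    if val u is g :: t then act_at x (ceval f (gsrc g) t) else 0).

Definition eta A n : set (cgrp (cont_complex A) n) -> set (cgrp (hom_complex gP A) n) :=
  @induced (cont_complex A) (hom_complex gP A) n (@eta_cochain A n).

(* Sequences A -> R_{n-1} -> ... -> R_0 -> Z. *)
Fixpoint ext_seq (n : nat) A : Type :=
  match n with
  | 0%N => shfam A ZZ
  | m.+1 => {R : sheaf G & (shfam A R * ext_seq m R)%type}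
  end.

(* The sequence is exact and consists of G-sheaves and morphisms of           *)
(* G-sheaves, the kernel of its first map being K. Exactness in the abelian   *)
(* category of G-sheaves is exactness on stalks.                              *)
Fixpoint ext_exact (n : nat) A (K : forall x, set (A x)) : ext_seq n A -> Prop :=
  match n return ext_seq n A -> Prop with
  | 0%N => fun f =>
      [/\ is_shmor f, (forall x a, f x a = 0 <-> K x a) &
          (forall x m, exists a, f x a = m)]
  | m.+1 => fun E =>
      [/\ is_sheaf (projT1 E), is_shmor (projT2 E).1,
          (forall x a, (projT2 E).1 x a = 0 <-> K x a) &
          @ext_exact m (projT1 E) (fun x => range ((projT2 E).1 x))
            (projT2 E).2]
  end.

(* 0 -> A -> R_{n-1} -> ... -> R_0 -> Z -> 0 is exact *)
Definition is_extension n A (E : ext_seq n A) : Prop :=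
  ext_exact (fun x => [set 0]) E.

(* There is a morphism of sequences with first component f : A -> B and last  *)
(* component the identity of Z.                                               *)
Fixpoint ext_mor (n : nat) A B (f : shfam A B) :
    ext_seq n A -> ext_seq n B -> Prop :=
  match n return ext_seq n A -> ext_seq n B -> Prop with
  | 0%N => fun s t => forall x a, t x (f x a) = s x a
  | m.+1 => fun E F => exists g : shfam (projT1 E) (projT1 F),
      [/\ is_shmor g,
          (forall x a, g x ((projT2 E).1 x a) = (projT2 F).1 x (f x a)) &
          @ext_mor m _ _ g (projT2 E).2 (projT2 F).2]
  end.

Definition ext_step n A (E F : ext_seq n A) : Prop :=
  [/\ is_extension E, is_extension F & ext_mor (fun x a => a) E F].

Definition ext_equiv n A : ext_seq n A -> ext_seq n A -> Prop :=
  clos_refl_sym_trans _ (@ext_step n A).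

(* Elements of H^n(G, A) are represented as predicates on [yoneda n A]: for   *)
(* n = 0 the singletons of morphisms Z -> A, for n >= 1 the equivalence       *)
(* classes of extensions.                                                     *)
Definition yoneda (n : nat) A : Type :=
  if n is m.+1 then ext_seq m.+1 A else shfam ZZ A.

Section Rho.
Variables (Q : augcomplex) (A : sheaf G).

(* Q_n -> Q_{n-1} -> ... -> Q_0 -> Z *)
Fixpoint qtail (n : nat) : ext_seq n (Q n) :=
  match n return ext_seq n (Q n) with
  | 0%N => raug Q
  | m.+1 => existT _ (rterm Q m) (rbd Q m, qtail m)
  end.

Section RQuotient.
Variables (n : nat) (c : shfam (Q n.+1) A).

(* For a cocycle c this set is already a subgroup. *)
Definition rquot_rel (x : unit_space G) : set (A x * Q n x)%type :=
  [set z | exists q : Q n.+1 x, z = (@c x q, - rbd Q n x q)].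

Definition rquot_stalk x : zmodType :=
  qgroup (V := (A x * Q n x)%type) (@rquot_rel x).

Definition rquot_pi : etale (sum_sheaf A (Q n)) -> total rquot_stalk :=
  fun e => Total (tpt e) (qpi (@rquot_rel (tpt e)) (tval e)).

(* (A + Q_n) / {(c(q), - rbd(q)) : q in Q_{n+1}}, with the quotient topology *)
Definition rquot : sheaf G :=
  @Sheaf G rquot_stalk
    (fun x y g u => qpi (@rquot_rel x) (act (sum_sheaf A (Q n)) g (repr u)))
    [set W | open (rquot_pi @^-1` W)].

Definition rquot_in : shfam A rquot := fun x a => qpi (@rquot_rel x) (a, 0).

End RQuotient.

(* R_c -> Q_{n-1} -> ... -> Q_0 -> Z, for c : Q_{n+1} -> A *)
Definition rquot_tail (n : nat) : forall c : shfam (Q n.+1) A, ext_seq n (rquot c) :=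
  match n return forall c : shfam (Q n.+1) A, ext_seq n (rquot c) with
  | 0%N => fun c x u => raug Q x (repr (u : rquot_stalk c x)).2
  | m.+1 => fun c => existT _ (rterm Q m)
      ((fun x u => rbd Q m x (repr (u : rquot_stalk c x)).2), qtail m)
  end.

Definition yoneda_seq (n : nat) (c : shfam (Q n.+1) A) : ext_seq n.+1 A :=
  existT _ (rquot c) (rquot_in c, rquot_tail c).

Definition rho (n : nat) : set (cgrp (hom_complex Q A) n) -> yoneda n A -> Prop :=
  match n return set (shfam (Q n) A) -> yoneda n A -> Prop with
  | 0%N => fun K c' => is_shmor c' /\
      exists2 c, K c & forall x q, c x q = c' x (raug Q x q)
  | m.+1 => fun K E => is_extension E /\
      exists2 c, K c & ext_equiv (yoneda_seq c) E
  end.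

End Rho.

End Sheaves.

Notation degree k := {ffun 'I_k -> nat}.
Notation zdegree k := {ffun 'I_k -> int}.

Section Degrees.
Variable k : nat.
Implicit Types m n p : degree k.

Definition ledeg m n : bool := [forall i, (m i <= n i)%N].
Definition subdeg m n : degree k := [ffun i => (m i - n i)%N].
Definition zdeg m : zdegree k := [ffun i => (m i)%:Z].

Lemma ledegP m n : reflect (forall i, (m i <= n i)%N) (ledeg m n).
Proof. exact: forallP. Qed.

Lemma ledegg m : ledeg m m.
Proof. by apply/ledegP => i. Qed.

Lemma ledeg_trans n m p : ledeg m n -> ledeg n p -> ledeg m p.
Proof.
by move=> /ledegP mn /ledegP np; apply/ledegP => i; exact: leq_trans (np i).
Qed.

Lemma ledeg0 m : ledeg 0 m.
Proof. by apply/ledegP => i; rewrite ffunE. Qed.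

Lemma ledeg_addl m n : ledeg m (m + n).
Proof. by apply/ledegP => i; rewrite ffunE leq_addr. Qed.

Lemma ledeg_addr m n : ledeg m (n + m).
Proof. by rewrite addrC ledeg_addl. Qed.

Lemma ledeg_add2r p m n : ledeg (m + p) (n + p) = ledeg m n.
Proof. by apply: eq_forallb => i; rewrite !ffunE leq_add2r. Qed.

Lemma subdeg_add2r p m n : subdeg (m + p) (n + p) = subdeg m n.
Proof. by apply/ffunP => i; rewrite !ffunE subnDr. Qed.

Lemma subdeg_trans m n p : ledeg m n -> ledeg n p ->
  subdeg p m = subdeg n m + subdeg p n.
Proof.
move=> /ledegP mn /ledegP np; apply/ffunP => i; rewrite !ffunE.
by rewrite [RHS]addnC addnBA// subnK.
Qed.

Lemma zdegD m n : zdeg (m + n) = zdeg m + zdeg n.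
Proof. by apply/ffunP => i; rewrite !ffunE. Qed.

Definition omega_mor := {mn : degree k * degree k | ledeg mn.1 mn.2}.
HB.instance Definition _ := Choice.on omega_mor.

Definition omk m n (mn : ledeg m n) : omega_mor :=
  exist (fun mn : degree k * degree k => is_true (ledeg mn.1 mn.2)) (m, n) mn.

Definition omega_rng (a : omega_mor) : degree k := (val a).1.
Definition omega_src (a : omega_mor) : degree k := (val a).2.
Definition omega_id m : omega_mor := omk (ledegg m).
Definition omega_comp (a b : omega_mor) : omega_mor :=
  insubd a ((val a).1, (val b).2).

Lemma val_omega_comp a b : omega_src a = omega_rng b ->
  val (omega_comp a b) = ((val a).1, (val b).2).
Proof.
move=> ab; rewrite val_insubd /= (ledeg_trans (valP a))//.
by rewrite [(val a).2]ab; exact: (valP b).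
Qed.

Lemma omega_category :
  is_category omega_rng omega_src omega_id omega_comp.
Proof.
split => //.
- by move=> a b ab; rewrite /omega_rng val_omega_comp.
- by move=> a b ab; rewrite /omega_src val_omega_comp.
- by move=> a; apply: val_inj; rewrite val_omega_comp//; case: a => -[].
- by move=> a; apply: val_inj; rewrite val_omega_comp//; case: a => -[].
- move=> a b c ab bc; apply: val_inj.
  have ac : omega_src a = omega_rng (omega_comp b c).
    by rewrite ab /omega_rng val_omega_comp.
  have bc' : omega_src (omega_comp a b) = omega_rng c.
    by rewrite -bc /omega_src val_omega_comp.
  by rewrite !val_omega_comp.
Qed.

Definition omega : category := Category omega_category.
Definition omega_deg (a : mor omega) : degree k := subdeg (val a).2 (val a).1.

Section OmegaShift.
Variable p : degree k.

Definition oshift_mor (a : omega_mor) : omega_mor :=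
  omk (etrans (ledeg_add2r p _ _) (valP a)).

Lemma oshift_comp (a b : mor omega) : src a = rng b ->
  oshift_mor (comp a b) = comp (oshift_mor a : mor omega) (oshift_mor b).
Proof.
move=> ab; apply: val_inj.
have sab : omega_src (oshift_mor a) = omega_rng (oshift_mor b).
  by congr (_ + p); exact: ab.
rewrite [RHS](val_omega_comp sab) -[LHS]/((val (omega_comp a b)).1 + p,
  (val (omega_comp a b)).2 + p).
by rewrite (val_omega_comp ab).
Qed.

Definition oshift : functor omega omega.
Proof.
refine (@Functor omega omega (fun m => m + p) oshift_mor _ _ _ oshift_comp).
- by [].
- by [].
- by move=> m; exact: val_inj.
Defined.

End OmegaShift.
End Degrees.

Record kgraph (k : nat) := KGraph {
  kcat :> category;
  kdeg : mor kcat -> degree k;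
  kgraph_countable : countable [set: mor kcat];
  kdeg_id : forall v, kdeg (idm v) = 0;
  kdeg_comp : forall a b, src a = rng b -> kdeg (comp a b) = kdeg a + kdeg b;
  kgraph_factor : forall l m n, kdeg l = m + n ->
    exists! ab : mor kcat * mor kcat,
      [/\ src ab.1 = rng ab.2, l = comp ab.1 ab.2,
          kdeg ab.1 = m & kdeg ab.2 = n] }.

Definition row_finite_no_sources k (L : kgraph k) : Prop :=
  forall (m : degree k) (v : obj L),
    finite_set [set l : mor L | kdeg l = m /\ rng l = v] /\
    [set l : mor L | kdeg l = m /\ rng l = v] !=set0.

Record ipath k (L : kgraph k) := IPath {
  ipath_functor :> functor (omega k) L;
  ipath_deg : forall a, kdeg (fmor ipath_functor a) = omega_deg a }.

HB.instance Definition _ k L := gen_eqMixin (@ipath k L).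
HB.instance Definition _ k L := gen_choiceMixin (@ipath k L).

Section Paths.
Variables (k : nat) (L : kgraph k).
Implicit Types (x y z : ipath L) (j l m n p q : degree k) (lam : mor L).

Lemma seg_rng x p q (pq : ledeg p q) : rng (fmor x (omk pq)) == x p.
Proof. by rewrite fmor_rng. Qed.

Lemma seg_src x p q (pq : ledeg p q) : src (fmor x (omk pq)) == x q.
Proof. by rewrite fmor_src. Qed.

(* x(p, q); the vertex x(p) is [x p]. *)
Definition seg x p q (pq : ledeg p q) : hom (x p) (x q) :=
  Hom (seg_rng x pq) (seg_src x pq).

Lemma shift_deg p x (a : mor (omega k)) : kdeg (fmor (fcomp x (oshift p)) a) = omega_deg a.
Proof. by rewrite /= ipath_deg /omega_deg /= subdeg_add2r. Qed.

Definition shift p x : ipath L := IPath (shift_deg p x).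

Definition Zpath lam : set (ipath L) :=
  [set x | harr (seg x (ledeg0 (kdeg lam))) = lam].

HB.instance Definition _ :=
  @isSubBaseTopological.Build (ipath L)
    (set (ipath L)) (range Zpath) id.

(* The path lam y, for s(lam) = r(y); unspecified if s(lam) <> r(y). *)
Definition pathcat lam y : ipath L :=
  xget y [set x | Zpath lam x /\ shift (kdeg lam) x = y].

Definition in_parrow (g : ipath L * zdegree k * ipath L) : bool :=
  `[< exists j l, g.1.2 = zdeg j - zdeg l /\ shift j g.1.1 = shift l g.2 >].

Definition parrow := {g : ipath L * zdegree k * ipath L | in_parrow g}.
HB.instance Definition _ := Choice.on parrow.

Definition prng (g : parrow) : ipath L := (val g).1.1.
Definition pdeg (g : parrow) : zdegree k := (val g).1.2.
Definition psrc (g : parrow) : ipath L := (val g).2.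

Lemma pid_subproof x : in_parrow (x, 0, x).
Proof. by apply/asboolP; exists 0, 0; rewrite subrr. Qed.

Definition pid x : parrow :=
  exist (fun g => is_true (in_parrow g)) _ (pid_subproof x).

(* The arrow (x, n, y) if it is one; unspecified otherwise. *)
Definition pmk x (n : zdegree k) y : parrow := insubd (pid x) (x, n, y).

Definition pmul (g h : parrow) : parrow := pmk (prng g) (pdeg g + pdeg h) (psrc h).
Definition pinv (g : parrow) : parrow := pmk (psrc g) (- pdeg g) (prng g).

(* Z(mu, nu), for mn = (mu, nu) with s(mu) = s(nu) *)
Definition Zarrow (mn : mor L * mor L) : set parrow :=
  [set g | exists z : ipath L, [/\ z 0 = src mn.1,
     prng g = pathcat mn.1 z, pdeg g = zdeg (kdeg mn.1) - zdeg (kdeg mn.2) &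
     psrc g = pathcat mn.2 z]].

HB.instance Definition _ :=
  @isSubBaseTopological.Build parrow (set parrow)
    (Zarrow @` [set mn | src mn.1 = src mn.2]) id.

Lemma functor_eq (C D : category) (F F' : functor C D) :
  fobj F = fobj F' -> fmor F = fmor F' -> F = F'.
Proof.
case: F F' => [o f ? ? ? ?] [o' f' ? ? ? ?] /= oo ff; subst o' f'.
by f_equal; exact: Prop_irrelevance.
Qed.

Lemma ipath_eq x y : fobj x = fobj y -> fmor x = fmor y -> x = y.
Proof.
case: x y => [F dF] [F' dF'] /= oo ff.
have E := @functor_eq (omega k) L F F' oo ff; subst F'.
by f_equal; exact: Prop_irrelevance.
Qed.

Lemma shiftD p q x : shift p (shift q x) = shift (p + q) x.
Proof.
apply: ipath_eq; apply/funext => a /=; first by rewrite addrA.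
by congr (fmor x _); apply: val_inj => /=; rewrite !addrA.
Qed.

Lemma val_pmul g h : psrc g = prng h ->
  val (pmul g h) = (prng g, pdeg g + pdeg h, psrc h).
Proof.
move=> gh; rewrite /pmul /pmk val_insubd.
suff -> : in_parrow (prng g, pdeg g + pdeg h, psrc h) by [].
have /asboolP[j [l [dg sg]]] := valP g; have /asboolP[p [q [dh sh]]] := valP h.
apply/asboolP; exists (p + j), (l + q); split => /=.
  by rewrite /pdeg dg dh !zdegD opprD addrACA (addrC (zdeg j)).
rewrite -shiftD [shift j _]sg -shiftD -[shift q _]sh.
by rewrite !shiftD -[(val g).2]/(psrc g) gh addrC.
Qed.

Lemma val_pinv g : val (pinv g) = (psrc g, - pdeg g, prng g).
Proof.
rewrite /pinv /pmk val_insubd.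
suff -> : in_parrow (psrc g, - pdeg g, prng g) by [].
have /asboolP[j [l [dg sg]]] := valP g.
by apply/asboolP; exists l, j; split; rewrite //= /pdeg dg opprB.
Qed.

Lemma parrow_eq g h :
  prng g = prng h -> pdeg g = pdeg h -> psrc g = psrc h -> g = h.
Proof.
rewrite /prng /pdeg /psrc => rgh dgh sgh; apply: val_inj.
by case: (val g) (val h) rgh dgh sgh => [[? ?] ?] [[? ?] ?] /= -> -> ->.
Qed.

Lemma prng_mul g h : psrc g = prng h -> prng (pmul g h) = prng g.
Proof. by move=> gh; rewrite {1}/prng val_pmul. Qed.

Lemma pdeg_mul g h : psrc g = prng h -> pdeg (pmul g h) = pdeg g + pdeg h.
Proof. by move=> gh; rewrite {1}/pdeg val_pmul. Qed.

Lemma psrc_mul g h : psrc g = prng h -> psrc (pmul g h) = psrc h.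
Proof. by move=> gh; rewrite {1}/psrc val_pmul. Qed.

Lemma prng_inv g : prng (pinv g) = psrc g.
Proof. by rewrite {1}/prng val_pinv. Qed.

Lemma pdeg_inv g : pdeg (pinv g) = - pdeg g.
Proof. by rewrite {1}/pdeg val_pinv. Qed.

Lemma psrc_inv g : psrc (pinv g) = prng g.
Proof. by rewrite {1}/psrc val_pinv. Qed.

Lemma path_category : is_category prng psrc pid pmul.
Proof.
split => //; [exact: prng_mul|exact: psrc_mul| | |].
- move=> g; apply: parrow_eq; rewrite ?prng_mul ?psrc_mul ?pdeg_mul//.
  by rewrite add0r.
- move=> g; apply: parrow_eq; rewrite ?prng_mul ?psrc_mul ?pdeg_mul//.
  by rewrite addr0.
- move=> g h f gh hf.
  have gh' : psrc g = prng (pmul h f) by rewrite prng_mul.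
  have hf' : psrc (pmul g h) = prng f by rewrite psrc_mul.
  apply: parrow_eq; rewrite ?prng_mul ?psrc_mul ?pdeg_mul//.
  by rewrite addrA.
Qed.

Lemma pmulV g : pmul g (pinv g) = pid (prng g).
Proof.
have E : psrc g = prng (pinv g) by rewrite prng_inv.
apply: parrow_eq; rewrite ?prng_mul ?psrc_mul ?pdeg_mul ?psrc_inv//.
by rewrite pdeg_inv subrr.
Qed.

Lemma pmulVg g : pmul (pinv g) g = pid (psrc g).
Proof.
have E : psrc (pinv g) = prng g by rewrite psrc_inv.
apply: parrow_eq; rewrite ?prng_mul ?psrc_mul ?pdeg_mul ?prng_inv//.
by rewrite pdeg_inv addNr.
Qed.

Definition path_groupoid : groupoid :=
  @Groupoid (ipath L) parrow prng psrc pid pmul pinv path_category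
    prng_inv psrc_inv pmulV pmulVg.

End Paths.

Section DirectLimit.
Variables (k : nat) (L : kgraph k) (A : rmodule L) (x : ipath L).
Implicit Types p q r : degree k.

Definition xmap p q (pq : ledeg p q) : {additive A (x p) -> A (x q)} :=
  mmap A (seg x pq).

Lemma xmap_id p (pp : ledeg p p) a : xmap pp a = a.
Proof.
rewrite /xmap; suff -> : seg x pp = idh (x p) by exact: mmap_id.
apply: hom_inj; rewrite /= -fmor_id; congr (fmor x _); exact: val_inj.
Qed.

Lemma xmap_comp p q r (pq : ledeg p q) (qr : ledeg q r) (pr : ledeg p r) a :
  xmap qr (xmap pq a) = xmap pr a.
Proof.
rewrite /xmap -mmap_comp; congr (mmap A _ a); apply: hom_inj => /=.
rewrite -fmor_comp//; congr (fmor x _); apply: val_inj.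
exact: val_omega_comp.
Qed.

Definition dlim_pre := {p : degree k & A (x p)}.
HB.instance Definition _ := Choice.on dlim_pre.
Implicit Types u v w : dlim_pre.

Definition dlim_rel u v : bool :=
  `[< exists r (ur : ledeg (tag u) r) (vr : ledeg (tag v) r),
        xmap ur (tagged u) = xmap vr (tagged v) >].

Lemma dlim_refl : reflexive dlim_rel.
Proof.
by move=> u; apply/asboolP; exists (tag u), (ledegg _), (ledegg _).
Qed.

Lemma dlim_sym : symmetric dlim_rel.
Proof.
by move=> u v; apply/asboolP/asboolP => -[r [ur [vr e]]]; exists r, vr, ur.
Qed.

Lemma dlim_trans : transitive dlim_rel.
Proof.
move=> v u w /asboolP[r [ur [vr e]]] /asboolP[s [vs [ws f]]]; apply/asboolP.
have rt : ledeg r (r + s) by exact: ledeg_addl.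
have st : ledeg s (r + s) by exact: ledeg_addr.
exists (r + s), (ledeg_trans ur rt), (ledeg_trans ws st).
rewrite -(xmap_comp ur rt) e -(xmap_comp ws st) -f.
by rewrite (xmap_comp vr rt (ledeg_trans vr rt)) (xmap_comp vs st (ledeg_trans vr rt)).
Qed.

Canonical dlim_equiv := EquivRel dlim_rel dlim_refl dlim_sym dlim_trans.

Definition dlim := {eq_quot dlim_rel}.

HB.instance Definition _ := Choice.on dlim.
HB.instance Definition _ := EqQuotient.on dlim.

Definition phi p (a : A (x p)) : dlim :=
  \pi_dlim (Tagged (fun p => A (x p)) a : dlim_pre).

Lemma phiP p q (a : A (x p)) (b : A (x q)) :
  phi a = phi b <-> exists r (pr : ledeg p r) (qr : ledeg q r),
    xmap pr a = xmap qr b.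
Proof.
rewrite /phi; split=> [/eqP|h]; first by rewrite piE => /asboolP.
by apply/eqP; rewrite piE; apply/asboolP.
Qed.

Lemma phi_map p q (pq : ledeg p q) (a : A (x p)) : phi (xmap pq a) = phi a.
Proof.
by apply/phiP; exists q, (ledegg q), pq; rewrite xmap_id.
Qed.

Definition dlim_deg (s : dlim) : degree k := tag (repr s).
Definition dlim_val (s : dlim) : A (x (dlim_deg s)) := tagged (repr s).

Lemma phi_val s : phi (dlim_val s) = s.
Proof.
rewrite /phi /dlim_val /dlim_deg; case E : (repr s) => [p a] /=.
by rewrite -[s in RHS]reprK E.
Qed.

Definition dlim0 : dlim := phi (0 : A (x 0)).
Definition dlimN (s : dlim) : dlim := phi (- dlim_val s).
Definition dlimD (s t : dlim) : dlim :=
  phi (xmap (ledeg_addl (dlim_deg s) (dlim_deg t)) (dlim_val s)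
       + xmap (ledeg_addr (dlim_deg t) (dlim_deg s)) (dlim_val t)).

Lemma dlimN_phi p (a : A (x p)) : dlimN (phi a) = phi (- a).
Proof.
have /phiP[r [pr [qr e]]] := phi_val (phi a).
by apply/phiP; exists r, pr, qr; rewrite !raddfN /= e.
Qed.

Lemma dlimD_phi p (a b : A (x p)) : dlimD (phi a) (phi b) = phi (a + b).
Proof.
rewrite /dlimD; move: (dlim_val _) (phi_val (phi a)) (dlim_val _) (phi_val (phi b)).
move: (dlim_deg _) (dlim_deg _) => s q c /phiP[r [qr [pr e]]] d /phiP[t [st [pt f]]].
have H1 : ledeg r (r + t + (q + s)) by rewrite -addrA ledeg_addl.
have H2 : ledeg t (r + t + (q + s)) by rewrite [r + t]addrC -addrA ledeg_addl.
have H3 : ledeg (q + s) (r + t + (q + s)) by exact: ledeg_addr.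
have pH := ledeg_trans pr H1.
apply/phiP; exists (r + t + (q + s)), H3, pH; rewrite !raddfD /=; congr (_ + _).
  rewrite (xmap_comp _ _ (ledeg_trans qr H1)) -(xmap_comp qr H1) e.
  exact: xmap_comp.
rewrite (xmap_comp _ _ (ledeg_trans st H2)) -(xmap_comp st H2) f.
exact: xmap_comp.
Qed.

Lemma dlim_common (s t u : dlim) : exists p (a b c : A (x p)),
  [/\ s = phi a, t = phi b & u = phi c].
Proof.
pose ds := dlim_deg s; pose dt := dlim_deg t; pose du := dlim_deg u.
have Hs : ledeg ds (ds + dt + du) by rewrite -addrA ledeg_addl.
have Ht : ledeg dt (ds + dt + du) by rewrite [ds + dt]addrC -addrA ledeg_addl.
have Hu : ledeg du (ds + dt + du) by exact: ledeg_addr.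
exists (ds + dt + du), (xmap Hs (dlim_val s)), (xmap Ht (dlim_val t)),
  (xmap Hu (dlim_val u)).
by rewrite !phi_map !phi_val.
Qed.

Lemma dlimDA : associative dlimD.
Proof.
move=> s t u; have [p [a [b [c [-> -> ->]]]]] := dlim_common s t u.
by rewrite !dlimD_phi addrA.
Qed.

Lemma dlimDC : commutative dlimD.
Proof.
move=> s t; have [p [a [b [_ [-> -> _]]]]] := dlim_common s t s.
by rewrite !dlimD_phi addrC.
Qed.

Lemma dlim00 p : phi (0 : A (x p)) = dlim0.
Proof.
rewrite /dlim0 -(phi_map (ledeg0 p) (0 : A (x 0))); congr phi.
by rewrite raddf0.
Qed.

Lemma dlim0D : left_id dlim0 dlimD.
Proof.
move=> s; have [p [a [_ [_ [-> _ _]]]]] := dlim_common s s s.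
by rewrite -(dlim00 p) dlimD_phi add0r.
Qed.

Lemma dlimND : left_inverse dlim0 dlimN dlimD.
Proof.
move=> s; have [p [a [_ [_ [-> _ _]]]]] := dlim_common s s s.
by rewrite dlimN_phi dlimD_phi addNr dlim00.
Qed.

HB.instance Definition _ :=
  GRing.isZmodule.Build dlim dlimDA dlimDC dlim0D dlimND.

End DirectLimit.

Arguments phi {k L} A x p a.

Section Underline.
Variables (k : nat) (L : kgraph k).
Local Notation G := (path_groupoid L).
Implicit Types (A B : rmodule L) (x y z : ipath L).

Definition ustalk A (x : unit_space G) : zmodType := dlim A x.

(* (x, p - q, y) . phi^y_q(b) = phi^x_p(b) whenever sigma^p(x) = sigma^q(y);  *)
(* then y(q) = x(p), and b is read in A_{x(p)}.                               *)
Definition uact A (x y : unit_space G) (g : @hom G x y) (s : ustalk A y) :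
    ustalk A x :=
  xget 0 [set t | exists (p q : degree k) (b : A (y q)) (e : y q = x p),
    [/\ pdeg (harr g) = zdeg p - zdeg q, shift p x = shift q y,
        s = phi A y q b & t = phi A x p (transp e b)]].

(* S_{a, lam}, for a in A_{s(lam)} *)
Definition ubasic A (lam : mor L) (a : A (src lam)) : set (total (ustalk A)) :=
  [set u | exists (y : ipath L) (e : src lam = y (kdeg lam)),
     Zpath lam y /\ u = Total y (phi A y (kdeg lam) (transp e a))].

Definition under A : sheaf G :=
  @Sheaf G (ustalk A) (@uact A)
    [set W | exists (lam : mor L) (a : A (src lam)), W = ubasic a].

(* phi^x_p(a) |-> phi^x_p(eta(a)) *)
Definition under_map A B (eta : modfam A B) : shfam (under A) (under B) :=
  fun x s => phi B x (dlim_deg s) (eta _ (dlim_val s)).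

(* The identification of the sheaf of the constant module with the constant   *)
(* sheaf: phi^x_p(a) |-> a.                                                   *)
Definition under_const (V : zmodType) :
    shfam (under (const_rmodule L V)) (const_sheaf G V) :=
  fun x s => dlim_val (s : dlim (const_rmodule L V) x).

Definition underP : augcomplex G :=
  @AugComplex G (fun n => under (Pmod n))
    (fun n => under_map (fun v => @Pd L n v))
    (fun x s => under_const (under_map (@Pd0 L) s)).

Definition theta A n :
    set (cgrp (mod_complex A) n) -> set (cgrp (hom_complex underP (under A)) n) :=
  @induced (mod_complex A) (hom_complex underP (under A)) n
    (fun c => under_map c).

(* For t = [lam_n, ..., lam_1] this is the list of                            *)
(* (y, - d(lam_n), lam_n y), (lam_n y, - d(lam_{n-1}), lam_{n-1} lam_n y), ...*)
Fixpoint climb (y : ipath L) (t : seq (mor L)) : seq (parrow L) :=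
  if t is lam :: t' then
    pmk y (- zdeg (kdeg lam)) (pathcat lam y) :: climb (pathcat lam y) t'
  else [::].

(* psi_n on the generator [g, (lam_1, ..., lam_n)], where t is the tuple of   *)
(* the lam_i *)
Definition psi_gen n (x : ipath L) (g : parrow L) (t : seq (mor L)) : gP_term G n x :=
  gP_gen (G := G) n x (g :: climb (psrc g) (rev t)) *~ (-1) ^+ uphalf n.

(* psi_n, through the identification of phi^x_p([lam_0, ..., lam_n]) with     *)
(* [(x, p - d(lam_n), lam_n sigma^p(x)), (lam_0, ..., lam_{n-1})]             *)
Definition psi n : shfam (under (Pmod n)) (gP_term G n) := fun x s =>
  flift (fun t : chainto n.+1 (fobj (x : ipath L) (dlim_deg s)) =>
    if val t is lam :: t' then
      let p := dlim_deg s in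
      let lam_n := last lam t' in
      psi_gen n x
        (pmk x (zdeg p - zdeg (kdeg lam_n)) (pathcat lam_n (shift p x)))
        (belast lam t')
    else 0) (dlim_val s).

Definition psi_star A n :
    set (cgrp (hom_complex (gP G) (under A)) n) ->
    set (cgrp (hom_complex underP (under A)) n) :=
  @induced (hom_complex (gP G) (under A)) (hom_complex underP (under A)) n
    (fun c x s => c x (psi s)).

Section Kappa.
Variable A : rmodule L.

Definition is_kappa0 (c : modfam (Pmod 0) A) (f : ccochain (under A) 0) : Prop :=
  forall y : ipath L, ceval f y [::] = phi A y 0 (catcochain c (y 0) [::]).

Definition is_kappa1 (c : modfam (Pmod 1) A) (f : ccochain (under A) 1) : Prop :=
  forall (y z : ipath L) (j l : degree k), shift l y = shift j z ->
    ceval f y [:: pmk y (zdeg l - zdeg j) z] =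
    phi A y l (catcochain c (y l) [:: harr (seg y (ledeg0 l))]
               - catcochain c (y l) [:: harr (seg z (ledeg0 j))]).

Definition normalized (c : modfam (Pmod 2) A) : Prop :=
  forall lam : mor L,
    catcochain c (src lam) [:: idm (rng lam); lam] = 0 /\
    catcochain c (src lam) [:: lam; idm (src lam)] = 0.

Definition kps_partition (P : set (mor L * mor L)) : Prop :=
  [/\ P `<=` [set mn | src mn.1 = src mn.2],
      partition P (@Zarrow k L) [set: parrow L] &
      forall lam : mor L, P (lam, idm (src lam))].

Definition is_kappa2 (c : modfam (Pmod 2) A) (f : ccochain (under A) 2) : Prop :=
  normalized c /\
  exists2 P : set (mor L * mor L), kps_partition P &
  forall (g h : parrow L) (mg ng mh nh mgh ngh a b c' : mor L) (y : ipath L),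
    psrc g = prng h ->
    P (mg, ng) -> Zarrow (mg, ng) g ->
    P (mh, nh) -> Zarrow (mh, nh) h ->
    P (mgh, ngh) -> Zarrow (mgh, ngh) (pmul g h) ->
    src mg = rng a -> src mh = rng b -> src mgh = rng c' -> src a = y 0 ->
    comp ng a = comp mh b -> comp mg a = comp mgh c' ->
    comp nh b = comp ngh c' ->
    prng g = pathcat (comp mg a) y -> psrc g = pathcat (comp ng a) y ->
    prng h = pathcat (comp mh b) y -> psrc h = pathcat (comp nh b) y ->
    let x := prng g in
    let p := kdeg (comp mg a) in
    let C := catcochain c (x p) in
    ceval f x [:: g; h] =
    phi A x p (C [:: mg; a] - C [:: ng; a] + C [:: mh; b] - C [:: nh; b]
               - C [:: mgh; c'] + C [:: ngh; c']).

Definition is_kappa n : modfam (Pmod n) A -> ccochain (under A) n -> Prop :=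
  match n with
  | 0%N => is_kappa0
  | 1%N => is_kappa1
  | 2%N => is_kappa2
  | _ => fun _ _ => False
  end.

Definition kappa n :
    set (cgrp (mod_complex A) n) -> set (cgrp (cont_complex (under A)) n) :=
  @induced_rel (mod_complex A) (cont_complex (under A)) n (@is_kappa n).

End Kappa.
End Underline.

Arguments theta {k L} A n.
Arguments eta {G} A n.
Arguments kappa {k L} A n.
Arguments psi_star {k L} A n.
Arguments rho {G} Q A n.
Arguments gP G : clear implicits.
Arguments underP {k} L.

(* Main.v *)
(* The maps psi_n form a morphism from the resolution underlying P^* to the bar
   resolution over the identity of Z. A cocycle c of the latter and a cocycle
   c' = c psi + b d of the former therefore have Yoneda extensions related by the
   morphism [a, p] |-> [a - b(p), psi(p)], which gives the second equality.

   For the first one, let f represent kappa^n[c]. Both psi^* eta f and underline c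
   are equivariant, so they need only be compared at the generators whose first
   arrow is a unit, that is, f must be evaluated at the arrows
   (lam y, -d(lam), ...) of negative degree along which psi climbs. In degrees 0
   and 1 this gives an equality of cochains. In degree 2 the pairs (lam, s(lam))
   of the partition determine f at arrows of positive degree only:
   f(h^-1, g^-1) = c(lam, mu) for the climbing pair (g, h). Since f is a cocycle
   vanishing at (g, s(g)), the cochain B(g) = g . f(g^-1, g) satisfies
   (f - delta B)(g, h) = - gh . f(h^-1, g^-1), so f - delta B has the values
   required by the comparison, the sign being the one in psi_2.

   As classes are sets of cocycles, kappa^2 must also be shown to be defined: a
   partition comes from the least common tail of the ends of each arrow, and a
   normalized representative from subtracting the coboundary of
   lam |-> c(s(lam), s(lam)). *)

Require Import Defs.
From Stdlib Require Import Relation_Operators.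
From mathcomp Require Import all_boot all_order all_algebra.
From mathcomp Require Import all_classical topology.
From mathcomp Require Import freeg zify.
Require Import Defs.

Set Implicit Arguments.
Unset Strict Implicit.
Unset Printing Implicit Defensive.

Import Order.TTheory GRing.Theory Num.Theory.

Local Open Scope classical_set_scope.
Local Open Scope ring_scope.
Local Open Scope quotient_scope.

(** * Germs of sections and sheaves *)

(** Topologies are given by subbases, so continuity is reduced to germs: [osec s y] says that near y
    the map s is continuous and carries neighbourhoods to neighbourhoods. A map of sheaves is
    continuous as soon as it sends such germs of sections to such germs.

    Yoneda equivalence only relates exact sequences of sheaves, so both complexes must be shown to
    be resolutions. Each has a contracting homotopy on stalks or at vertices that ignores the
    action; exactness passes to the direct limit since an element that vanishes there vanishes at a
    finite level.

    The sign (-1)^ceil(n/2) of psi is forced: psi reverses tuples, the dropped first entry becomes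
    the truncation, and the signs s(n) must satisfy s(n) = s(n+1) (-1)^(n+1).

    The formulas for kappa read an arrow g at a level (j, l) with sigma^j(r(g)) = sigma^l(s(g)).
    Raising the level appends the same segment on both sides, and the corrections given by the
    cocycle identity cancel. This yields independence of the level; the cocycle identity for kappa
    then follows by reading all the arrows involved at matching levels. *)

Section Topology.

(** The defining identity of a topology generated by a subbase, stated abstractly so that sheaf
    spaces, the path space and the arrow space share one argument; the three instances below hold by
    conversion. *)
Definition has_subbase (T : topologicalType) (I : choiceType) (D : set I)
    (b : I -> set T) : Prop :=
  open = [set \bigcup_(i in D') i | D' in subset^~ (finI_from D b)].

Lemma subbase_open (T : topologicalType) (I : choiceType) (D : set I)
    (b : I -> set T) i : has_subbase D b -> D i -> open (b i).
Proof.
move=> sb Di; rewrite sb /=; exists [set b i].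
  by move=> _ ->; exact: finI_from1.
by rewrite bigcup_set1.
Qed.

(** Convergence test: a filter finer than the subbasic neighbourhoods of a point is finer than all
    of them, being closed under finite intersections. *)
Lemma subbase_filter (T : topologicalType) (I : choiceType) (D : set I)
    (b : I -> set T) (F : set_system T) (x : T) : Filter F ->
  has_subbase D b -> (forall i, D i -> b i x -> F (b i)) -> nbhs x `<=` F.
Proof.
move=> FF sb Fb O; rewrite nbhsE => -[U [oU Ux] UO].
apply: (filterS UO); move: oU Ux; rewrite sb => -[D' D'f <-] [V D'V Vx].
have [E ED EV] := D'f _ D'V.
suff : F V by apply: filterS => y Vy; exists V.
rewrite -EV; apply: filter_bigI => i Ei; apply: Fb.
  by have := ED _ Ei; rewrite in_setE.
by move: Vx; rewrite -EV; apply.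
Qed.

Lemma etale_subbase (G : groupoid) (A : sheaf G) :
  @has_subbase (etale A) _ (subbase A) id.
Proof. by []. Qed.

Lemma ipath_subbase k (L : kgraph k) : @has_subbase (ipath L) _ (range (@Zpath k L)) id.
Proof. by []. Qed.

Lemma parrow_subbase k (L : kgraph k) : @has_subbase (parrow L) _
  (@Zarrow k L @` [set mn | src mn.1 = src mn.2]) id.
Proof. by []. Qed.

Variables X Y : topologicalType.
Implicit Types (s t : Y -> X) (y : Y).

(* The germ at y of a local section of a local homeomorphism onto its image. *)
Definition osec s y := \forall z \near y, nbhs (s z) = (s @ z).

Lemma osec_near s y : osec s y -> \forall z \near y, osec s z.
Proof. exact: near_join. Qed.

Lemma osec_nbhs s y : osec s y -> nbhs (s y) = (s @ y).
Proof. exact: nbhs_singleton. Qed.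

Lemma osec_cvg s y : osec s y -> {for y, continuous s}.
Proof. by move=> /osec_nbhs sy O; rewrite sy. Qed.

(** The points e with e = s(p(e)) form a neighbourhood of s(y). By continuity t enters it, and there
    t(z) = s(p(t(z))) = s(z). *)
Lemma osec_agree (p : X -> Y) s t y :
  (\forall z \near y, p (s z) = z) -> (\forall z \near y, p (t z) = z) ->
  osec s y -> {for y, continuous t} -> s y = t y ->
  \forall z \near y, s z = t z.
Proof.
move=> ps pt /osec_nbhs sy ct st.
have : nbhs (s y) [set e | e = s (p e)].
  by rewrite sy; apply: filterS ps => z /= ->.
rewrite st => /ct /= /(filterI pt); apply: filterS => z /= [-> ->].
by [].
Qed.

Lemma near_eq_cvg s t y : (\forall z \near y, s z = t z) ->
  s y = t y -> s @ y = t @ y.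
Proof.
move=> st e; apply/funext => O; apply/propext; split;
  by move=> /= /(filterI st); apply: filterS => z [/= e']; rewrite /preimage /= e'.
Qed.

Lemma osec_eq s t y : (\forall z \near y, s z = t z) -> osec s y -> osec t y.
Proof.
move=> /near_join; apply: filterS2 => z st sz.
have e : s z = t z by exact: nbhs_singleton st.
by rewrite -e sz (near_eq_cvg st e).
Qed.

Lemma osec_of_cont (p : X -> Y) s t y :
  (\forall z \near y, p (s z) = z) -> (\forall z \near y, p (t z) = z) ->
  osec s y -> {for y, continuous t} -> s y = t y -> osec t y.
Proof.
move=> ps pt sy ct st.
exact: osec_eq (osec_agree ps pt sy ct st) sy.
Qed.

End Topology.

Section SheafGerms.
Variable G : groupoid.
Implicit Types (A B : sheaf G) (x y z : unit_space G).

(** The second component is recovered by transport along an equality of base points, which proof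
    irrelevance makes trivial. *)
Lemma total_inj X (S : X -> zmodType) i (a b : S i) : Total i a = Total i b -> a = b.
Proof.
pose f (e : total S) : S i :=
  if pselect (tpt e = i) is left p then transp p (tval e) else 0.
move=> /(congr1 f); rewrite /f /=; case: pselect => // p.
by rewrite (Prop_irrelevance p erefl).
Qed.

Definition sec A (s : forall x, A x) : unit_space G -> etale A :=
  fun x => Total x (s x).

Definition germ A (s : forall x, A x) x := osec (sec s) x.

(** The local homeomorphism axiom in the form that is convenient to check: every point lies on a
    section that is open at it. *)
Definition etale_sheaf A :=
  forall e : etale A, exists2 s : forall x, A x, germ s (tpt e) & e = sec s (tpt e).

Lemma etale_stalk A x (a : A x) : etale_sheaf A ->
  exists2 s : forall x, A x, germ s x & s x = a.
Proof.
move=> /(_ (Total x a)) [s gs e]; exists s => //.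
by apply/esym; exact: total_inj e.
Qed.

Lemma tpt_continuous A : etale_sheaf A -> continuous (@shproj G A).
Proof.
move=> eA e; have [s gs es] := eA e; move=> O Oe.
by rewrite es; have := osec_nbhs gs; rewrite /shproj /nbhs /= => ->.
Qed.

Lemma germ_agree A (s t : forall x, A x) x : germ s x ->
  {for x, continuous (sec t)} -> s x = t x -> \forall z \near x, s z = t z.
Proof.
move=> gs ct st.
have : \forall z \near x, sec s z = sec t z.
  apply: (osec_agree (p := @shproj G A)) => //; [exact: nearW|exact: nearW|].
  by rewrite /sec st.
by apply: filterS => z; exact: total_inj.
Qed.

Lemma germ_of_cont A (s : forall x, A x) x : etale_sheaf A ->
  {for x, continuous (sec s)} -> germ s x.
Proof.
move=> /(etale_stalk (s x)) [t gt ts] cs.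
apply: (osec_of_cont (p := @shproj G A) (s := sec t)) => //.
- exact: nearW.
- exact: nearW.
- by rewrite /sec ts.
Qed.

Lemma germ_eq A (s t : forall x, A x) x :
  (\forall z \near x, s z = t z) -> germ s x -> germ t x.
Proof.
by move=> st; apply: osec_eq; apply: filterS st => z; rewrite /sec => ->.
Qed.

Lemma sum_pair_continuous A B : continuous (@sum_pair G A B : etale (sum_sheaf A B) -> _).
Proof.
apply/continuousP => V oV.
apply: (subbase_open (@etale_subbase G (sum_sheaf A B))).
by exists V.
Qed.

(** The topology of the sum is pulled back from a product, so openness of the paired section
    requires an open set of the product whose pullback lies on it. *)
Lemma germ_sum A B (s : forall x, A x) (t : forall x, B x) x :
  germ s x -> germ t x ->
  germ (A := sum_sheaf A B) (fun z => (s z, t z)) x.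
Proof.
move=> /osec_near gs' /osec_near; move: gs'.
apply: filterS2 => z gs gt; apply/seteqP; split.
  apply: (subbase_filter _ (@etale_subbase G (sum_sheaf A B))).
  move=> _ [V oV ->] Vz; have VN : nbhs (sec s z, sec t z) V.
    by apply: open_nbhs_nbhs; split.
  exact: (cvg_pair (osec_cvg gs) (osec_cvg gt)).
(* Pairs whose components lie on s and on t. In the pullback both components have the same base
   point, so such a point is the value of the paired section there. *)
move=> O Oz; pose V : set (etale A * etale B) :=
  [set p | (p.1 = sec s (tpt p.1) /\ O (sec (A := sum_sheaf A B) (fun z => (s z, t z)) (tpt p.1)))
           /\ p.2 = sec t (tpt p.2)].
have VN : nbhs (sec s z, sec t z) V.
  exists ([set e | e = sec s (tpt e) /\ O (sec (A := sum_sheaf A B) (fun z => (s z, t z)) (tpt e))],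
          [set e | e = sec t (tpt e)]) => /=; last by [].
  split; last by rewrite (osec_nbhs gt); exact: nearW.
  rewrite (osec_nbhs gs); apply: (@filterS _ (nbhs z) _ _ _ _ Oz) => w Ow.
  by split.
have : nbhs (sec (A := sum_sheaf A B) (fun z => (s z, t z)) z) (@sum_pair G A B @^-1` V).
  exact: (@sum_pair_continuous A B (sec (A := sum_sheaf A B) (fun z => (s z, t z)) z) V VN).
apply: filterS => e; case: e => w ab; rewrite /V /=.
move=> [[e1 Ow] e2]; move: Ow; rewrite /sec -(total_inj e1) -(total_inj e2).
by case: ab {e1 e2}.
Qed.

Lemma sum_etale A B : etale_sheaf A -> etale_sheaf B -> etale_sheaf (sum_sheaf A B).
Proof.
move=> eA eB [x [a b]] /=.
have [s gs sa] := etale_stalk a eA; have [t gt tb] := etale_stalk b eB.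
exists (fun z => (s z, t z)); first exact: germ_sum.
by rewrite /sec sa tb.
Qed.

Lemma germ_sumE A B (s : forall x, sum_sheaf A B x) x : etale_sheaf A -> etale_sheaf B ->
  germ s x -> germ (fun z => (s z).1) x /\ germ (fun z => (s z).2) x.
Proof.
move=> eA eB gs.
have [s1 gs1 e1] := etale_stalk (s x).1 eA; have [s2 gs2 e2] := etale_stalk (s x).2 eB.
have : \forall z \near x, s z = (s1 z, s2 z).
  apply: germ_agree (gs) _ _; last by rewrite e1 e2; case: (s x).
  exact/osec_cvg/(germ_sum gs1 gs2).
move=> E; split; [apply: germ_eq gs1|apply: germ_eq gs2];
  by apply: filterS E => z ->.
Qed.

Lemma osec_map A B (s : forall x, A x) (f : etale A -> etale B) x :
  germ s x -> {for sec s x, continuous f} <-> {for x, continuous (f \o sec s)}.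
Proof.
move=> gs; have E := osec_nbhs gs; split => cf.
  by move=> O /cf On; have : nbhs (sec s x) (f @^-1` O) by []; rewrite E.
move=> O /cf On; have : nbhs (sec s x) (f @^-1` O) by rewrite E.
by [].
Qed.

Lemma shmor_cont A B (f : shfam A B) : etale_sheaf A ->
  (forall x (a : A x), exists s : forall x, A x, [/\ germ s x, s x = a &
     germ (fun z => f z (s z)) x]) -> continuous (tmap f).
Proof.
move=> eA H [x a]; have [s [gs sx gfs]] := H x a.
have -> : Total x a = sec s x by rewrite /sec sx.
by apply/(osec_map _ gs); exact: osec_cvg gfs.
Qed.

Lemma shmor_germ A B (f : shfam A B) (s : forall x, A x) x : etale_sheaf B ->
  continuous (tmap f) -> germ s x -> germ (fun z => f z (s z)) x.
Proof.
move=> eB cf gs; apply: germ_of_cont => //.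
by have /(osec_map _ gs) := cf (sec s x).
Qed.

(** The sheaf axioms in terms of sections: continuity of an operation becomes closure of germs under
    it. For the action, [germ_act] asks that arrows near g carry s into one section t evaluated at
    the range. *)
Record sheafy A : Prop := Sheafy {
  sheafy_etale : etale_sheaf A;
  germ0 : forall x, germ (A := A) (fun z => 0) x;
  germB : forall x (s t : forall x, A x), germ s x -> germ t x ->
    germ (fun z => s z - t z) x;
  actB : forall x y (g : @hom G x y), zmod_morphism (act A g);
  act_id : forall x (a : A x), act A (@idh G x) a = a;
  act_comp : forall x y z (g : @hom G x y) (h : @hom G y z) (a : A z),
    act A (comph g h) a = act A g (act A h a);
  germ_act : forall (g : arrow G) (s : forall x, A x), germ s (gsrc g) ->
    exists2 t : forall x, A x, germ t (grng g) &
      \forall h \near g, act A (@hom_of G h) (s (gsrc h)) = t (grng h) }.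

Lemma germN A x (s : forall x, A x) : sheafy A -> germ s x -> germ (fun z => - s z) x.
Proof.
move=> sA gs; apply: germ_eq (germB sA (germ0 sA x) gs).
by apply: nearW => z; rewrite sub0r.
Qed.

Lemma germD A x (s t : forall x, A x) : sheafy A -> germ s x -> germ t x ->
  germ (fun z => s z + t z) x.
Proof.
move=> sA gs gt; apply: germ_eq (germB sA gs (germN sA gt)).
by apply: nearW => z; rewrite opprK.
Qed.

Lemma germ_sumr A x I (r : seq I) (s : I -> forall x, A x) : sheafy A ->
  (forall i, germ (s i) x) -> germ (fun z => \sum_(i <- r) s i z) x.
Proof.
move=> sA gs; elim: r => [|i r IH].
  by apply: germ_eq (germ0 sA x); apply: nearW => z; rewrite big_nil.
apply: germ_eq (germD sA (gs i) IH).
by apply: nearW => z; rewrite big_cons.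
Qed.

Lemma germMz A x (s : forall x, A x) n : sheafy A -> germ s x -> germ (fun z => s z *~ n) x.
Proof.
move=> sA gs; have H m : germ (fun z => s z *+ m) x.
  elim: m => [|m IH]; first by apply: germ_eq (germ0 sA x); apply: nearW.
  by apply: germ_eq (germD sA gs IH); apply: nearW => z; rewrite mulrS.
case: n => m; first exact: H.
by apply: germ_eq (germN sA (H m.+1)); apply: nearW.
Qed.

(** The section through the point is the local inverse of the projection. *)
Lemma sheafy_local_homeo A : etale_sheaf A -> local_homeomorphism (@shproj G A).
Proof.
move=> eA e; have [s gs es] := eA e.
have : nbhs (tpt e) [set z | osec (sec s) z] by exact: osec_near gs.
rewrite nbhsE => -[W [oW We] WO].
have E : @shproj G A @` (sec s @` W) = W.
  by rewrite image_comp -[RHS]image_id.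
exists (sec s @` W); split.
- rewrite openE => _ [z Wz <-]; rewrite /interior (osec_nbhs (WO _ Wz)).
  by apply: filterS (open_nbhs_nbhs (conj oW Wz)) => w Ww; exists w.
- by exists (tpt e).
- by rewrite E.
- rewrite E; exists (sec s); split.
  + by apply: continuous_subspaceT => a; exact: tpt_continuous.
  + by apply: continuous_in_subspaceT => z /set_mem /WO /osec_cvg.
  + by move=> _ [z Wz <-].
Qed.

(** Each continuity axiom is tested along a section through the given point. For the action,
    continuity of the range map turns [germ_act] into convergence in the total space. *)
Lemma sheafy_is_sheaf A : continuous (@grng G) -> sheafy A -> is_sheaf A.
Proof.
move=> crng sA; have eA := sheafy_etale sA; split.
- exact: sheafy_local_homeo.
- split.
  + move=> [x [a b]].
    have [s gs sx] := etale_stalk a eA; have [t gt tx] := etale_stalk b eA.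
    rewrite -sx -tx -[Total _ _]/(sec (A := sum_sheaf A A) (fun z => (s z, t z)) x).
    by apply/osec_map; [exact: germ_sum|exact: osec_cvg (germD sA gs gt)].
  + move=> [x a]; have [s gs sx] := etale_stalk a eA; rewrite -sx.
    by apply/(osec_map _ gs); exact: osec_cvg (germN sA gs).
  + by move=> x; exact: osec_cvg (germ0 sA x).
- exact: actB.
- by split; [exact: act_id|exact: act_comp].
- move=> [g a]; have [s gs sx] := etale_stalk a eA; rewrite -sx {a sx}.
  have [t gt st] := germ_act sA gs.
  move=> O /= On.
  have tO : \forall z \near grng g, O (sec t z).
    apply: (osec_cvg gt); move: On; rewrite /action_map /= (nbhs_singleton st).
    exact.
  pose V : set (arrow G * etale A) :=
    [set p | (act A (@hom_of G p.1) (s (gsrc p.1)) = t (grng p.1) /\ O (sec t (grng p.1)))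
     /\ p.2 = sec s (tpt p.2)].
  have : nbhs (g, sec s (gsrc g)) V.
    exists ([set h | act A (@hom_of G h) (s (gsrc h)) = t (grng h) /\ O (sec t (grng h))],
            [set e | e = sec s (tpt e)]) => //=; split.
      have cr : \forall h \near g, O (sec t (grng h)) by exact: (crng g _ tO).
      by move: st cr; apply: filterS2.
    by rewrite (osec_nbhs gs); exact: nearW.
  move=> VN.
  have : nbhs (existT _ g (s (gsrc g)) : initial_topology (@action_pair G A))
      (@action_pair G A @^-1` V).
    exact: (@initial_continuous _ _ (@action_pair G A) (existT _ g (s (gsrc g))) V VN).
  apply: filterS => u; case: u => h b [[/= e Ot] e2].
  have {e2} -> := total_inj e2.
  by rewrite /action_map /= e.
Qed.

Lemma sum_sheafy A B : sheafy A -> sheafy B -> sheafy (sum_sheaf A B).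
Proof.
move=> sA sB; have eA := sheafy_etale sA; have eB := sheafy_etale sB; split.
- exact: sum_etale.
- by move=> x; apply: germ_sum; exact: germ0.
- move=> x s t /germ_sumE[]// s1 s2 /germ_sumE[]// t1 t2.
  apply: germ_eq (germ_sum (germB sA s1 t1) (germB sB s2 t2)); apply: nearW => z.
  by [].
- move=> x y g [a b] [c d] /=.
  by rewrite !(actB sA, actB sB).
- by move=> x [a b] /=; rewrite (act_id sA) (act_id sB).
- by move=> x y z g h [a b] /=; rewrite (act_comp sA) (act_comp sB).
- move=> g s /germ_sumE[]// /(germ_act sA)[t1 gt1 e1] /(germ_act sB)[t2 gt2 e2].
  exists (fun z => (t1 z, t2 z)); first exact: germ_sum.
  by move: e1 e2; apply: filterS2 => h /= <- <-.
Qed.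

End SheafGerms.

(** * Additive maps on free abelian groups *)

Section FreeGroups.
Variables (K : choiceType) (V : zmodType).

Lemma freeg_ind (P : {freeg K} -> Prop) : P 0 -> (forall k, P << k >>) ->
  (forall a b, P a -> P b -> P (a - b)) -> forall D, P D.
Proof.
move=> P0 PU PB.
have PN a : P a -> P (- a) by rewrite -sub0r; exact: PB.
have PD a b : P a -> P b -> P (a + b).
  by move=> Pa Pb; rewrite -[b]opprK; apply: PB => //; exact: PN.
move=> D; rewrite -[D]freeg_sumE; elim/big_ind: _ => // k _.
have -> : << coeff k D *g k >> = << k >> *~ coeff k D :> {freeg K}.
  by rewrite freegU_mulz intz.
have Pn n : P (<< k >> *+ n) by elim: n => [//|n IH]; rewrite mulrS; exact: PD.
by case: (coeff k D) => n; [exact: Pn|apply: PN; exact: Pn].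
Qed.

Lemma zmod_freeg_ext (f g : {freeg K} -> V) : zmod_morphism f -> zmod_morphism g ->
  (forall k, f << k >> = g << k >>) -> f =1 g.
Proof.
move=> fB gB fg; apply: freeg_ind => //.
  by rewrite -(subrr (0 : {freeg K})) fB gB !subrr.
by move=> a b fa fb; rewrite fB gB fa fb.
Qed.

End FreeGroups.

Section ZmodMorphism.
Variables (U V : zmodType) (f : U -> V).
Hypothesis fB : zmod_morphism f.

Lemma zmod0 : f 0 = 0. Proof. by rewrite -(subrr (0 : U)) fB subrr. Qed.
Lemma zmodN a : f (- a) = - f a. Proof. by rewrite -sub0r fB zmod0 sub0r. Qed.
Lemma zmodD a b : f (a + b) = f a + f b.
Proof. by rewrite -[b in LHS]opprK fB zmodN opprK. Qed.
Lemma zmod_sum I (r : seq I) (F : I -> U) :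
  f (\sum_(i <- r) F i) = \sum_(i <- r) f (F i).
Proof. by elim: r => [|i r IH]; rewrite ?big_nil ?zmod0// !big_cons zmodD IH. Qed.
Lemma zmodMz a n : f (a *~ n) = f a *~ n.
Proof.
have H m : f (a *+ m) = f a *+ m.
  by elim: m => [|m IH]; rewrite ?mulr0n ?zmod0// !mulrS zmodD IH.
by case: n => m; rewrite ?NegzE ?mulrNz ?zmodN -!pmulrn H.
Qed.

End ZmodMorphism.

Lemma flift_zmod (K : choiceType) (V : zmodType) (f : K -> V) : zmod_morphism (flift f).
Proof. exact: flift_is_zmod_morphism. Qed.

Lemma shfam_ext (G : groupoid) (A B : sheaf G) (f g : shfam A B) :
  (forall x a, f x a = g x a) -> f = g.
Proof. by move=> fg; apply: functional_extensionality_dep => x; apply/funext. Qed.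

Section Quotients.
Variable G : groupoid.
Implicit Types (A B : sheaf G) (x y z : unit_space G).

Lemma subbase_continuous (T U : topologicalType) (I : choiceType) (D : set I)
    (b : I -> set U) (f : T -> U) : has_subbase D b ->
  (forall i, D i -> open (f @^-1` b i)) -> continuous f.
Proof.
move=> sb fo t; apply: (subbase_filter _ sb) => i Di bt.
by apply: open_nbhs_nbhs; split => //; exact: fo.
Qed.

Lemma is_shmor_comp A B (C : sheaf G) (f : shfam A B) (g : shfam B C) :
  is_shmor f -> is_shmor g -> is_shmor (fun x a => g x (f x a) : C x).
Proof.
move=> [cf fB fe] [cg gB ge]; split.
- by move=> e; exact: (@continuous_comp _ _ _ (tmap f) (tmap g) e (cf e) (cg _)).
- by move=> x a b; rewrite fB gB.
- by move=> x y h a; rewrite fe ge.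
Qed.

Lemma germ_shmor A B (f : shfam A B) (s : forall x, A x) x : sheafy B ->
  is_shmor f -> germ s x -> germ (fun z => f z (s z)) x.
Proof. by move=> sB [cf _ _]; apply: shmor_germ => //; exact: sheafy_etale. Qed.

End Quotients.

Arguments rbd {G} a n {i} _.
Arguments raug {G} a {i} _.

(** * The quotient R_c as a sheaf *)

Section PushoutSheaf.
Variables (G : groupoid) (csrc : continuous (@gsrc G)).
Variables (Q : augcomplex G) (A : sheaf G) (n : nat) (c : shfam (Q n.+1) A).
Hypotheses (sA : sheafy A) (sQ : sheafy (Q n)) (sQ1 : sheafy (Q n.+1)).
Hypotheses (mc : is_shmor c) (mb : is_shmor (@rbd G Q n)).
Implicit Types x y z : unit_space G.
Local Notation S := (sum_sheaf A (Q n)).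
Local Notation pi x := (@qpi (A x * Q n x)%type (@rquot_rel G Q A n c x)).

Lemma rquot_relP x v : gensub (@rquot_rel G Q A n c x) v <-> rquot_rel c v.
Proof.
have [_ cB _] := mc; have [_ dB _] := mb.
split=> [|h H H0 HB]; last exact.
apply=> //.
  by exists 0; rewrite (zmod0 (cB x)) (zmod0 (dB x)) oppr0.
move=> _ _ [q ->] [q' ->]; exists (q - q'); rewrite cB dB opprB.
by congr pair; rewrite /= opprK addrC.
Qed.

Lemma pi_eq x (u v : A x * Q n x) : pi x u = pi x v <->
  exists q, u = (v.1 + c q, v.2 - rbd Q n q).
Proof.
rewrite qpiE rquot_relP; split=> -[q E]; exists q.
  by rewrite -[u](subrK v) E addrC.
by rewrite E; case: v {E} => a b; congr pair; rewrite /= addrC addKr.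
Qed.

Lemma piK x (u : rquot_stalk c x) : pi x (repr u) = u.
Proof. by rewrite -qpi_surj. Qed.

Lemma pi_zmod x : zmod_morphism (pi x).
Proof. by move=> a b; apply/esym; rewrite -[- pi x b]/(qN (pi x b)) qND; exact: qDD. Qed.

Lemma rquot_pi_continuous : continuous (@rquot_pi G Q A n c : etale S -> etale (rquot c)).
Proof. by apply: (subbase_continuous (@etale_subbase G (rquot c))). Qed.

(** The quotient map is open on sections: the preimage of the image of a section consists of its
    translates by (c t, - d t), with t a section of [Q n.+1], and each translate is again an open
    section. *)
Lemma rquot_germ x (s : forall x, S x) : germ s x ->
  germ (A := rquot c) (fun z => pi z (s z)) x.
Proof.
move=> gs; have := osec_near gs; rewrite /germ /osec.
move=> /near_join; apply: filterS => z0 gz0.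
have gz := nbhs_singleton gz0; apply/seteqP; split => O.
  move=> On; have : nbhs (sec s z0) (@rquot_pi G Q A n c @^-1` O).
    exact: (@rquot_pi_continuous (sec s z0) O On).
  by rewrite (osec_nbhs gz).
move=> Oz; have {Oz} Oz : \forall w \near z0, O (sec (A := rquot c) (fun z => pi z (s z)) w) by [].
have : nbhs z0 [set w | osec (sec s) w /\ O (sec (A := rquot c) (fun z => pi z (s z)) w)].
  by move: gz0 Oz; apply: filterS2.
rewrite nbhsE => -[W [oW Wz] WO].
rewrite nbhsE; exists [set e | W (tpt e) /\ tval e = pi _ (s (tpt e))]; last first.
  move=> e; case: e => w u /= [Ww ->]; exact: (WO _ Ww).2.
split=> //.
apply: (subbase_open (@etale_subbase G (rquot c))) => /=.
rewrite openE => e; case: e => w v [/= Ww] /pi_eq [q vq].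
have [t gt tq] := etale_stalk q (sheafy_etale sQ1).
have gs' := (WO _ Ww).1.
have [gs1 gs2] := germ_sumE (sheafy_etale sA) (sheafy_etale sQ) gs'.
have gs3 : germ (A := S) (fun z => ((s z).1 + c (t z), (s z).2 - rbd Q n (t z))) w.
  apply: germ_sum.
    by apply: germD => //; exact: germ_shmor mc gt.
  by apply: germB => //; exact: germ_shmor mb gt.
have -> : Total w v = sec (A := S) (fun z => ((s z).1 + c (t z), (s z).2 - rbd Q n (t z))) w.
  by rewrite /sec vq tq.
rewrite /interior (osec_nbhs gs3).
have : \forall w' \near w, W w' by exact: open_nbhs_nbhs.
apply: filterS => w' Ww'; split=> //=.
by apply/pi_eq; exists (t w').
Qed.

Lemma rquot_etale : etale_sheaf (rquot c).
Proof.
move=> e; case: e => x u.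
have [s gs sx] := etale_stalk (repr u : S x) (sum_etale (sheafy_etale sA) (sheafy_etale sQ)).
exists (fun z => pi z (s z)); first exact: rquot_germ.
by rewrite /sec /= sx piK.
Qed.

Lemma rquot_lift x (s : forall x, rquot c x) : germ s x ->
  exists2 t : forall x, S x, germ t x & \forall z \near x, s z = pi z (t z).
Proof.
move=> gs.
have [t gt tx] := etale_stalk (repr (s x) : S x) (sum_etale (sheafy_etale sA) (sheafy_etale sQ)).
exists t => //; apply: germ_agree gs _ _; last by rewrite tx piK.
exact: osec_cvg (rquot_germ gt).
Qed.

(** The action is defined through [repr]; changing the representative by (c q, - d q) changes the
    result by the relation of g . q, since c and d are equivariant. *)
Lemma rquot_act x y (g : @hom G x y) (v : S y) :
  act (rquot c) g (pi y v) = pi x (act S g v).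
Proof.
have [_ cB ce] := mc; have [_ dB de] := mb.
have /pi_eq[q E] := piK (pi y v).
rewrite /= E /=; apply/pi_eq; exists (act (Q n.+1) g q).
by rewrite ce de /= (zmodD (actB sA g)) (actB sQ g).
Qed.

Lemma rquot_sheafy : sheafy (rquot c).
Proof.
have sS := sum_sheafy sA sQ; split.
- exact: rquot_etale.
- move=> x; apply: germ_eq (rquot_germ (germ0 sS x)).
  by apply: nearW => z; exact: zmod0 (@pi_zmod z).
- move=> x s t /rquot_lift[s' gs es] /rquot_lift[t' gt et].
  apply: germ_eq (rquot_germ (germB sS gs gt)).
  by move: es et; apply: filterS2 => z -> ->; exact: pi_zmod.
- move=> x y g u v; rewrite -(piK u) -(piK v) -pi_zmod !rquot_act -pi_zmod.
  by rewrite (actB sS g).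
- by move=> x u; rewrite -(piK u) rquot_act (act_id sS).
- by move=> x y z g h u; rewrite -(piK u) !rquot_act (act_comp sS).
- move=> g s /rquot_lift[s' gs es].
  have [t gt et] := germ_act sS gs; exists (fun z => pi z (t z)).
    exact: rquot_germ.
  have cs : \forall h \near g, s (gsrc h) = pi (gsrc h) (s' (gsrc h)).
    exact: (csrc es).
  by move: cs et; apply: filterS2 => h -> <-; rewrite rquot_act.
Qed.

End PushoutSheaf.

(** * Yoneda extensions of a resolution *)

Section Extensions.
Variables (G : groupoid) (crng : continuous (@grng G)) (csrc : continuous (@gsrc G)).
Implicit Types (A B : sheaf G) (x y z : unit_space G) (Q : augcomplex G).

Lemma const_germ (V : zmodType) (a : V) x : germ (A := const_sheaf G V) (fun=> a) x.
Proof.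
apply: nearW => z; apply/seteqP; split => O.
  move: O; apply: (subbase_filter _ (@etale_subbase G (const_sheaf G V))).
  move=> _ [U [b [oU ->]]] [/= Uz ->].
  have : \forall w \near z, U w by exact: open_nbhs_nbhs.
  by apply: filterS => w Uw; split.
move=> Oz; have {Oz} : \forall w \near z, O (Total w a : etale (const_sheaf G V)) by [].
rewrite /prop_near1 /= nbhsE => -[W [oW Wz] WO].
rewrite nbhsE; exists [set e | W (tpt e) /\ tval e = a]; last first.
  by case=> w b /= [Ww ->]; exact: WO.
split=> //; apply: (subbase_open (@etale_subbase G (const_sheaf G V))).
by exists W, a.
Qed.

Lemma const_sheafy (V : zmodType) : sheafy (const_sheaf G V).
Proof.
have eV : etale_sheaf (const_sheaf G V).
  by case=> x a; exists (fun=> a) => //; exact: const_germ.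
have loc (s : forall x, const_sheaf G V x) x : germ s x -> \forall z \near x, s z = s x.
  move=> gs; apply: (germ_agree gs) => //; exact: osec_cvg (const_germ (s x) x).
split=> //.
- by move=> x; exact: (const_germ (0 : V) x).
- move=> x s t /loc s1 /loc t1; apply: germ_eq (const_germ (s x - t x) x).
  by move: s1 t1; apply: filterS2 => z -> ->.
- move=> g s /loc s1; exists (fun=> s (gsrc g)); first exact: const_germ.
  exact: (csrc s1).
Qed.

Record resolution Q : Prop := Resolution {
  res_sheafy : forall n, sheafy (Q n);
  res_bd : forall n, is_shmor (@rbd G Q n);
  res_aug : is_shmor (@raug G Q);
  res_exact : forall n x (q : Q n.+1 x), rbd Q n q = 0 <-> range (@rbd G Q n.+1 x) q;
  res_exact0 : forall x (q : Q 0 x), raug Q q = 0 <-> range (@rbd G Q 0 x) q;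
  res_surj : forall x m, exists q : Q 0 x, raug Q q = m }.

Lemma qtail_exact Q n (K : forall x, set (Q n x)) : resolution Q ->
  (forall x, K x = range (@rbd G Q n x)) -> ext_exact K (qtail Q n).
Proof.
move=> rQ; elim: n K => [|n IH] K KE /=.
  split; [exact: res_aug|by move=> x a; rewrite KE; exact: res_exact0|exact: res_surj].
split; [exact/sheafy_is_sheaf/res_sheafy|exact: res_bd| |exact: IH].
by move=> x a; rewrite KE; exact: res_exact.
Qed.

Section OneCocycle.
Variables (Q : augcomplex G) (rQ : resolution Q) (A : sheaf G) (sA : sheafy A).
Variables (n : nat) (c : shfam (Q n.+1) A).
Hypotheses (mc : is_shmor c) (c0 : forall x (q : Q n.+2 x), c (rbd Q n.+1 q) = 0).
Local Notation S := (sum_sheaf A (Q n)).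
Local Notation pi x := (@qpi (A x * Q n x)%type (@rquot_rel G Q A n c x)).
Let sQ := res_sheafy rQ n.
Let sQ1 := res_sheafy rQ n.+1.
Let mb := res_bd rQ n.

(** The universal property of R_c. The maps out of it are written with [repr], hence the first
    conclusion, which frees them from the representative. *)
Lemma rquot_shmor B (h : shfam S B) : sheafy B -> is_shmor h ->
  (forall x (q : Q n.+1 x), h x (c q, - rbd Q n q) = 0) ->
  (forall x v, h x (repr (pi x v)) = h x v) /\
  is_shmor ((fun x u => h x (repr u)) : shfam (rquot c) B).
Proof.
move=> sB [ch hB he] h0.
have hK x v : h x (repr (pi x v)) = h x v.
  have /(pi_eq mc mb)[q ->] := piK (pi x v).
  have -> : (v.1 + c q, v.2 - rbd Q n q) = v + (c q, - rbd Q n q) :> S x by case: v.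
  by rewrite (zmodD (hB x)) h0 addr0.
split=> //; split.
- apply: shmor_cont; first exact: rquot_etale.
  move=> x u; have [s gs sx] := etale_stalk (repr u : S x) (sum_etale (sheafy_etale sA) (sheafy_etale sQ)).
  exists (fun z => pi z (s z)); split; first exact: rquot_germ.
    by rewrite sx piK.
  have g1 := shmor_germ (sheafy_etale sB) ch gs.
  by apply: germ_eq g1; apply: nearW => z; exact/esym/hK.
- by move=> x u v; rewrite -(piK u) -(piK v) -pi_zmod !hK hB.
- by move=> x y g u; rewrite -(piK u) rquot_act// !hK he.
Qed.

(** The maps of [rquot_tail] depend on the second component only, so they descend once they kill
    boundaries. The description of the kernel has the same shape as [rquot_in_range], which makes
    exactness at R_c a comparison of two images. *)
Lemma tail_map_shmor B (f : shfam (Q n) B) : sheafy B -> is_shmor f ->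
  (forall x (q : Q n.+1 x), f x (rbd Q n q) = 0) ->
  [/\ (forall x v, f x (repr (pi x v)).2 = f x v.2),
      is_shmor ((fun x u => f x (repr u).2) : shfam (rquot c) B) &
      forall x, [set u : rquot c x | f x (repr u).2 = 0] =
         [set pi x v | v in [set v : S x | f x v.2 = 0]]].
Proof.
move=> sB mf f0; have [cf fB fe] := mf.
have m2 : is_shmor ((fun x v => f x v.2) : shfam S B).
  split; [|by move=> x a b; rewrite /= -fB|by move=> x y g a; rewrite /= -fe].
  apply: shmor_cont; first exact: (sum_etale (sheafy_etale sA) (sheafy_etale sQ)).
  move=> x v; have [s gs sx] := etale_stalk v (sum_etale (sheafy_etale sA) (sheafy_etale sQ)).
  exists s; split => //; have [_ gs2] := germ_sumE (sheafy_etale sA) (sheafy_etale sQ) gs.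
  exact: (shmor_germ (sheafy_etale sB) cf gs2).
have [E M] := rquot_shmor sB m2 (fun x q => etrans (zmodN (fB x) _) (etrans (congr1 _ (f0 x q)) (oppr0 _))).
split=> // x; apply/seteqP; split => u.
  by move=> u0; exists (repr u) => //; exact: piK.
by move=> [v v0 <-]; rewrite /= E.
Qed.

(** If (a, 0) = (c q, - d q) then d q = 0, so q = d q' by exactness and a = c(d q') = 0 because c is
    a cocycle. *)
Lemma rquot_in_ker x a : rquot_in c a = 0 <-> [set (0 : A x)] a.
Proof.
rewrite -(zmod0 (@pi_zmod _ _ _ _ c x)).
split=> [/(pi_eq mc mb)[q [-> /esym E]]| -> //].
have /(res_exact rQ) [q' _ <-] : rbd Q n q = 0.
  by move: E; rewrite /= sub0r => /eqP; rewrite oppr_eq0 => /eqP.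
by rewrite /= add0r c0.
Qed.

Lemma rquot_in_shmor : is_shmor (@rquot_in G Q A n c).
Proof.
split.
- apply: shmor_cont; first exact: sheafy_etale.
  move=> x a; have [s gs sx] := etale_stalk a (sheafy_etale sA).
  exists s; split=> //; apply: (rquot_germ sA sQ sQ1 mc mb (s := fun z => (s z, 0))).
  by apply: germ_sum => //; exact: germ0.
- move=> x a b; rewrite /rquot_in -pi_zmod; congr (pi x _); congr pair.
  by rewrite /= subr0.
- move=> x y g a; rewrite /rquot_in rquot_act//=; congr (pi x _); congr pair.
  by rewrite (zmod0 (actB sQ g)).
Qed.

(** The class of (a, d q) is that of (a + c q, 0). *)
Lemma rquot_in_range x : range (@rquot_in G Q A n c x) =
  [set pi x v | v in [set v : S x | range (@rbd G Q n x) v.2]].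
Proof.
have [_ dB _] := mb; apply/seteqP; split => u.
  by move=> [a _ <-]; exists (a, 0) => //=; exists 0 => //; exact: zmod0 (dB x).
move=> [[a _] /= [q _ <-] <-]; exists (a + c q) => //.
by apply/(pi_eq mc mb); exists q; rewrite /= subrr.
Qed.

End OneCocycle.

Lemma yoneda_seq_extension Q A n (c : shfam (Q n.+1) A) : resolution Q -> sheafy A ->
  is_shmor c -> (forall x (q : Q n.+2 x), c x (rbd Q n.+1 q) = 0) ->
  is_extension (yoneda_seq c).
Proof.
move=> rQ sA mc c0; split=> /=.
- apply: sheafy_is_sheaf => //.
  exact: (rquot_sheafy csrc sA (res_sheafy rQ n) (res_sheafy rQ n.+1) mc (res_bd rQ n)).
- exact: rquot_in_shmor.
- exact: rquot_in_ker.
case: n c mc c0 => [|n] c mc c0 /=.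
  have d0 x (q : Q 1 x) : raug Q (rbd Q 0 q) = 0 by apply/(res_exact0 rQ); exists q.
  have [E M R] := tail_map_shmor rQ sA mc (const_sheafy _) (res_aug rQ) d0.
  split=> //.
    move=> x u; rewrite -[X in _ <-> X]/(range (@rquot_in G Q A 0 c x) u).
    rewrite (rquot_in_range rQ mc) -[X in X <-> _]/([set u | raug Q (repr u).2 = 0] u) R.
    by split=> -[v /= v0 <-]; exists v => //; apply/(res_exact0 rQ).
  move=> x m; have [q <-] := @res_surj _ rQ x m.
  by exists (qpi (rquot_rel c (x:=x)) (0, q)); rewrite E.
have d0 x (q : Q n.+2 x) : rbd Q n (rbd Q n.+1 q) = 0 by apply/(res_exact rQ); exists q.
have [E M R] := tail_map_shmor rQ sA mc (res_sheafy rQ n) (res_bd rQ n) d0.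
split=> //.
- exact/sheafy_is_sheaf/res_sheafy.
- move=> x u; rewrite -[X in _ <-> X]/(range (@rquot_in G Q A n.+1 c x) u).
  rewrite (rquot_in_range rQ mc) -[X in X <-> _]/([set u | rbd Q n (repr u).2 = 0] u) R.
  by split=> -[v /= v0 <-]; exists v => //; apply/(res_exact rQ).
- apply: qtail_exact => // x; apply/seteqP; split => q.
    by move=> [u _ <-]; exists (repr u).2.
  by move=> [p _ <-]; exists (qpi (rquot_rel c (x:=x)) (0, p)) => //; rewrite E.
Qed.

Section ChainMap.
Variables (Q Q' : augcomplex G) (f : forall n, shfam (Q n) (Q' n)).
Arguments f n [i] _.
Hypotheses (rQ : resolution Q) (rQ' : resolution Q').
Hypotheses (mf : forall n, is_shmor (@f n)).
Hypotheses (fbd : forall n x (q : Q n.+1 x), f n (rbd Q n q) = rbd Q' n (f n.+1 q)).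
Hypotheses (faug : forall x (q : Q 0 x), raug Q' (f 0 q) = raug Q q).

Lemma qtail_mor n : ext_mor (@f n) (qtail Q n) (qtail Q' n).
Proof.
elim: n => [|n IH] /=; first exact: faug.
by exists (@f n); split.
Qed.

(* The morphism R_c -> R_c' is [a, p] |-> [a - b p, f p]. *)
Lemma yoneda_seq_step A n (c : shfam (Q n.+1) A) (c' : shfam (Q' n.+1) A)
    (b : shfam (Q n) A) : sheafy A -> is_shmor c -> is_shmor c' -> is_shmor b ->
  (forall x (q : Q n.+2 x), c x (rbd Q n.+1 q) = 0) ->
  (forall x (q : Q' n.+2 x), c' x (rbd Q' n.+1 q) = 0) ->
  (forall x (q : Q n.+1 x), c' x (f n.+1 q) = c x q + b x (rbd Q n q)) ->
  ext_step (yoneda_seq c) (yoneda_seq c').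
Proof.
move=> sA mc mc' mb c0 c0' E.
have sQ := res_sheafy rQ n; have sQ' := res_sheafy rQ' n.
have sR := rquot_sheafy csrc sA sQ' (res_sheafy rQ' n.+1) mc' (res_bd rQ' n).
have pic x := @pi_eq G Q' A n c' mc' (res_bd rQ' n) x.
have [cb bB be] := mb; have [cf fB fe] := mf n.
split; [exact: yoneda_seq_extension|exact: yoneda_seq_extension|].
pose h : shfam (sum_sheaf A (Q n)) (rquot c') :=
  fun x v => qpi (rquot_rel c' (x:=x)) (v.1 - b x v.2, f n v.2).
have mh : is_shmor h.
  split.
  - apply: shmor_cont; first exact: sum_etale (sheafy_etale sA) (sheafy_etale sQ).
    move=> x v; have [s gs sx] := etale_stalk v (sum_etale (sheafy_etale sA) (sheafy_etale sQ)).
    exists s; split=> //.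
    have [g1 g2] := germ_sumE (sheafy_etale sA) (sheafy_etale sQ) gs.
    apply: (rquot_germ sA sQ' (res_sheafy rQ' n.+1) mc' (res_bd rQ' n)
      (s := fun z => ((s z).1 - b z (s z).2, f n (s z).2))).
    apply: germ_sum; last exact: germ_shmor (mf n) g2.
    by apply: germB => //; exact: germ_shmor mb g2.
  - move=> x u v; rewrite /h -pi_zmod; congr qpi; congr pair; rewrite /= ?bB ?fB//.
    by rewrite !opprD !opprK !addrA; congr (_ + _); rewrite addrAC.
  - move=> x y g v; rewrite /h rquot_act//=; last exact: res_bd.
    by rewrite be fe (actB sA).
(* The relation (c q, - d q) goes to (c q + b(d q), - f(d q)), which by hypothesis is the relation
   (c' p, - d p) for p = f q. *)
have h0 x (q : Q n.+1 x) : h x (c x q, - rbd Q n q) = 0.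
  rewrite /h /= -(zmod0 (@pi_zmod _ _ _ _ c' x)); apply/pic; exists (f n.+1 q).
  by rewrite (zmodN (bB x)) (zmodN (fB x)) opprK /= add0r sub0r E fbd.
have [hE mh'] := rquot_shmor rQ sA mc sR mh h0.
exists (fun x u => h x (repr u)); split=> //.
  move=> x a; rewrite hE /h /rquot_in; congr qpi.
  by rewrite /= (zmod0 (bB x)) (zmod0 (fB x)) subr0.
have d0 m x (q : Q m.+2 x) : rbd Q m (rbd Q m.+1 q) = 0 by apply/(res_exact rQ); exists q.
have d0' m x (q : Q' m.+2 x) : rbd Q' m (rbd Q' m.+1 q) = 0 by apply/(res_exact rQ'); exists q.
have d00 x (q : Q 1%N x) : raug Q (rbd Q 0 q) = 0 by apply/(res_exact0 rQ); exists q.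
have d00' x (q : Q' 1%N x) : raug Q' (rbd Q' 0 q) = 0 by apply/(res_exact0 rQ'); exists q.
case: n => [|n] in c c' b mc mc' mb c0 c0' E sQ sQ' sR pic cb bB be cf fB fe h mh h0 hE mh' *.
  move=> x u /=.
  have [E1 _ _] := tail_map_shmor rQ sA mc (const_sheafy _) (res_aug rQ) d00.
  have [E2 _ _] := tail_map_shmor rQ' sA mc' (const_sheafy _) (res_aug rQ') d00'.
  by rewrite /h E2 faug.
have [E1 _ _] := tail_map_shmor rQ sA mc (res_sheafy rQ n) (res_bd rQ n) (d0 n).
have [E2 _ _] := tail_map_shmor rQ' sA mc' (res_sheafy rQ' n) (res_bd rQ' n) (d0' n).
exists (@f n); split; [exact: mf| |exact: qtail_mor].
by move=> x u; rewrite /= /h E2 /= fbd.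
Qed.

End ChainMap.
End Extensions.

(** * Composable tuples and the bar resolution *)

Section ChainLists.
Variable C : category.
Implicit Types (v w : obj C) (a b : mor C) (t : seq (mor C)).

Lemma size_merge i t : (i.+1 < size t)%N -> size (merge i t) = (size t).-1.
Proof.
elim: i t => [|i IH] [|a [|b t]]//= it; congr S.
by rewrite IH.
Qed.

Lemma ischain_merge v i t : ischain v t -> ischain v (merge i t).
Proof.
elim: i v t => [|i IH] v [|a t]//=; last by move=> /andP[-> /IH].
case: t => [|b t]//= /and3P[/eqP ra /eqP rb ct].
by rewrite (cat_rng_comp (categoryP C))// (cat_src_comp (categoryP C))// ra eqxx.
Qed.

Lemma nth_merge d i j t : (i.+1 < size t)%N -> nth d (merge i t) j =
  if (j < i)%N then nth d t j else
  if j == i then comp (nth d t i) (nth d t i.+1) else nth d t j.+1.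
Proof.
elim: i j t => [|i IH] [|j] [|a [|b t]]//= it.
by rewrite IH.
Qed.

Lemma ischain_take v n t : ischain v t -> ischain v (take n t).
Proof.
elim: t v n => [|a t IH] v [|n]//= /andP[-> ct] /=.
exact: IH.
Qed.

Lemma ischain_nth v d i t : ischain v t -> (i.+1 < size t)%N ->
  src (nth d t i) = rng (nth d t i.+1).
Proof.
elim: t v i => [|a t IH] v [|i]//= /andP[_].
  by case: t IH => [|b t]//= _ /andP[/eqP ->].
by move=> ct it; exact: IH ct _.
Qed.

Lemma ischain_mulhead v a t : src a = v -> ischain v t -> ischain (rng a) (mulhead a t).
Proof.
move=> av; case: t => [|b t]//= /andP[/eqP rb ct].
have ab : src a = rng b by rewrite rb.
by rewrite (cat_rng_comp (categoryP C))// (cat_src_comp (categoryP C))// eqxx.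
Qed.

Lemma size_mulhead a t : size (mulhead a t) = size t.
Proof. by case: t. Qed.

Lemma mulhead_id v t : ischain v t -> mulhead (idm v) t = t.
Proof. by case: t => [|b t]//= /andP[/eqP <- _]; rewrite (cat_idl (categoryP C)). Qed.

Lemma mulhead_comp a b t : src a = rng b -> ischain (src b) t ->
  mulhead (comp a b) t = mulhead a (mulhead b t).
Proof.
by move=> ab; case: t => [|c t]//= /andP[/eqP rc _]; rewrite (cat_compA (categoryP C)).
Qed.

Lemma merge_mulhead a i t : ischain (src a) t -> (i.+1 < size t)%N ->
  merge i (mulhead a t) = mulhead a (merge i t).
Proof.
case: t => [|b [|c t]]; case: i => [|i]//= /and3P[/eqP rb /eqP rc _] _.
by rewrite (cat_compA (categoryP C)).
Qed.

Lemma take_mulhead a n t : take n (mulhead a t) = mulhead a (take n t).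
Proof. by case: t n => [|b t] [|n]. Qed.

Lemma idchainP n v : (size (nseq n (idm v)) == n) && ischain v (nseq n (idm v)).
Proof.
rewrite size_nseq eqxx /=; elim: n => //= n IH.
by rewrite (cat_rng_id (categoryP C)) eqxx /= (cat_src_id (categoryP C)).
Qed.

(** Inhabits [chainfrom n v], so that [chain_of] has a default value. *)
Definition idchain n v : chainfrom n v :=
  exist (fun t => is_true ((size t == n) && ischain v t)) _ (idchainP n v).

Definition chain_of n v t : chainfrom n v := insubd (idchain n v) t.

Lemma val_chain_of n v t : size t = n -> ischain v t -> val (chain_of n v t) = t.
Proof. by move=> st ct; rewrite /chain_of val_insubd st eqxx ct. Qed.

Lemma chain_size n v (t : chainfrom n v) : size (val t) = n.
Proof. by have /andP[/eqP] := valP t. Qed.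

Lemma chain_ischain n v (t : chainfrom n v) : ischain v (val t).
Proof. by have /andP[] := valP t. Qed.

End ChainLists.

Lemma initial_cvg (S : choiceType) (T : topologicalType) (f : S -> T)
    (F : set_system S) (s : S) : Filter F ->
  f @ F --> f s -> F --> (s : initial_topology f).
Proof.
move=> FF Fs O [_ [[B oB <-] Bs BO]].
have : nbhs (f s) B by exact: open_nbhs_nbhs.
by move=> /Fs; rewrite /= /fmap /nbhs /=; apply: filterS.
Qed.

(** * Étale groupoids and local sections of the spaces of composable tuples *)

Section Tuples.
Variable G : groupoid.
Implicit Types (x y z : unit_space G) (g h : arrow G).

(** Continuity of the product is stated with neighbourhoods, which avoids a topology on composable
    pairs. The field [bisection] makes the range map a local homeomorphism by giving an open section
    of it through each arrow. *)
Record etale_groupoid : Prop := EtaleGroupoid {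
  grng_cont : continuous (@grng G);
  gsrc_cont : continuous (@gsrc G);
  gmul_cont : forall g h, gsrc g = grng h -> forall O, nbhs (gmul g h) O ->
    exists V W, [/\ nbhs g V, nbhs h W & forall g' h', V g' -> W h' ->
      gsrc g' = grng h' -> O (gmul g' h')];
  bisection : forall g, exists b : unit_space G -> arrow G,
    [/\ osec b (grng g), b (grng g) = g & \forall z \near grng g, grng (b z) = z] }.

Hypothesis eG : etale_groupoid.

Definition gnth n (t : gtuple G n) i : arrow G :=
  nth (gid (gstart t)) (val (gchain t)) i.

Lemma gstart_cont n : continuous (@gstart G n).
Proof.
move=> t; have := @initial_continuous _ _ (@gtuple_coord G n) t.
by move=> /(cvg_comp _ fst) /(_ (@cvg_fst _ _ _ _ _)); exact.
Qed.

Lemma gnth_cont n i : (i < n)%N -> continuous (fun t : gtuple G n => gnth t i).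
Proof.
move=> lin t; have := @initial_continuous _ _ (@gtuple_coord G n) t.
move=> /(cvg_comp _ snd) /(_ (@cvg_snd _ _ _ _ _)).
move=> /(cvg_comp _ (proj (Ordinal lin))) /(_ (@proj_continuous _ _ _ _)).
exact.
Qed.

Lemma gtuple_cvg n (Y : topologicalType) (f : Y -> gtuple G n) (y : Y) :
  {for y, continuous (fun u => gstart (f u))} ->
  (forall i, (i < n)%N -> {for y, continuous (fun u => gnth (f u) i)}) ->
  {for y, continuous f}.
Proof.
move=> cs cn; apply: (@initial_cvg _ _ (@gtuple_coord G n) (f @ y)).
have cn' : (fun u => (gtuple_coord (f u)).2) @ y -->
    ((gtuple_coord (f y)).2 : prod_topology (fun _ : 'I_n => arrow G)).
  by apply/cvg_sup => i; apply: initial_cvg; exact: cn (ltn_ord i).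
move=> O [[V W] [/= Vn Wn] VW].
have hV : \forall u \near y, V (gstart (f u)) by exact: cs.
have hW : \forall u \near y, W (gtuple_coord (f u)).2 by exact: cn'.
move: hV hW; rewrite /= /fmap /= /nbhs /=; apply: filterS2 => u Vu Wu.
by apply: VW; split.
Qed.

(** Local sections of G^(n) over the first range: each local section of the range map is evaluated
    at the source of the arrow chosen before it. *)
Fixpoint walk z (bs : seq (unit_space G -> arrow G)) : seq (arrow G) :=
  if bs is b :: bs' then b z :: walk (@gsrc G (b z)) bs' else [::].

Fixpoint good z (bs : seq (unit_space G -> arrow G)) : Prop :=
  if bs is b :: bs' then
    [/\ osec b z, \forall w \near z, @grng G (b w) = w & good (@gsrc G (b z)) bs']
  else True.

Lemma size_walk z bs : size (walk z bs) = size bs.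
Proof. by elim: bs z => //= b bs IH z; rewrite IH. Qed.

Lemma osec_src_cont b z : osec b z -> {for z, continuous (fun w => @gsrc G (b w))}.
Proof.
move=> ob; apply: (@continuous_comp _ _ _ b (@gsrc G)); first exact: osec_cvg.
exact: gsrc_cont.
Qed.

Lemma good_near z bs : good z bs -> \forall w \near z, good w bs.
Proof.
elim: bs z => [|b bs IH] z /=; first by move=> _; exact: nearW.
move=> [ob rb /IH gb].
have gb' : \forall w \near z, good (gsrc (b w)) bs by exact: (osec_src_cont ob gb).
by move: (osec_near ob) (near_join rb) gb'; apply: filterS3.
Qed.

Lemma good_chain z bs : good z bs -> ischain (C := G) z (walk z bs).
Proof.
elim: bs z => //= b bs IH z [ob rb /IH ->].
by rewrite andbT; apply/eqP; exact: nbhs_singleton rb.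
Qed.

Lemma good_cont z bs g0 i : good z bs -> (i < size bs)%N ->
  {for z, continuous (fun w => nth g0 (walk w bs) i)}.
Proof.
elim: bs z i => // b bs IH z [|i] /= [ob rb gb] ib; first exact: osec_cvg.
apply: (@continuous_comp _ _ _ (fun w => @gsrc G (b w)) (fun w => nth g0 (walk w bs) i)).
  exact: osec_src_cont.
exact: IH.
Qed.

Lemma good_exists x t : ischain (C := G) x t ->
  exists2 bs, good x bs & walk x bs = t.
Proof.
elim: t x => [|g t IH] x /=; first by exists [::].
move=> /andP[/eqP <- /IH [bs gb <-]].
have [b [ob bg rb]] := bisection eG g.
by exists (b :: bs); rewrite /= bg.
Qed.

Lemma walk_unique z bs g0 s : ischain (C := G) z s -> size s = size bs ->
  (forall i, (i < size bs)%N -> nth g0 s i = nth (@gid G) bs i (grng (nth g0 s i))) ->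
  s = walk z bs.
Proof.
elim: bs z s => [|b bs IH] z [|g s] //= /andP[/eqP rg cs] [ss] H.
have gE : g = b z by rewrite -rg; exact: (H 0%N).
rewrite -gE; congr cons; apply: IH => // i ib.
exact: (H i.+1).
Qed.
End Tuples.

Lemma cont_near_eq (X Y : topologicalType) (s t : Y -> X) y :
  (\forall z \near y, s z = t z) -> {for y, continuous s} -> {for y, continuous t}.
Proof.
move=> st; have e := nbhs_singleton st.
by rewrite /prop_for /continuous_at (near_eq_cvg st e) e.
Qed.

Section TupleSections.
Variables (G : groupoid) (eG : etale_groupoid G).
Implicit Types (x y z : unit_space G) (g h : arrow G).
Local Notation chainfrom n z := (@chainfrom G n z).

Definition tsec n (e : forall z, chainfrom n z) : unit_space G -> gtuple G n :=
  fun z => GTuple (e z).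

Definition tgerm n (e : forall z, chainfrom n z) x := osec (tsec e) x.

Lemma gtuple_eq n (t u : gtuple G n) : gstart t = gstart u ->
  val (gchain t) = val (gchain u) -> t = u.
Proof.
case: t u => [x t] [y u] /= xy; subst y => /val_inj ->.
by [].
Qed.

Lemma gtuple_inj n x (t u : chainfrom n x) : GTuple t = GTuple u -> t = u.
Proof.
move=> tu; apply: val_inj.
by have := congr1 (fun p : gtuple G n => val (gchain p)) tu.
Qed.

(** For openness: the tuples whose i-th entry lies on the i-th section form a neighbourhood, and
    such a tuple is the walk from its own starting point. *)
Lemma tgerm_walk n bs z : size bs = n -> good z bs ->
  tgerm (fun w => @chain_of G n w (walk w bs)) z.
Proof.
move=> sbs gb; set e := fun w => _.
have eE w : good w bs -> val (e w) = walk w bs.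
  by move=> gw; rewrite val_chain_of ?size_walk//; exact: good_chain.
have [g0] : exists g0 : arrow G, True by exists (gid z).
move=> _; move: (good_near eG gb); apply: filterS => y {}gb.
have ce : {for y, continuous (tsec e)}.
  apply: gtuple_cvg => [|i ib]; first exact: cvg_id.
  have ib' : (i < size bs)%N by rewrite sbs.
  apply: cont_near_eq (good_cont eG (g0:=g0) gb ib').
  move: (good_near eG gb); apply: filterS => w gw.
  by rewrite /gnth /= eE//; apply: set_nth_default; rewrite size_walk sbs.
apply/seteqP; split => O; first exact: ce.
move=> Oy; have {Oy} Oy : \forall w \near y, O (tsec e w) by [].
have N1 : nbhs (tsec e y) [set u | O (tsec e (gstart u)) /\ good (gstart u) bs].
  apply: (@gstart_cont G n (tsec e y) [set w | O (tsec e w) /\ good w bs]).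
  move: Oy (good_near eG gb); exact: filterS2.
have N2 : \forall u \near tsec e y, forall i : 'I_n,
    gnth u i = nth (@gid G) bs i (grng (gnth u i)).
  apply: (@filter_forall _ 'I_n (fun i u => gnth u i = nth (@gid G) bs i (grng (gnth u i)))
    (nbhs (tsec e y))) => i.
  apply: (@gnth_cont G n i (ltn_ord i) (tsec e y)
    [set h | h = nth (@gid G) bs i (grng h)]).
  have : exists y', [/\ osec (nth (@gid G) bs i) y', gnth (tsec e y) i = nth (@gid G) bs i y' &
      \forall w \near y', @grng G (nth (@gid G) bs i w) = w].
    rewrite /gnth /= eE//; have := ltn_ord i; rewrite -[X in (_ < X)%N]sbs.
    elim: (bs) (y) (nat_of_ord i) gb => // b bs' IH w [|j] /= [ob rb gb'] jb.
      by exists w.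
    have [y' [o e' r]] := IH _ _ gb' jb; exists y'; split => //.
    by rewrite -e'; apply: set_nth_default; rewrite size_walk.
  move=> [y' [o -> r]]; rewrite (osec_nbhs o).
  by apply: filterS r => w rw; rewrite /= rw.
move: N1 N2; apply: filterS2 => u [Ou gu] Hu.
suff -> : u = tsec e (gstart u) by [].
apply: gtuple_eq => //=; rewrite eE//.
apply: (@walk_unique G _ _ (gid (gstart u))).
- exact: chain_ischain.
- by rewrite chain_size.
- by rewrite sbs => i ib; exact: (Hu (Ordinal ib)).
Qed.

Lemma etale_tuple n x (t : chainfrom n x) :
  exists2 e : forall z, chainfrom n z, tgerm e x & e x = t.
Proof.
have [bs gb bt] := good_exists eG (chain_ischain t).
have sbs : size bs = n by rewrite -(size_walk x bs) bt; exact: chain_size.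
exists (fun w => @chain_of G n w (walk w bs)); first exact: tgerm_walk.
apply: val_inj; rewrite val_chain_of ?size_walk//; exact: good_chain.
Qed.

Lemma tgerm_agree n (e f : forall z, chainfrom n z) x : tgerm e x -> tgerm f x ->
  e x = f x -> \forall z \near x, e z = f z.
Proof.
move=> ge gf ef.
have : \forall z \near x, tsec e z = tsec f z.
  apply: (osec_agree (p := @gstart G n)) => //; [exact: nearW|exact: nearW| |].
    exact: osec_cvg.
  by rewrite /tsec ef.
by apply: filterS => z; exact: gtuple_inj.
Qed.

Lemma tgerm_of_cont n (e : forall z, chainfrom n z) x :
  {for x, continuous (tsec e)} -> tgerm e x.
Proof.
move=> ce; have [f gf fe] := etale_tuple (e x).
apply: (osec_of_cont (p := @gstart G n) (s := tsec f)) => //.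
- exact: nearW.
- exact: nearW.
- by rewrite /tsec fe.
Qed.

Lemma tgerm_gnth n (e : forall z, chainfrom n z) x g0 i : tgerm e x -> (i < n)%N ->
  {for x, continuous (fun z => nth g0 (val (e z)) i)}.
Proof.
move=> /osec_cvg ce ib.
have := @continuous_comp _ _ _ (tsec e) (fun t : gtuple G n => gnth t i) x ce
  (@gnth_cont G n i ib _).
apply: cont_near_eq; apply: nearW => z /=; rewrite /gnth /=.
by apply: set_nth_default; move: (chain_size (e z)) ib => /= ->.
Qed.

Lemma tgerm_chain_of n (F : unit_space G -> seq (arrow G)) x g0 :
  (\forall z \near x, size (F z) = n /\ ischain (C := G) z (F z)) ->
  (forall i, (i < n)%N -> {for x, continuous (fun z => nth g0 (F z) i)}) ->
  tgerm (fun z => @chain_of G n z (F z)) x.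
Proof.
move=> cF nF; apply: tgerm_of_cont; apply: gtuple_cvg => [|i ib].
  exact: cvg_id.
apply: cont_near_eq (nF i ib).
move: cF; apply: filterS => z [sF chF].
have E : val (@chain_of G n z (F z)) = F z by exact: val_chain_of.
by rewrite /gnth /= E; apply: set_nth_default; rewrite sF.
Qed.

Lemma gmul_continuous (Y : topologicalType) (f g : Y -> arrow G) (y : Y) :
  {for y, continuous f} -> {for y, continuous g} ->
  (\forall u \near y, gsrc (f u) = grng (g u)) ->
  {for y, continuous (fun u => gmul (f u) (g u))}.
Proof.
move=> cf cg fg O /(gmul_cont eG (nbhs_singleton fg)) [V [W [Vn Wn VW]]].
have hV : \forall u \near y, V (f u) by exact: cf.
have hW : \forall u \near y, W (g u) by exact: cg.
by move: hV hW fg; rewrite /= /fmap /= /nbhs /=; apply: filterS3 => u; exact: VW.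
Qed.

End TupleSections.

(** * The free sheaves on tuples of arrows *)

Section FreeSheaf.
Variables (G : groupoid) (eG : etale_groupoid G).
Implicit Types (x y z : unit_space G) (g h : arrow G).
Local Notation chainfrom n z := (@chainfrom G n z).
Local Notation chain_of n z t := (@chain_of G n z t).

Lemma gP_genE n x (t : chainfrom n.+1 x) : gP_gen n x (val t) = << t >>.
Proof. by rewrite /gP_gen valK. Qed.

Lemma gP_gen_chain n x t : size t = n.+1 -> ischain (C := G) x t ->
  gP_gen n x t = << chain_of n.+1 x t >>.
Proof.
move=> st ct; rewrite -gP_genE; congr gP_gen.
exact: (esym (@val_chain_of G _ _ _ st ct)).
Qed.

Lemma gP_gen_out n x t : ~~ ((size t == n.+1) && ischain (C := G) x t) ->
  gP_gen n x t = 0.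
Proof. by move=> nt; rewrite /gP_gen insubN. Qed.

Definition lincomb n k (a : 'I_k -> int) (e : 'I_k -> forall z, chainfrom n.+1 z) :
  forall z, gP_term G n z := fun z => \sum_(i < k) << e i z >> *~ a i.

(* Germs of sections that agree at a point agree near it, so the relations
   between the terms of a linear combination persist nearby. *)
Lemma lincomb_agree n k l a (e : 'I_k -> forall z, chainfrom n.+1 z)
    b (f : 'I_l -> forall z, chainfrom n.+1 z) x :
  (forall i, tgerm (e i) x) -> (forall i, tgerm (f i) x) ->
  lincomb a e x = lincomb b f x ->
  \forall z \near x, lincomb a e z = lincomb b f z.
Proof.
move=> ge gf ef.
pose h (u : 'I_k + 'I_l) := match u with inl i => e i | inr j => f j end.
have gh u : tgerm (h u) x by case: u.
have : \forall z \near x, forall u v, h u x = h v x -> h u z = h v z.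
  apply: filter_forall => u; apply: filter_forall => v.
  have [E|nE] := pselect (h u x = h v x); last by apply: nearW => z /nE.
  by move: (tgerm_agree (gh u) (gh v) E); apply: filterS.
apply: filterS => z H.
(* F sends the generator e_i(x) to e_i(z). It is well defined because sections equal at x are equal
   at z, and its linear extension carries the combination at x to the one at z. *)
pose F (t : chainfrom n.+1 x) : gP_term G n z :=
  if [pick u | h u x == t] is Some u then << h u z >> else 0.
have FE u : F (h u x) = << h u z >>.
  rewrite /F; case: pickP => [v /eqP /H ->//|/(_ u)]; by rewrite eqxx.
have lE m c (g : 'I_m -> forall z, chainfrom n.+1 z) :
    (forall i, F (g i x) = << g i z >>) -> lincomb c g z = flift F (lincomb c g x).
  move=> Fg; rewrite /lincomb raddf_sum; apply: eq_bigr => i _.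
  by rewrite raddfMz /= fliftU Fg.
rewrite (lE _ _ _ (fun i => FE (inl i))) (lE _ _ _ (fun i => FE (inr i))).
by rewrite ef.
Qed.

Lemma local_sectionP n (U : set (unit_space G)) (e : forall z, chainfrom n.+1 z) :
  open U -> local_section U e <-> (forall z, U z -> tgerm e z).
Proof.
move=> oU; split=> [[cU oe] z Uz|H].
  apply: tgerm_of_cont => //; move: cU.
  by rewrite continuous_open_subspace// => /(_ z); apply; exact/mem_set.
split.
  by apply: continuous_in_subspaceT => z /set_mem Uz; exact: osec_cvg (H z Uz).
rewrite openE => _ [z Uz <-]; rewrite /interior.
rewrite -[GTuple _]/(tsec e z) (osec_nbhs (H z Uz)).
by apply: filterS (open_nbhs_nbhs (conj oU Uz)) => w Uw; exists w.
Qed.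

Lemma tgerm_open n (e : forall z, chainfrom n.+1 z) x : tgerm e x ->
  \forall z \near x, tgerm e z.
Proof. exact: osec_near. Qed.

(** The subbase consists of images of such combinations. Continuity is [lincomb_agree]; the image
    over a small open set is itself subbasic, hence openness. *)
Lemma lincomb_germ n k a (e : 'I_k -> forall z, chainfrom n.+1 z) x :
  (forall i, tgerm (e i) x) -> germ (A := gP_term G n) (lincomb a e) x.
Proof.
move=> ge.
have : \forall z \near x, forall i, tgerm (e i) z.
  by apply: filter_forall => i; exact: tgerm_open.
apply: filterS => z {}ge; apply/seteqP; split => O.
  move: O; apply: (subbase_filter _ (@etale_subbase G (gP_term G n))).
  move=> _ [U [l [b [f [oU lf ->]]]]] [z' Uz' E].
  have zz : z' = z by exact: (congr1 tpt E).
  subst z'; have E1 := total_inj E.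
  have gf i : tgerm (f i) z by have /local_sectionP := lf i; apply.
  have N1 : \forall w \near z, U w by exact: open_nbhs_nbhs.
  have N2 := lincomb_agree gf ge E1.
  by move: N1 N2; apply: filterS2 => w Uw Ew; exists w => //; rewrite /sec -Ew.
move=> Oz; have {Oz} Oz : \forall w \near z, O (sec (A := gP_term G n) (lincomb a e) w) by [].
have : \forall w \near z, forall i, tgerm (e i) w.
  by apply: filter_forall => i; exact: tgerm_open.
move=> /filterS2 /(_ Oz) => /(_ (fun w => O (sec (A := gP_term G n) (lincomb a e) w) /\ forall i, tgerm (e i) w)).
move=> /(_ (fun w p q => conj q p)).
rewrite /prop_near1 nbhsE => -[W [oW Wz] WO].
rewrite nbhsE; exists [set Total w (lincomb a e w : gP_term G n w) | w in W]; last first.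
  by move=> _ [w /WO[+ _] <-].
split; last by exists z.
apply: (subbase_open (@etale_subbase G (gP_term G n))).
exists W, k, a, e; split=> // i; apply/local_sectionP => // w /WO[_]; exact.
Qed.

Lemma tuple_germ n (e : forall z, chainfrom n.+1 z) x : tgerm e x ->
  germ (A := gP_term G n) (fun z => << e z >>) x.
Proof.
move=> ge; have gl := @lincomb_germ n 1 (fun=> 1) (fun=> e) x (fun=> ge).
apply: germ_eq gl.
by apply: nearW => z; rewrite /lincomb big_ord_recl big_ord0 addr0 mulr1z.
Qed.

Lemma lincombB n k l a (e : 'I_k -> forall z, chainfrom n.+1 z)
    b (f : 'I_l -> forall z, chainfrom n.+1 z) x :
  (forall i, tgerm (e i) x) -> (forall i, tgerm (f i) x) ->
  exists m c (h : 'I_m -> forall z, chainfrom n.+1 z), (forall i, tgerm (h i) x) /\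
    forall z, lincomb a e z - lincomb b f z = lincomb c h z.
Proof.
move=> ge gf.
exists (k + l)%N, (fun i => match fintype.split i with inl j => a j | inr j => - b j end).
exists (fun i => match fintype.split i with inl j => e j | inr j => f j end).
split; first by move=> i; case: (fintype.split i).
move=> z; rewrite /lincomb big_split_ord /=; congr (_ + _).
  by apply: eq_bigr => i _; rewrite (unsplitK (inl i)).
rewrite -sumrN; apply: eq_bigr => i _.
by rewrite (unsplitK (inr i)) mulrNz.
Qed.

Lemma gP_lincomb n x (D : gP_term G n x) : exists k a (e : 'I_k -> forall z, chainfrom n.+1 z),
  (forall i, tgerm (e i) x) /\ lincomb a e x = D.
Proof.
have /choice[E HE] (t : chainfrom n.+1 x) :
    exists e : forall z, chainfrom n.+1 z, tgerm e x /\ e x = t.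
  by have [e] := etale_tuple eG t; exists e.
elim/freeg_ind: D => [|t|D D' [k [a [e [ge <-]]]] [l [b [f [gf <-]]]]].
- exists 0%N, (fun=> 0), (fun=> @idchain G n.+1); split; first by case.
  by rewrite /lincomb big_ord0.
- exists 1%N, (fun=> 1), (fun=> E t); split=> [_|]; first exact: (HE t).1.
  by rewrite /lincomb big_ord_recl big_ord0 addr0 mulr1z (HE t).2.
- by have [m [c [h [gh E']]]] := lincombB a b ge gf; exists m, c, h; rewrite E'.
Qed.

Lemma gP_etale n : etale_sheaf (gP_term G n).
Proof.
case=> x D; have [k [a [e [ge <-]]]] := gP_lincomb D.
by exists (lincomb a e) => //; exact: lincomb_germ.
Qed.

Lemma gP_germP n (s : forall z, gP_term G n z) x : germ s x ->
  exists k a (e : 'I_k -> forall z, chainfrom n.+1 z),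
  (forall i, tgerm (e i) x) /\ \forall z \near x, s z = lincomb a e z.
Proof.
move=> gs; have [k [a [e [ge E]]]] := gP_lincomb (s x).
exists k, a, e; split=> //; apply: germ_agree gs _ (esym E).
exact/osec_cvg/lincomb_germ.
Qed.

Lemma gP_act_gen n x y (g : @hom G x y) t : size t = n.+1 -> ischain (C := G) y t ->
  act (gP_term G n) g (gP_gen n y t) = gP_gen n x (mulhead (harr g) t).
Proof.
move=> st ct; rewrite gP_gen_chain//= /gP_act fliftU.
by rewrite (@val_chain_of G _ _ _ st ct).
Qed.

Lemma gP_ext n x (V : zmodType) (f f' : gP_term G n x -> V) :
  zmod_morphism f -> zmod_morphism f' ->
  (forall t, size t = n.+1 -> ischain (C := G) x t -> f (gP_gen n x t) = f' (gP_gen n x t)) ->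
  f =1 f'.
Proof.
move=> fB f'B ff'; apply: zmod_freeg_ext => // t; rewrite -gP_genE.
by apply: ff'; [exact: chain_size|exact: chain_ischain].
Qed.

Lemma gP_act_zmod n x y (g : @hom G x y) : zmod_morphism (act (gP_term G n) g).
Proof. exact: flift_zmod. Qed.

Lemma hom_mulhead n x y (g : @hom G x y) t : size t = n.+1 -> ischain (C := G) y t ->
  size (mulhead (harr g) t) = n.+1 /\ ischain (C := G) x (mulhead (harr g) t).
Proof.
move=> st ct; rewrite size_mulhead st; split=> //.
have /ischain_mulhead -/(_ _ ct) : src (harr g) = y by exact/eqP/(hom_src g).
by rewrite (eqP (hom_rng g)).
Qed.

Lemma gP_act_id n x (D : gP_term G n x) : act (gP_term G n) (@idh G x) D = D.
Proof.
apply: (gP_ext (f := act (gP_term G n) (@idh G x)) (f' := id)) => //.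
  exact: gP_act_zmod.
by move=> t st ct; rewrite gP_act_gen// mulhead_id.
Qed.

Lemma gP_act_comp n x y z (g : @hom G x y) (h : @hom G y z) (D : gP_term G n z) :
  act (gP_term G n) (comph g h) D = act (gP_term G n) g (act (gP_term G n) h D).
Proof.
apply: (gP_ext (f := act (gP_term G n) (comph g h))
  (f' := fun D => act (gP_term G n) g (act (gP_term G n) h D))).
- exact: gP_act_zmod.
- by move=> a b; rewrite !gP_act_zmod.
move=> t st ct; have [st' ct'] := hom_mulhead h st ct.
rewrite !gP_act_gen//=; congr gP_gen; rewrite mulhead_comp//.
  exact: hom_composable.
by rewrite (eqP (hom_src h)).
Qed.

(* The section z |-> b(z) . e(s(b(z))) through g . e(s(g)), for a local
   bisection b through g. *)
Lemma gP_germ_act n (g : arrow G) (e : forall z, chainfrom n.+1 z) : tgerm e (gsrc g) ->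
  exists2 e' : forall z, chainfrom n.+1 z, tgerm e' (grng g) &
  \forall h \near g, act (gP_term G n) (@hom_of G h) << e (gsrc h) >> = << e' (grng h) >>.
Proof.
move=> ge; have [b [ob bg rb]] := bisection eG g.
pose F z := mulhead (C := G) (b z) (val (e (gsrc (b z)))).
have FP z : grng (b z) = z -> size (F z) = n.+1 /\ ischain (C := G) z (F z).
  move=> bz; rewrite /F size_mulhead; split; first exact: chain_size.
  rewrite -{1}bz; apply: (@ischain_mulhead G (gsrc (b z))) => //.
  exact: chain_ischain.
have csb : {for grng g, continuous (fun z => @gsrc G (b z))} by exact: osec_src_cont.
have cne i : (i < n.+1)%N -> {for grng g, continuous (fun z => nth g (val (e (gsrc (b z)))) i)}.
  move=> ib; apply: (@continuous_comp _ _ _ (fun z => @gsrc G (b z)) (fun z => nth g (val (e z)) i)).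
    exact: csb.
  by rewrite /= bg; exact: tgerm_gnth.
exists (fun z => chain_of n.+1 z (F z)).
  apply: (tgerm_chain_of eG (g0 := g)); first by apply: filterS rb => z; exact: FP.
  case=> [|i] ib.
    apply: (cont_near_eq (s := fun z => gmul (b z) (nth g (val (e (gsrc (b z)))) 0))).
      apply: nearW => z; rewrite /F; case E : (val (e (gsrc (b z)))) => [|a t] //=.
      by have := chain_size (e (gsrc (b z))); rewrite E.
    apply: gmul_continuous => //; [exact: osec_cvg|exact: cne|].
    apply: nearW => z; have := chain_ischain (e (gsrc (b z))).
    have := chain_size (e (gsrc (b z))).
    by case: (val (e _)) => [|a t]//= _ /andP[/eqP ->].
  apply: cont_near_eq (cne i.+1 ib); apply: nearW => z; rewrite /F.
  by case: (val (e _)).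
have bh : \forall h \near g, h = b (grng h).
  have : nbhs (b (grng g)) [set h | h = b (grng h)].
    by rewrite (osec_nbhs ob); apply: filterS rb => z rz; rewrite /= rz.
  by rewrite bg.
apply: filterS bh => h hb.
rewrite -gP_genE gP_act_gen; [|exact: chain_size|exact: chain_ischain].
rewrite gP_gen_chain; last 2 first.
- by rewrite size_mulhead; exact: chain_size.
- by apply: (@ischain_mulhead G (gsrc h)) => //; exact: chain_ischain.
by rewrite /F -hb.
Qed.

Lemma gP_sheafy n : sheafy (gP_term G n).
Proof.
split.
- exact: gP_etale.
- move=> x; have := @lincomb_germ n 0 (fun=> 0) (fun=> @idchain G n.+1) x.
  have g0 (i : 'I_0) : tgerm (@idchain G n.+1) x by case: i.
  move=> /(_ g0).
  by apply: germ_eq; apply: nearW => z; rewrite /lincomb big_ord0.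
- move=> x s t /gP_germP[k [a [e [ge Es]]]] /gP_germP[l [b [f [gf Et]]]].
  have [m [c [h [gh E]]]] := lincombB a b ge gf.
  apply: germ_eq (lincomb_germ c gh).
  by move: Es Et; apply: filterS2 => z -> ->; rewrite E.
- exact: gP_act_zmod.
- exact: gP_act_id.
- exact: gP_act_comp.
- move=> g s /gP_germP[k [a [e [ge E]]]].
  have /choice[E' HE'] i : exists e' : forall z, chainfrom n.+1 z, tgerm e' (grng g) /\
      \forall h \near g, act (gP_term G n) (@hom_of G h) << e i (gsrc h) >> = << e' (grng h) >>.
    by have [e'] := gP_germ_act (ge i); exists e'.
  exists (lincomb a E'); first by apply: lincomb_germ => i; exact: (HE' i).1.
  have N1 : \forall h \near g, forall i,
      act (gP_term G n) (@hom_of G h) << e i (gsrc h) >> = << E' i (grng h) >>.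
    by apply: filter_forall => i; exact: (HE' i).2.
  have N2 : \forall h \near g, s (gsrc h) = lincomb a e (gsrc h).
    exact: (gsrc_cont eG E).
  move: N1 N2; apply: filterS2 => h H ->.
  rewrite /lincomb (zmod_sum (@gP_act_zmod n _ _ _)); apply: eq_bigr => i _.
  by rewrite (zmodMz (@gP_act_zmod n _ _ _)) H.
Qed.

Lemma gP_shmor n (B : sheaf G) (f : shfam (gP_term G n) B) : sheafy B ->
  (forall x, zmod_morphism (f x)) ->
  (forall (e : forall z, chainfrom n.+1 z) x, tgerm e x -> germ (fun z => f z << e z >>) x) ->
  (forall x y (g : @hom G x y) t, size t = n.+1 -> ischain (C := G) y t ->
     f x (gP_gen n x (mulhead (harr g) t)) = act B g (f y (gP_gen n y t))) ->
  is_shmor f.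
Proof.
move=> sB fB fg fe; split=> //.
- apply: shmor_cont; first exact: gP_etale.
  move=> x D; have [k [a [e [ge <-]]]] := gP_lincomb D.
  exists (lincomb a e); split=> //; first exact: lincomb_germ.
  have gs : germ (fun z => \sum_(i < k) f z << e i z >> *~ a i) x.
    by apply: germ_sumr => // i; apply: germMz => //; exact: fg.
  apply: germ_eq gs; apply: nearW => z; rewrite /lincomb (zmod_sum (fB z)).
  by apply: eq_bigr => i _; rewrite (zmodMz (fB z)).
- move=> x y g D.
  apply: (gP_ext (f := fun D => f x (act (gP_term G n) g D))
    (f' := fun D => act B g (f y D))).
  + by move=> a b; rewrite gP_act_zmod fB.
  + by move=> a b; rewrite fB (actB sB).
  by move=> t st ct; rewrite gP_act_gen// fe.
Qed.

Lemma gP_gen_germ n (F : unit_space G -> seq (arrow G)) x g0 :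
  (\forall z \near x, size (F z) = n.+1 /\ ischain (C := G) z (F z)) ->
  (forall i, (i < n.+1)%N -> {for x, continuous (fun z => nth g0 (F z) i)}) ->
  germ (A := gP_term G n) (fun z => gP_gen n z (F z)) x.
Proof.
move=> cF nF; apply: germ_eq (tuple_germ (tgerm_chain_of eG cF nF)).
by apply: filterS cF => z [sF chF]; rewrite gP_gen_chain.
Qed.

End FreeSheaf.

Arguments gP_bd {G n i} _.
Arguments gP_aug {G i} _.

Lemma subr_subACA (V : zmodType) (a b c d : V) : a - b - (c - d) = a - c - (b - d).
Proof. by rewrite !opprD !opprK !addrA [a - b - c]addrAC. Qed.

(** * Exactness of the bar resolution *)

Section BarResolution.
Variables (G : groupoid) (eG : etale_groupoid G).
Implicit Types (x y z : unit_space G) (g h : arrow G).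
Local Notation chainfrom n z := (@chainfrom G n z).

Lemma gP_bd_zmod n x : zmod_morphism (@gP_bd G n x).
Proof. exact: flift_zmod. Qed.

Lemma gP_aug_zmod x : zmod_morphism (@gP_aug G x).
Proof. exact: flift_zmod. Qed.

Lemma gP_bd_chain n x (t : chainfrom n.+2 x) : gP_bd (<< t >> : gP_term G n.+1 x) =
  gP_gen n x (take n.+1 (val t)) *~ (-1) ^+ n.+1 +
  \sum_(i < n.+1) gP_gen n x (merge (C := G) i (val t)) *~ (-1) ^+ i.
Proof. by rewrite /gP_bd fliftU big_add1 big_mkord. Qed.

Lemma gP_bd_gen n x t : size t = n.+2 -> ischain (C := G) x t ->
  gP_bd (gP_gen n.+1 x t) = gP_gen n x (take n.+1 t) *~ (-1) ^+ n.+1 +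
  \sum_(i < n.+1) gP_gen n x (merge (C := G) i t) *~ (-1) ^+ i.
Proof.
move=> st ct; rewrite gP_gen_chain// gP_bd_chain.
by rewrite (@val_chain_of G _ _ _ st ct).
Qed.

Lemma gP_aug_gen x t : size t = 1%N -> ischain (C := G) x t ->
  gP_aug (gP_gen 0 x t) = 1.
Proof. by move=> st ct; rewrite gP_gen_chain// /gP_aug fliftU. Qed.

Lemma bd_chain_size n x t (i : 'I_n.+1) : size t = n.+2 -> ischain (C := G) x t ->
  [/\ size (merge (C := G) i t) = n.+1, ischain (C := G) x (merge (C := G) i t),
      size (take n.+1 t) = n.+1 & ischain (C := G) x (take n.+1 t)].
Proof.
move=> st ct; split.
- by rewrite size_merge ?st//= ltnS ltn_ord.
- exact: ischain_merge.
- by rewrite size_takel// st.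
- exact: ischain_take.
Qed.

Lemma gP_bd_shmor n : is_shmor (@gP_bd G n).
Proof.
apply: (gP_shmor eG) => //.
- exact: gP_sheafy.
- exact: gP_bd_zmod.
- move=> e x ge; have [g0] : exists g0 : arrow G, True by exists (gid x).
  move=> _; have ne := fun i => tgerm_gnth (g0 := g0) (i := i) ge.
  have ce z := chain_ischain (e z); have se z := chain_size (e z).
  have g1 : germ (A := gP_term G n) (fun z => gP_gen n z (take n.+1 (val (e z)))) x.
    apply: (gP_gen_germ eG (g0 := g0)).
      by apply: nearW => z; have [] := bd_chain_size ord0 (se z) (ce z).
    move=> i ib; apply: cont_near_eq (ne i (ltnW ib)).
    by apply: nearW => z; rewrite nth_take.
  have g2 (i : 'I_n.+1) : germ (A := gP_term G n) (fun z => gP_gen n z (merge (C := G) i (val (e z)))) x.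
    apply: (gP_gen_germ eG (g0 := g0)).
      by apply: nearW => z; have [] := bd_chain_size i (se z) (ce z).
    move=> j jb; have i2 z : (i.+1 < size (val (e z)))%N.
      by rewrite [size _]se ltnS ltn_ord.
    pose F := if (j < i)%N then fun z => nth g0 (val (e z)) j else
       if j == i then fun z => gmul (nth g0 (val (e z)) i) (nth g0 (val (e z)) i.+1)
       else fun z => nth g0 (val (e z)) j.+1.
    apply: (cont_near_eq (s := F)).
      apply: nearW => z; rewrite (@nth_merge G g0 i j _ (i2 z)) /F.
      by case: ifP => // _; case: ifP.
    rewrite /F; case: ifP => [ji|_]; first exact: ne (ltnW jb).
    case: ifP => [_|_]; last exact: ne.
    apply: gmul_continuous => //; [exact: ne (ltnW (ltn_ord i))|exact: (ne i.+1 (ltn_ord i))|].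
    by apply: nearW => z; exact: (@ischain_nth G _ g0 _ _ (ce z) (i2 z)).
  have gg := germD (gP_sheafy eG n) (germMz ((-1) ^+ n.+1) (gP_sheafy eG n) g1)
    (germ_sumr (index_enum 'I_n.+1) (gP_sheafy eG n)
      (fun i => germMz ((-1) ^+ i) (gP_sheafy eG n) (g2 i))).
  by apply: germ_eq gg; apply: nearW => z; rewrite gP_bd_chain.
move=> x y g t st ct; have [st' ct'] := hom_mulhead g st ct.
have aB := @gP_act_zmod G n _ _ g.
rewrite !gP_bd_gen// (zmodD aB) (zmod_sum aB) (zmodMz aB).
have sg : src (harr g) = y by exact/eqP/(hom_src g).
congr (_ + _).
  have [_ _ s1 c1] := bd_chain_size ord0 st ct.
  by rewrite gP_act_gen// take_mulhead.
apply: eq_bigr => i _; rewrite (zmodMz aB).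
have [s1 c1 _ _] := bd_chain_size i st ct.
rewrite gP_act_gen// merge_mulhead//; first by rewrite sg.
by rewrite st ltnS ltn_ord.
Qed.

Lemma gP_aug_shmor : is_shmor (@gP_aug G).
Proof.
have csrc := gsrc_cont eG.
apply: (gP_shmor eG (B := ZZ G)).
- exact: const_sheafy.
- exact: gP_aug_zmod.
- move=> e x ge; apply: germ_eq (const_germ (1 : int) x).
  by apply: nearW => z; rewrite /gP_aug fliftU.
- move=> x y g t st ct; have [st' ct'] := hom_mulhead g st ct.
  by rewrite /= !gP_aug_gen.
Qed.

(** The contracting homotopy that puts the unit x in front. It is used on one stalk at a time and
    need not commute with the action. *)
Definition gP_htp n x : gP_term G n x -> gP_term G n.+1 x :=
  flift (fun t : chainfrom n.+1 x => gP_gen n.+1 x (gid x :: val t)).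

Lemma cons_id_chain x t : ischain (C := G) x (gid x :: t) = ischain (C := G) x t.
Proof. by rewrite /= (cat_rng_id (groupoidP G)) eqxx (cat_src_id (groupoidP G)). Qed.

Lemma gP_htp_zmod n x : zmod_morphism (@gP_htp n x).
Proof. exact: flift_zmod. Qed.

Lemma gP_htp_gen n x t : gP_htp (gP_gen n x t) = gP_gen n.+1 x (gid x :: t).
Proof.
have [/andP[/eqP st ct]|nt] := boolP ((size t == n.+1) && ischain (C := G) x t).
  by rewrite gP_gen_chain// /gP_htp fliftU (@val_chain_of G _ _ _ st ct).
rewrite !gP_gen_out// ?(zmod0 (@gP_htp_zmod n x))//.
by rewrite cons_id_chain /= eqSS.
Qed.

(** The first face of [x, t] absorbs the unit and returns [t]; the others are the faces of [t],
    shifted by one place and hence with the opposite sign. *)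
Lemma gP_htpS n x (D : gP_term G n.+1 x) :
  gP_bd (gP_htp D) = D - gP_htp (gP_bd D).
Proof.
apply: (gP_ext (f := fun D => gP_bd (gP_htp D)) (f' := fun D => D - gP_htp (gP_bd D))).
- by move=> a b; rewrite gP_htp_zmod gP_bd_zmod.
- by move=> a b; rewrite gP_bd_zmod gP_htp_zmod subr_subACA.
case=> [//|a t] st ct; have hB := @gP_htp_zmod n x.
have ia : gmul (gid x) a = a.
  by move: ct => /andP[/eqP <- _]; exact: cat_idl (groupoidP G) a.
rewrite gP_htp_gen gP_bd_gen ?cons_id_chain//; last by move: st => /= ->.
rewrite gP_bd_gen// (zmodD hB) (zmod_sum hB) (zmodMz hB) gP_htp_gen big_ord_recl.
rewrite [merge ord0 _]/= ia mulr1z addrCA opprD; congr (_ + (_ + _)).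
  by rewrite [(-1) ^+ n.+2]exprS mulN1r mulrNz.
rewrite -sumrN; apply: eq_bigr => i _.
by rewrite (zmodMz hB) gP_htp_gen lift0 exprS mulN1r mulrNz.
Qed.

Lemma gP_htp0 x (D : gP_term G 0 x) :
  gP_bd (gP_htp D) = D - gP_gen 0 x [:: gid x] *~ gP_aug D.
Proof.
apply: (gP_ext (f := fun D => gP_bd (gP_htp D))
  (f' := fun D => D - gP_gen 0 x [:: gid x] *~ gP_aug D)).
- by move=> a b; rewrite gP_htp_zmod gP_bd_zmod.
- move=> a b; by rewrite gP_aug_zmod mulrzBr subr_subACA.
move=> t st ct; rewrite gP_htp_gen gP_bd_gen ?cons_id_chain//=; last by rewrite st.
rewrite gP_aug_gen// big_ord_recl big_ord0 addr0.
case: t st ct => [|a []]//= _ /andP[/eqP <- _].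
rewrite (cat_idl (groupoidP G)) addrC; congr (_ + _).
Qed.

Lemma gP_aug_bd x (D : gP_term G 1 x) : gP_aug (gP_bd D) = 0.
Proof.
apply: (gP_ext (f := fun D => gP_aug (gP_bd D)) (f' := fun=> 0)) => //.
  by move=> a b; rewrite gP_bd_zmod gP_aug_zmod.
move=> t st ct; rewrite gP_bd_gen// big_ord_recl big_ord0 addr0 (zmodD (@gP_aug_zmod x)).
rewrite !(zmodMz (@gP_aug_zmod x)).
have [s1 c1 s2 c2] := bd_chain_size ord0 st ct.
by rewrite !gP_aug_gen.
Qed.

Lemma gP_act_htp n x (g : arrow G) (gx : grng g == x) t : size t = n.+1 ->
  ischain (C := G) (gsrc g) t ->
  act (gP_term G n.+1) (@Hom G x (gsrc g) g gx (eqxx _)) (gP_htp (gP_gen n (gsrc g) t)) =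
  gP_gen n.+1 x (g :: t).
Proof.
move=> st ct; rewrite gP_htp_gen gP_act_gen /=; last 2 first.
- by rewrite st.
- by rewrite (cat_rng_id (groupoidP G)) (cat_src_id (groupoidP G)) eqxx.
by rewrite (cat_idr (groupoidP G)).
Qed.

(* Every generator is g . h[t], so equivariance reduces d d = 0 to the homotopy
   formula. *)
Lemma gP_bd_bd n x (D : gP_term G n.+2 x) : gP_bd (gP_bd D) = 0.
Proof.
have be n' x' y (g : @hom G x' y) := (let: And3 _ _ H := gP_bd_shmor n' in H) x' y g.
elim: n x D => [|n IH] x D.
all: apply: (gP_ext (f := fun D => gP_bd (gP_bd D)) (f' := fun=> 0)) => //;
  [by move=> a b; rewrite !gP_bd_zmod|by move=> a b; rewrite subrr|].
all: case=> [|g t]//= [st] /andP[gx ct].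
all: rewrite -(gP_act_htp gx st ct) !be gP_htpS gP_bd_zmod.
  by rewrite gP_htp0 gP_aug_bd mulr0z subr0 subrr (zmod0 (gP_act_zmod _)).
by rewrite gP_htpS IH (zmod0 (@gP_htp_zmod _ _)) subr0 subrr (zmod0 (gP_act_zmod _)).
Qed.

Lemma gP_resolution : resolution (gP G).
Proof.
split=> /=.
- exact: gP_sheafy.
- exact: gP_bd_shmor.
- exact: gP_aug_shmor.
- move=> n x q; split=> [q0|[p _ <-]]; last exact: gP_bd_bd.
  by exists (gP_htp q) => //; rewrite gP_htpS q0 (zmod0 (@gP_htp_zmod _ _)) subr0.
- move=> x q; split=> [q0|[p _ <-]]; last exact: gP_aug_bd.
  by exists (gP_htp q) => //; rewrite gP_htp0 q0 mulr0z subr0.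
- move=> x m; exists (gP_gen 0 x [:: gid x] *~ m).
  rewrite (zmodMz (@gP_aug_zmod x)) gP_aug_gen ?intz//=.
  by rewrite (cat_rng_id (groupoidP G)) eqxx.
Qed.

End BarResolution.

(** * Infinite paths and the path groupoid *)

Section InfinitePaths.
Variables (k : nat) (L : kgraph k).
Implicit Types (x y z : ipath L) (j l m n p q : degree k) (lam mu a b : mor L).
Let cL := categoryP L.

Lemma degI p m n : p + m = p + n -> m = n.
Proof.
move=> /ffunP E; apply/ffunP => i; have := E i.
by rewrite !ffunE => /addnI.
Qed.

Lemma ledeg_exists p q : ledeg p q -> exists n, q = p + n.
Proof.
move=> /ledegP pq; exists (subdeg q p); apply/ffunP => i.
by rewrite !ffunE; apply/esym/subnKC.
Qed.

Lemma subdegDl p n : subdeg (p + n) p = n.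
Proof. by apply/ffunP => i; rewrite !ffunE; exact: addKn. Qed.

Lemma deg_factor a m n : kdeg a = m + n -> exists b c,
  [/\ src b = rng c, a = comp b c, kdeg b = m & kdeg c = n].
Proof. by move=> /kgraph_factor[[b c] [H _]]; exists b, c. Qed.

Lemma comp_cancel a b a' b' : src a = rng b -> src a' = rng b' ->
  comp a b = comp a' b' -> kdeg a = kdeg a' -> a = a' /\ b = b'.
Proof.
move=> ab ab' E aa'.
have D := kdeg_comp ab; have [[c d] [_ U]] := kgraph_factor D.
have E1 := U (a, b) (And4 ab erefl erefl erefl).
have D' : kdeg b' = kdeg b.
  by have := kdeg_comp ab'; rewrite -E D aa' => /degI.
have E2 := U (a', b') (And4 ab' E (esym aa') D').
by move: E1; rewrite E2 => -[-> ->].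
Qed.

(** The products a s(a) and r(a) a are two factorisations with a first factor of degree 0. *)
Lemma deg0_id a : kdeg a = 0 -> a = idm (rng a).
Proof.
move=> a0; have [] := @comp_cancel a (idm (src a)) (idm (rng a)) a.
- by rewrite (cat_rng_id cL).
- by rewrite (cat_src_id cL).
- by rewrite (cat_idl cL) (cat_idr cL).
- by rewrite kdeg_id a0.
by [].
Qed.

(** The segment x(p, p + n); indexing by the length keeps the proof of an inequality out of
    equations. *)
Definition sg x p n : mor L := fmor x (omk (ledeg_addl p n)).

Lemma fmor_sg x p q (pq : ledeg p q) n : q = p + n -> fmor x (omk pq) = sg x p n.
Proof.
by move=> E; congr (fmor x _); apply: val_inj; rewrite /= E.
Qed.

Lemma rng_sg x p n : rng (sg x p n) = x p.
Proof. by rewrite /sg fmor_rng. Qed.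

Lemma src_sg x p n : src (sg x p n) = x (p + n).
Proof. by rewrite /sg fmor_src. Qed.

Lemma kdeg_sg x p n : kdeg (sg x p n) = n.
Proof. by rewrite /sg ipath_deg /omega_deg /= subdegDl. Qed.

Lemma sg0 x p : sg x p 0 = idm (x p).
Proof. by rewrite [LHS]deg0_id ?kdeg_sg// rng_sg. Qed.

Lemma sgD x p n m : sg x p (n + m) = comp (sg x p n) (sg x (p + n) m).
Proof.
rewrite /sg -fmor_comp//; congr (fmor x _); apply: val_inj.
by rewrite [RHS]val_omega_comp//= addrA.
Qed.

Lemma sg_shift x q p n : sg (shift q x) p n = sg x (p + q) n.
Proof.
rewrite /sg /=; congr (fmor x _); apply: val_inj => /=.
by rewrite addrAC.
Qed.

Lemma ipath_ext x y : (forall n, sg x 0 n = sg y 0 n) -> x = y.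
Proof.
move=> E; have E' p n : sg x p n = sg y p n.
  have [] // := @comp_cancel (sg x 0 p) (sg x p n) (sg y 0 p) (sg y p n).
  - by rewrite src_sg rng_sg add0r.
  - by rewrite src_sg rng_sg add0r.
  - by have := E (p + n); rewrite !sgD !add0r.
  - by rewrite !kdeg_sg.
apply: ipath_eq; apply/funext.
  by move=> p; rewrite -(rng_sg x p 0) E' rng_sg.
case=> -[p q] pq; have [n E2] := ledeg_exists pq.
by rewrite -[exist _ _ _]/(omk pq) !(fmor_sg _ _ E2).
Qed.

Lemma ZpathP lam x : Zpath lam x <-> sg x 0 (kdeg lam) = lam.
Proof.
by rewrite /Zpath /= (fmor_sg x (ledeg0 _) (n := kdeg lam))// add0r.
Qed.

Lemma Zpath_sg x n : Zpath (sg x 0 n) x.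
Proof. by apply/ZpathP; rewrite kdeg_sg. Qed.

(** The value at (p, q) is the unique t with w(q) = w(p) t; cancellation makes this choice a
    functor. *)
Lemma path_of_prefixes (w : degree k -> mor L) :
  (forall q, kdeg (w q) = q) ->
  (forall p n, exists2 t, src (w p) = rng t & w (p + n) = comp (w p) t) ->
  exists x, forall q, sg x 0 q = w q.
Proof.
move=> dw cw.
pose T (a : omega_mor k) : mor L := xget (w 0)
  [set t | src (w (val a).1) = rng t /\ w (val a).2 = comp (w (val a).1) t].
have TP (a : omega_mor k) : src (w (val a).1) = rng (T a) /\ w (val a).2 = comp (w (val a).1) (T a).
  rewrite /T; case: xgetP => [t _ //|]; case: a => -[p q] /= pq.
  have [n ->] := ledeg_exists pq; have [t t1 t2] := cw p n.
  by move=> /(_ t)/(_ (conj t1 t2)).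
have TU (a : omega_mor k) t : src (w (val a).1) = rng t -> w (val a).2 = comp (w (val a).1) t -> T a = t.
  by move=> t1 t2; have [T1 T2] := TP a; case: (comp_cancel T1 t1 _ erefl); rewrite -?T2.
have Trng (a : mor (omega k)) : rng (T a) = src (w (rng a)) by have [-> _] := TP a.
have Tsrc (a : mor (omega k)) : src (T a) = src (w (src a)).
  by have [h] := TP a; rewrite /= /omega_src => ->; rewrite (cat_src_comp cL).
have Tid v : T (idm (v : obj (omega k))) = idm (src (w v)).
  apply: TU; first by rewrite (cat_rng_id cL).
  by rewrite /= (cat_idr cL).
have Tcomp (a b : mor (omega k)) : src a = rng b -> T (comp a b) = comp (T a) (T b).
  move=> ab; have ab' := val_omega_comp ab; have [a1 a2] := TP a; have [b1 b2] := TP b.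
  have Tab : src (T a) = rng (T b) by rewrite Tsrc Trng ab.
  apply: TU; rewrite ab' /=.
    by rewrite (cat_rng_comp cL).
  rewrite b2 (_ : (val b).1 = (val a).2) ?a2 ?(cat_compA cL)//.
pose F := @Functor (omega k) L (fun p => src (w p)) T Trng Tsrc Tid Tcomp.
have dF (a : mor (omega k)) : kdeg (fmor F a) = omega_deg a.
  have [h E] := TP a; have := kdeg_comp h; rewrite -E !dw /omega_deg.
  by move=> ->; rewrite subdegDl.
exists (IPath dF) => q; apply: TU; rewrite /= ?add0r.
  have [t h E] := cw 0 q.
  have -> : w 0 = idm (rng (w 0)) by apply: deg0_id; rewrite dw.
  have -> : rng (w q) = rng (w 0) by move: E; rewrite add0r => ->; rewrite (cat_rng_comp cL).
  by rewrite (cat_src_id cL).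
have [t h E] := cw 0 q; rewrite add0r in E.
have E0 : w 0 = idm (rng (w 0)) by apply: deg0_id; rewrite dw.
rewrite {1}E0 (_ : rng (w 0) = rng (w q)) ?(cat_idl cL)//.
by rewrite E (cat_rng_comp cL).
Qed.

(** Only deg f(q) >= q is asked, so nested sequences can be used as they come. The initial factors
    of degree q of the f(q) are coherent by cancellation. *)
Lemma path_of_sequence (f : degree k -> mor L) :
  (forall q, ledeg q (kdeg (f q))) ->
  (forall p n, exists2 t, src (f p) = rng t & f (p + n) = comp (f p) t) ->
  exists x, forall q, exists2 b, src (sg x 0 q) = rng b & f q = comp (sg x 0 q) b.
Proof.
move=> df cf.
have /choice[w Hw] q : exists a, kdeg a = q /\ exists2 b, src a = rng b & f q = comp a b.
  have [n En] := ledeg_exists (df q); have [a [b [ab E da db]]] := deg_factor En.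
  by exists a; split=> //; exists b.
have [x Hx] : exists x, forall q, sg x 0 q = w q.
  apply: path_of_prefixes => [q|p n]; first exact: (Hw q).1.
  have [dp [b pb Ep]] := Hw p; have [dpn [b' pb' Epn]] := Hw (p + n).
  have [a1 [a2 [a12 E d1 d2]]] := deg_factor dpn.
  have [t ft Et] := cf p n.
  have bt : src b = rng t by rewrite -ft Ep (cat_src_comp cL).
  have a2b : src a2 = rng b' by rewrite -pb' E (cat_src_comp cL).
  have [] // := @comp_cancel (w p) (comp b t) a1 (comp a2 b').
  - by rewrite (cat_rng_comp cL).
  - by rewrite (cat_rng_comp cL).
  - by rewrite !(cat_compA cL)// -E -Ep -Et -Epn.
  - by rewrite dp d1.
  by move=> wp _; exists a2; rewrite wp.
by exists x => q; rewrite Hx; exact: (Hw q).2.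
Qed.

(** As [pathcat] is a choice, a path with its two properties has to be built: it is the limit of the
    morphisms lam y(0, q). *)
Lemma pathcat_spec lam y : src lam = y 0 ->
  Zpath lam (pathcat lam y) /\ shift (kdeg lam) (pathcat lam y) = y.
Proof.
move=> ly; have sl n : src lam = rng (sg y 0 n) by rewrite rng_sg.
have [x Hx] : exists x, forall q, exists2 b, src (sg x 0 q) = rng b &
    comp lam (sg y 0 q) = comp (sg x 0 q) b.
  apply: path_of_sequence => [q|p n].
    by rewrite kdeg_comp// kdeg_sg ledeg_addr.
  exists (sg y p n); first by rewrite (cat_src_comp cL)// src_sg rng_sg add0r.
  by rewrite sgD add0r (cat_compA cL)// src_sg rng_sg add0r.
have Ex n : sg x 0 (kdeg lam + n) = comp lam (sg y 0 n).
  have [b sb E] := Hx (kdeg lam + n).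
  have sn : src (sg y 0 n) = rng (sg y (0 + n) (kdeg lam)) by rewrite src_sg rng_sg.
  have [] // := @comp_cancel (sg x 0 (kdeg lam + n)) b (comp lam (sg y 0 n)) (sg y (0 + n) (kdeg lam)).
  - by rewrite (cat_src_comp cL).
  - by rewrite -E addrC sgD (cat_compA cL).
  - by rewrite kdeg_comp// !kdeg_sg.
have E0 : sg x 0 (kdeg lam) = lam.
  by have := Ex 0; rewrite addr0 sg0 -ly (cat_idr cL).
rewrite /pathcat; case: xgetP => [z _ //|/(_ x)[]]; split; first exact/ZpathP.
apply: ipath_ext => n; rewrite sg_shift add0r.
have := Ex n; rewrite sgD E0 add0r => E.
by have [] := comp_cancel _ (sl n) E erefl; rewrite ?rng_sg // -[in LHS]E0 src_sg add0r.
Qed.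

Section PathCat.
Variables (lam : mor L) (y : ipath L).
Hypothesis ly : src lam = y 0.

Lemma shift_pathcat : shift (kdeg lam) (pathcat lam y) = y.
Proof. by have [] := pathcat_spec ly. Qed.

Lemma sg_pathcat0 : sg (pathcat lam y) 0 (kdeg lam) = lam.
Proof. by apply/ZpathP; have [] := pathcat_spec ly. Qed.

Lemma sg_pathcat p n : sg (pathcat lam y) (p + kdeg lam) n = sg y p n.
Proof. by rewrite -[in RHS]shift_pathcat sg_shift. Qed.

Lemma pathcat0 : (pathcat lam y) 0 = rng lam.
Proof. by rewrite -[in RHS]sg_pathcat0 rng_sg. Qed.

Lemma pathcat_at p : (pathcat lam y) (p + kdeg lam) = y p.
Proof. by rewrite -[in RHS]shift_pathcat. Qed.

End PathCat.

Lemma pathcat_unique lam y x : sg x 0 (kdeg lam) = lam -> shift (kdeg lam) x = y ->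
  pathcat lam y = x.
Proof.
move=> xl xy; have ly : src lam = y 0 by rewrite -xl src_sg -xy.
apply: ipath_ext => n.
have E z : sg z 0 (kdeg lam) = lam -> shift (kdeg lam) z = y ->
    sg z 0 (kdeg lam + n) = comp lam (sg y 0 n).
  by move=> E1 E2; rewrite sgD E1 -E2 sg_shift.
have E1 := E _ (sg_pathcat0 ly) (shift_pathcat ly); have E2 := E _ xl xy.
rewrite -E2 [kdeg lam + n]addrC !sgD in E1.
by have [] := comp_cancel _ _ E1 _; rewrite ?src_sg ?rng_sg ?kdeg_sg.
Qed.

Lemma pathcat_shift x p : pathcat (sg x 0 p) (shift p x) = x.
Proof. by apply: pathcat_unique; rewrite kdeg_sg. Qed.

Lemma pathcat_comp a b y : src a = rng b -> src b = y 0 ->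
  pathcat (comp a b) y = pathcat a (pathcat b y).
Proof.
move=> ab b_y; have ay : src a = (pathcat b y) 0 by rewrite pathcat0.
apply: pathcat_unique; rewrite kdeg_comp//.
  by rewrite sgD sg_pathcat0// sg_pathcat// sg_pathcat0.
by rewrite addrC -shiftD shift_pathcat// shift_pathcat.
Qed.

Lemma path_eq_prefix x y p : sg x 0 p = sg y 0 p -> shift p x = shift p y -> x = y.
Proof. by move=> E1 E2; rewrite -(pathcat_shift x p) E1 E2 pathcat_shift. Qed.

Lemma path_exists (hL : row_finite_no_sources L) (v : obj L) : exists x, x 0 = v.
Proof.
pose one : degree k := [ffun=> 1%N].
have /choice[e He] u : exists a, kdeg a = one /\ rng a = u by have [_ [a]] := hL one u; exists a.
pose c := fix c N := if N is M.+1 then comp (c M) (e (src (c M))) else idm v.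
have cS N : src (c N) = rng (e (src (c N))) by rewrite (He _).2.
have dc N i : kdeg (c N) i = N.
  elim: N => [|N IH] /=; first by rewrite kdeg_id ffunE.
  by rewrite kdeg_comp//= ffunE IH (He _).1 ffunE; exact: addn1.
have cc N M : exists2 t, src (c N) = rng t & c (N + M)%N = comp (c N) t.
  elim: M => [|M [t Nt E]].
    by exists (idm (src (c N))); rewrite ?(cat_rng_id cL)// addn0 (cat_idr cL).
  have ct : src t = src (c (N + M)%N) by rewrite E (cat_src_comp cL).
  exists (comp t (e (src t))); first by rewrite (cat_rng_comp cL)// (He _).2.
  by rewrite addnS /= -ct {1}E (cat_compA cL)// (He _).2.
have rc N : rng (c N) = v.
  by elim: N => [|N IH] /=; rewrite ?(cat_rng_id cL)// (cat_rng_comp cL).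
(* The sum of the coordinates dominates each of them and is additive, so c(N q) has degree at least
   q and these morphisms are nested. *)
pose N q := (\sum_i q i)%N.
have [x Hx] : exists x, forall q, exists2 b, src (sg x 0 q) = rng b &
    c (N q) = comp (sg x 0 q) b.
  apply: path_of_sequence => [q|p n].
    by apply/ledegP => i; rewrite dc /N (bigD1 i)//= leq_addr.
  have -> : N (p + n) = (N p + N n)%N; last exact: cc.
  by rewrite /N -big_split; apply: eq_bigr => i _; rewrite ffunE.
exists x; have [b xb E] := Hx 0.
by rewrite -(rng_sg x 0 0) -(cat_rng_comp cL xb) -E.
Qed.

End InfinitePaths.

Section DegreeArith.
Variable k : nat.
Implicit Types (m n : degree k) (a b : zdegree k).

Lemma degDE m n i : (m + n) i = (m i + n i)%N. Proof. by rewrite ffunE. Qed.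
Lemma deg0E i : (0 : degree k) i = 0%N. Proof. by rewrite ffunE. Qed.
Lemma zdegE m i : zdeg m i = (m i)%:Z. Proof. by rewrite ffunE. Qed.
Lemma zdegDE a b i : (a + b) i = a i + b i. Proof. by rewrite ffunE. Qed.
Lemma zdegNE a i : (- a) i = - a i. Proof. by rewrite ffunE. Qed.
Lemma zdeg0E i : (0 : zdegree k) i = 0. Proof. by rewrite ffunE. Qed.

Lemma degP m n : (forall i, m i = n i :> nat) -> m = n.
Proof. by move=> mn; apply/ffunP. Qed.
Lemma zdegP a b : (forall i, a i = b i :> int) -> a = b.
Proof. by move=> ab; apply/ffunP. Qed.
Lemma degK m n : m = n -> forall i, m i = n i :> nat.
Proof. by move=> ->. Qed.
Lemma zdegK a b : a = b -> forall i, a i = b i :> int.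
Proof. by move=> ->. Qed.

End DegreeArith.

Definition degE := (degDE, deg0E, zdegE, zdegDE, zdegNE, zdeg0E).

Ltac deg_lia :=
  intros; (apply: degP || apply: zdegP);
  let i := fresh "i" in move=> i; rewrite ?degE;
  repeat match goal with
  | E : _ = _ |- _ =>
      (move/degK/(_ i): E || move/zdegK/(_ i): E); rewrite ?degE => E
  end; lia.

(** * The path groupoid is étale *)

Section PathGroupoidEtale.
Variables (k : nat) (L : kgraph k).
Implicit Types (x y z w : ipath L) (j l m n p q : degree k) (lam mu nu : mor L).
Implicit Types g h : parrow L.
Let cL := categoryP L.

Lemma sg_prefix x y p n : sg x 0 (p + n) = sg y 0 (p + n) -> sg x 0 p = sg y 0 p.
Proof.
rewrite !sgD => E.
by have [] := comp_cancel _ _ E _; rewrite ?src_sg ?rng_sg ?kdeg_sg ?add0r.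
Qed.

Lemma sg_suffix x y p n : sg x 0 (p + n) = sg y 0 (p + n) -> sg x p n = sg y p n.
Proof.
rewrite !sgD !add0r => E.
by have [] := comp_cancel _ _ E _; rewrite ?src_sg ?rng_sg ?kdeg_sg ?add0r.
Qed.

(** The cylinders around x are directed: the one of degree p + q lies in those of degrees p and
    q. *)
Lemma nbhs_ipath x (O : set (ipath L)) :
  nbhs x O <-> exists p, forall z, sg z 0 p = sg x 0 p -> O z.
Proof.
split; last first.
  move=> [p Op]; rewrite nbhsE; exists (Zpath (sg x 0 p)).
    split; last exact: Zpath_sg.
    by apply: (subbase_open (@ipath_subbase k L)); exists (sg x 0 p).
  by move=> z /ZpathP; rewrite kdeg_sg => /Op.
pose F := [set O : set (ipath L) | exists p, forall z, sg z 0 p = sg x 0 p -> O z].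
move: O; apply: (subbase_filter (F := F) _ (@ipath_subbase k L)).
  split; first by exists 0.
    move=> P Q [p Pp] [q Qq]; exists (p + q) => z E; split; last apply: Qq.
      exact/Pp/sg_prefix/E.
    by apply: (@sg_prefix _ _ q p); rewrite [q + p]addrC.
  by move=> P Q PQ [p Pp]; exists p => z /Pp /PQ.
move=> _ [lam _ <-] /ZpathP xl; exists (kdeg lam) => z E.
by apply/ZpathP; rewrite E.
Qed.

(** A level of g: a pair of shifts that witnesses g as an arrow. By [levD] and [lev_join] any two
    levels have a common translate. *)
Definition lev g j l : Prop :=
  pdeg g = zdeg j - zdeg l /\ shift j (prng g) = shift l (psrc g).

Lemma lev_exists g : exists j l, lev g j l.
Proof. by have /asboolP[j [l [E1 E2]]] := valP g; exists j, l. Qed.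

Lemma levD g j l n : lev g j l -> lev g (j + n) (l + n).
Proof.
move=> [E1 E2]; split; first by move: E1; deg_lia.
by rewrite addrC [l + n]addrC -!shiftD E2.
Qed.

Lemma lev_sg g j l n : lev g j l -> sg (prng g) j n = sg (psrc g) l n.
Proof.
move=> [_ E]; have : sg (shift j (prng g)) 0 n = sg (shift l (psrc g)) 0 n by rewrite E.
by rewrite !sg_shift !add0r.
Qed.

Lemma lev_at g j l n : lev g j l -> prng g (j + n) = psrc g (l + n).
Proof. by move=> gl; rewrite -!src_sg (lev_sg n gl). Qed.

Lemma lev_join g j l j' l' : lev g j l -> lev g j' l' -> j + l' = j' + l.
Proof. by move=> [E _] [E' _]; deg_lia. Qed.

Lemma pmkP x y j l : shift j x = shift l y ->
  [/\ prng (pmk x (zdeg j - zdeg l) y) = x, psrc (pmk x (zdeg j - zdeg l) y) = y &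
      lev (pmk x (zdeg j - zdeg l) y) j l].
Proof.
move=> E; have V : val (pmk x (zdeg j - zdeg l) y) = (x, zdeg j - zdeg l, y).
  by rewrite /pmk val_insubd (_ : in_parrow _)//; apply/asboolP; exists j, l.
by rewrite /lev /prng /psrc /pdeg V.
Qed.

Lemma pmk_eta g j l : lev g j l -> g = pmk (prng g) (zdeg j - zdeg l) (psrc g).
Proof.
move=> [E1 E2]; have [r1 r2 [r3 _]] := pmkP E2.
by apply: parrow_eq; rewrite ?r1 ?r2 ?r3.
Qed.

(** Membership of h in the basic set Z(r(g)(0, j), s(g)(0, l)), in terms of segments; see
    [Zarrow_sg]. *)
Definition near_at g j l h := [/\ lev h j l,
  sg (prng h) 0 j = sg (prng g) 0 j & sg (psrc h) 0 l = sg (psrc g) 0 l].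

(** Past the level (j, l) both ends of h continue with the same segment of degree n, namely that of
    g, and then with the same tail. *)
Lemma near_atW g j l n h : lev g j l -> near_at g (j + n) (l + n) h -> near_at g j l h.
Proof.
move=> gl [[E1 E2] P1 P2]; split; [split|exact: sg_prefix P1|exact: sg_prefix P2].
  by move: E1; deg_lia.
apply: (@path_eq_prefix _ _ _ _ n); last by rewrite !shiftD addrC E2 addrC.
by rewrite !sg_shift !add0r (sg_suffix P1) (sg_suffix P2) (lev_sg n gl).
Qed.

Lemma ZarrowP mu nu g : src mu = src nu ->
  Zarrow (mu, nu) g <-> [/\ lev g (kdeg mu) (kdeg nu),
    sg (prng g) 0 (kdeg mu) = mu & sg (psrc g) 0 (kdeg nu) = nu].
Proof.
move=> mn; split=> [[z [zm E1 E2 E3]]|[[E1 E2] E3 E4]].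
  have zn : src nu = z 0 by rewrite -mn.
  split; [split=> //|by rewrite E1; exact: sg_pathcat0|by rewrite E3; exact: sg_pathcat0].
  by rewrite E1 E3 !shift_pathcat.
exists (shift (kdeg mu) (prng g)); split=> //=.
- by rewrite -[in RHS]E3 src_sg.
- exact/esym/pathcat_unique.
- exact/esym/(pathcat_unique E4)/esym.
Qed.

Lemma Zarrow_sg g j l h : lev g j l ->
  Zarrow (sg (prng g) 0 j, sg (psrc g) 0 l) h <-> near_at g j l h.
Proof.
move=> gl; have sE : src (sg (prng g) 0 j) = src (sg (psrc g) 0 l).
  by rewrite !src_sg ![0 + _]addrC (lev_at 0 gl).
by split=> [/(ZarrowP _ sE)|H]; [|apply/(ZarrowP _ sE)]; rewrite !kdeg_sg.
Qed.

Lemma nbhs_parrow g (O : set (parrow L)) :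
  nbhs g O <-> exists j l, lev g j l /\ forall h, near_at g j l h -> O h.
Proof.
split; last first.
  move=> [j [l [gl Og]]]; rewrite nbhsE.
  exists (Zarrow (sg (prng g) 0 j, sg (psrc g) 0 l)).
    split; last exact/(Zarrow_sg _ gl).
    apply: (subbase_open (@parrow_subbase k L)); exists (sg (prng g) 0 j, sg (psrc g) 0 l) => //=.
    by rewrite !src_sg ![0 + _]addrC (lev_at 0 gl).
  by move=> h /(Zarrow_sg _ gl)/Og.
pose F := [set O : set (parrow L) | exists j l, lev g j l /\ forall h, near_at g j l h -> O h].
move: O; apply: (subbase_filter (F := F) _ (@parrow_subbase k L)).
  split; first by have [j [l gl]] := lev_exists g; exists j, l.
    move=> P Q [j [l [gl Pg]]] [j' [l' [gl' Qg]]].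
    have E1 : j + j' = j' + j by rewrite addrC.
    have E2 : l + j' = l' + j by have := lev_join gl gl'; deg_lia.
    exists (j + j'), (l + j'); split; first exact: levD.
    move=> h H; split; first exact/Pg/(near_atW gl H).
    by rewrite E1 E2 in H; exact/Qg/(near_atW gl' H).
  by move=> P Q PQ [j [l [gl Pg]]]; exists j, l; split=> // h /Pg /PQ.
move=> _ [[mu nu] /= mn <-] gZ; have [gl m1 n1] := proj1 (ZarrowP g mn) gZ.
exists (kdeg mu), (kdeg nu); split=> // h [H1 H2 H3].
by apply/(ZarrowP h mn); rewrite H2 H3.
Qed.

Lemma nbhs_parrow_at g j l (O : set (parrow L)) : lev g j l -> nbhs g O ->
  exists n, forall h, near_at g (j + n) (l + n) h -> O h.
Proof.
move=> gl /nbhs_parrow[j' [l' [gl' Og]]]; exists j'.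
have E1 : j + j' = j' + j by rewrite addrC.
have E2 : l + j' = l' + j by have := lev_join gl gl'; deg_lia.
by rewrite E1 E2 => h H; exact/Og/(near_atW gl' H).
Qed.

Lemma prng_cont : continuous (@prng k L).
Proof.
move=> g O /nbhs_ipath[p Op]; have [j [l gl]] := lev_exists g.
apply/nbhs_parrow; exists (j + p), (l + p); split; first exact: levD.
move=> h [_ E _]; apply: Op; apply: (@sg_prefix _ _ p j).
by rewrite [p + j]addrC.
Qed.

Lemma psrc_cont : continuous (@psrc k L).
Proof.
move=> g O /nbhs_ipath[p Op]; have [j [l gl]] := lev_exists g.
apply/nbhs_parrow; exists (j + p), (l + p); split; first exact: levD.
move=> h [_ _ E]; apply: Op; apply: (@sg_prefix _ _ p l).
by rewrite [p + l]addrC.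
Qed.

Lemma lev_mul g h j m l : psrc g = prng h -> lev g j m -> lev h m l -> lev (pmul g h) j l.
Proof.
move=> gh [E1 E2] [E3 E4]; split.
  by rewrite pdeg_mul// E1 E3; deg_lia.
by rewrite prng_mul// psrc_mul// E2 gh.
Qed.

Lemma lev_pair g h : psrc g = prng h -> exists j m l, lev g j m /\ lev h m l.
Proof.
move=> gh; have [a [b gl]] := lev_exists g; have [c [d hl]] := lev_exists h.
exists (a + c), (b + c), (d + b); split; first exact: levD.
by rewrite [b + c]addrC; exact: levD.
Qed.

Lemma pmul_cont g h : psrc g = prng h -> forall O, nbhs (pmul g h) O ->
  exists V W, [/\ nbhs g V, nbhs h W & forall g' h', V g' -> W h' ->
    psrc g' = prng h' -> O (pmul g' h')].
Proof.
move=> gh O; have [j [m [l [gl hl]]]] := lev_pair gh.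
move=> /(nbhs_parrow_at (lev_mul gh gl hl))[n On].
exists (near_at g (j + n) (m + n)), (near_at h (m + n) (l + n)); split.
- by apply/nbhs_parrow; exists (j + n), (m + n); split=> //; exact: levD.
- by apply/nbhs_parrow; exists (m + n), (l + n); split=> //; exact: levD.
move=> g' h' [gl' g1 g2] [hl' h1 h2] gh'; apply: On; split.
- exact: lev_mul hl'.
- by rewrite !prng_mul.
- by rewrite !psrc_mul.
Qed.

(** The local section of the range map through g: the initial segment of z of degree j is replaced
    by the one of s(g) of degree l. *)
Definition bisec g j l : ipath L -> parrow L := fun z =>
  pmk z (zdeg j - zdeg l) (pathcat (sg (psrc g) 0 l) (shift j z)).

Lemma bisecP g j l z : lev g j l -> sg z 0 j = sg (prng g) 0 j ->
  [/\ prng (bisec g j l z) = z, near_at g j l (bisec g j l z) &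
      psrc (bisec g j l z) = pathcat (sg (psrc g) 0 l) (shift j z)].
Proof.
move=> gl zj; have sz : src (sg (psrc g) 0 l) = (shift j z) 0.
  rewrite /= src_sg [0 + l]addrC -(lev_at 0 gl) [j + 0]addrC -!src_sg.
  by rewrite zj.
have E : shift j z = shift l (pathcat (sg (psrc g) 0 l) (shift j z)).
  by have := shift_pathcat sz; rewrite kdeg_sg.
have [r1 r2 r3] := pmkP E; split=> //; split=> //.
  by rewrite r1 zj.
by have := sg_pathcat0 sz; rewrite r2 kdeg_sg.
Qed.

Lemma bisec_unique g j l h : near_at g j l h -> h = bisec g j l (prng h).
Proof.
move=> [hl E1 E2]; rewrite {1}(pmk_eta hl) /bisec; congr pmk.
apply/esym/pathcat_unique; first by rewrite kdeg_sg E2.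
by rewrite kdeg_sg; have [_ ->] := hl.
Qed.

Lemma bisec_self g j l : lev g j l -> bisec g j l (prng g) = g.
Proof. by move=> gl; rewrite -bisec_unique. Qed.

Lemma bisec_osec g j l z : lev g j l -> sg z 0 j = sg (prng g) 0 j ->
  nbhs (bisec g j l z) = (bisec g j l @ z).
Proof.
move=> gl zj; have [r1 b1 s1] := bisecP gl zj; have [bl _ _] := b1.
apply/seteqP; split=> O.
  move=> /(nbhs_parrow_at bl)[n On].
  apply/nbhs_ipath; exists (j + n) => w wn.
  have wj := sg_prefix wn; have wj' : sg w 0 j = sg (prng g) 0 j by rewrite wj.
  have [r2 [bl2 _ _] s2] := bisecP gl wj'.
  apply: On; split; [exact: levD|by rewrite r1 r2|].
  have sw y : sg y 0 j = sg (prng g) 0 j -> src (sg (psrc g) 0 l) = (shift j y) 0.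
    move=> yj; rewrite /= src_sg [0 + l]addrC -(lev_at 0 gl) [j + 0]addrC -!src_sg.
    by rewrite yj.
  have P0 y (yj : sg y 0 j = sg (prng g) 0 j) : sg (pathcat (sg (psrc g) 0 l) (shift j y)) 0 l = sg (psrc g) 0 l.
    by have := sg_pathcat0 (sw _ yj); rewrite kdeg_sg.
  have P1 y (yj : sg y 0 j = sg (prng g) 0 j) : sg (pathcat (sg (psrc g) 0 l) (shift j y)) (0 + l) n = sg y j n.
    by have := sg_pathcat (sw _ yj) 0 n; rewrite kdeg_sg sg_shift [0 + j]add0r.
  by rewrite !sgD s1 s2 !P0// !P1// (sg_suffix wn).
move=> /nbhs_ipath[p Op].
apply/nbhs_parrow; exists (j + p), (l + p); split; first exact: levD.
move=> h H; have H1 := near_atW bl H; have [_ E _] := H.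
have -> : h = bisec g j l (prng h).
  apply: bisec_unique; have [h1 h2 h3] := H1; split=> //; first by rewrite h2 r1.
  by rewrite h3; have [_ _ ->] := b1.
apply: Op; apply: (@sg_prefix _ _ p j); rewrite [p + j]addrC E r1.
by [].
Qed.

Lemma path_etale : etale_groupoid (path_groupoid L).
Proof.
split; [exact: prng_cont|exact: psrc_cont|exact: pmul_cont|].
move=> g; have [j [l gl]] := lev_exists g.
have N : \forall z \near prng g, sg z 0 j = sg (prng g) 0 j.
  by apply/nbhs_ipath; exists j.
exists (bisec g j l); split.
- by apply: filterS N => z; exact: bisec_osec.
- exact: bisec_self.
- by apply: filterS N => z zj; have [] := bisecP gl zj.
Qed.

End PathGroupoidEtale.

(** * The sheaf of a module *)

Section UnderSheaf.
Variables (k : nat) (L : kgraph k).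
Implicit Types (x y z : ipath L) (j l m n p q : degree k).
Local Notation G := (path_groupoid L).

Section Module.
Variable A : rmodule L.

(* phi^x_p(a), for a in A_v; junk value 0 unless v = x(p) *)
Definition phv x p v (a : A v) : dlim A x :=
  if pselect (v = x p) is left e then phi A x p (transp e a) else 0.

Lemma phvE x p (a : A (x p)) : phv x p a = phi A x p a.
Proof. by rewrite /phv; case: pselect => // e; rewrite (Prop_irrelevance e erefl). Qed.

Lemma phv_cast x p v (e : v = x p) (a : A v) : phi A x p (transp e a) = phv x p a.
Proof. by rewrite /phv; case: pselect => // e'; rewrite (Prop_irrelevance e e'). Qed.

Lemma phi_zmod x p : zmod_morphism (phi A x p).
Proof.
move=> a b; apply/esym.
by rewrite -[- phi A x p b]/(dlimN (phi A x p b)) dlimN_phi; exact: dlimD_phi.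
Qed.

Lemma phv_zmod x p v : zmod_morphism (@phv x p v).
Proof.
move=> a b; rewrite /phv; case: pselect => [e|_]; last by rewrite subr0.
rewrite -phi_zmod; congr phi; case: _ / e.
by [].
Qed.

Lemma phv_map x p n v w (h : hom v w) (a : A v) : harr h = sg x p n ->
  phv x (p + n) (mmap A h a) = phv x p a.
Proof.
move=> E.
have ev : v = x p by rewrite -(eqP (hom_rng h)) E rng_sg.
have ew : w = x (p + n) by rewrite -(eqP (hom_src h)) E src_sg.
subst v w; rewrite !phvE -(phi_map (ledeg_addl p n)) /xmap; congr phi.
by congr (mmap A _ a); exact: hom_inj.
Qed.

Lemma phv_eq x p q v w (a : A v) (b : A w) : v = x p -> w = x q ->
  phv x p a = phv x q b -> exists n m u (h : hom v u) (h' : hom w u),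
  [/\ p + n = q + m, harr h = sg x p n, harr h' = sg x q m & mmap A h a = mmap A h' b].
Proof.
move=> ev ew; subst v w; rewrite !phvE => /phiP[r [pr [qr E]]].
have [n En] := ledeg_exists pr; have [m Em] := ledeg_exists qr.
exists n, m, (x r), (seg x pr), (seg x qr); split=> //.
- by rewrite -En.
- by rewrite /= (fmor_sg x pr En).
- by rewrite /= (fmor_sg x qr Em).
Qed.

Lemma phv_common x l (s t : dlim A x) : exists n (a b : A (x (l + n))),
  s = phv x (l + n) a /\ t = phv x (l + n) b.
Proof.
have [p [a [b [_ [-> -> _]]]]] := dlim_common s t s.
exists p; have E : p + l = l + p by rewrite addrC.
rewrite -E; exists (xmap A x (ledeg_addl p l) a), (xmap A x (ledeg_addl p l) b).
by rewrite !phvE !phi_map.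
Qed.

Lemma phv_at x l (s : dlim A x) : exists n (a : A (x (l + n))), s = phv x (l + n) a.
Proof. by have [n [a [_ [E _]]]] := phv_common l s s; exists n, a. Qed.

(** An equality in the direct limit is witnessed at a finite level, hence holds for every path with
    the same initial segment up to that level. *)
Lemma phv_eq_near x p q v w (a : A v) (b : A w) : v = x p -> w = x q ->
  phv x p a = phv x q b -> \forall z \near x, phv z p a = phv z q b.
Proof.
move=> ev ew /(phv_eq ev ew)[n [m [u [h [h' [E hE hE' ab]]]]]].
apply/nbhs_ipath; exists (p + n) => z zx.
rewrite -(@phv_map z p n _ _ h) ?hE ?(sg_suffix zx)// ab E phv_map//.
by rewrite hE'; apply/esym/sg_suffix; rewrite -E.
Qed.

Lemma ubasicP lam (a : A (src lam)) (u : total (ustalk A)) : ubasic a u <->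
  Zpath lam (tpt u) /\ tval u = phv (tpt u) (kdeg lam) a.
Proof.
split=> [[y [e [yl ->]]]|]; first by rewrite /= phv_cast.
case: u => y s /= [yl ->]; have e : src lam = y (kdeg lam).
  by move/ZpathP: yl => <-; rewrite src_sg add0r kdeg_sg.
by exists y, e; rewrite phv_cast.
Qed.

(** Continuity is [phv_eq_near]. For openness, the section over a small cylinder is exactly a basic
    set S_{b, lam}. *)
Lemma under_germ x p v (a : A v) : v = x p -> germ (A := under A) (fun z => phv z p a) x.
Proof.
move=> ev; have N : \forall z \near x, v = (z : ipath L) p.
  apply/nbhs_ipath; exists p => z zx.
  by rewrite ev -[p in RHS]add0r -src_sg zx src_sg add0r.
apply: filterS N => z {ev x} ev; apply/seteqP; split => O.
  have FF : Filter (sec (A := under A) (fun z => phv z p a) @ z).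
    by apply: fmap_filter; exact: (@nbhs_filter (unit_space G) z).
  move: O; apply: (subbase_filter FF (@etale_subbase G (under A))).
  move=> _ [lam [b ->]] /ubasicP[/= zl E].
  have ew : src lam = z (kdeg lam).
    by move/ZpathP: zl => <-; rewrite src_sg add0r kdeg_sg.
  have N1 := phv_eq_near ev ew E.
  have N2 : \forall w \near z, Zpath lam w.
    by apply/nbhs_ipath; exists (kdeg lam) => w; move/ZpathP: zl => -> /ZpathP.
  move: N1 N2; apply: filterS2 => w E1 wl; exact/ubasicP.
move=> /nbhs_ipath[q Oq].
have hr : rng (sg z p q) == v by rewrite rng_sg ev.
have hs : src (sg z p q) == src (sg z 0 (p + q)) by rewrite !src_sg add0r.
(* The element a is pushed along z(p, p + q), because the basic set over the cylinder of z(0, p + q)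
   needs an element at the level p + q. *)
pose h : hom v (src (sg z 0 (p + q))) := Hom hr hs.
have H y : Zpath (sg z 0 (p + q)) y -> phv y (kdeg (sg z 0 (p + q))) (mmap A h a) = phv y p a.
  by move=> /ZpathP; rewrite kdeg_sg => yz; rewrite phv_map//= (sg_suffix yz).
rewrite nbhsE; exists (ubasic (mmap A h a)).
  split; last by apply/ubasicP; split; rewrite /= ?H//; exact: Zpath_sg.
  apply: (subbase_open (@etale_subbase G (under A))).
  by exists (sg z 0 (p + q)), (mmap A h a).
case=> y s /ubasicP[/= yz ->]; rewrite H//; apply: Oq.
move/ZpathP: yz; rewrite kdeg_sg [p + q]addrC; exact: sg_prefix.
Qed.

Lemma under_etale : etale_sheaf (under A).
Proof.
case=> x s; have [n [a E]] := phv_at (0 : degree k) (s : dlim A x).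
exists (fun z => phv z (0 + n) a) => /=; first exact: under_germ.
by rewrite /sec E.
Qed.

(** The action is a choice among all levels and representatives. Two of them are compared after
    raising both to a common level, where the segments of x and y coincide. *)
Lemma uact_phv x y (g : @hom G x y) p q v (b : A v) : v = y q ->
  lev (harr g) p q -> act (under A) g (phv y q b) = phv x p b.
Proof.
move=> ev [E1 E2].
have gx : prng (harr g) = x by exact: (eqP (hom_rng g)).
have gy : psrc (harr g) = y by exact: (eqP (hom_src g)).
rewrite gx gy in E2.
rewrite /= /uact; case: xgetP => [t _ [p' [q' [b' [e [F1 F2 F3 ->]]]]]|].
  rewrite phv_cast; move: F3; rewrite -phvE => F3.
  have [n [m [u [h [h' [E3 hE hE' bb]]]]]] := phv_eq ev erefl F3.
  have pp : p + n = p' + m.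
    by move: E1; rewrite /pdeg -[(val _).1.2]/(pdeg (harr g)) F1 => E1; deg_lia.
  have sE a c r : shift a x = shift c y -> sg x a r = sg y c r.
    move=> ac; have : sg (shift a x) 0 r = sg (shift c y) 0 r by rewrite ac.
    by rewrite !sg_shift !add0r.
  rewrite -(@phv_map x p' m _ _ h') ?hE' ?(sE _ _ _ F2)// -bb -pp phv_map//.
  by rewrite hE; apply/esym/sE.
have e : y q = x p by have := congr1 (fun z => fobj z 0) E2; rewrite /= !add0r => ->.
move=> /(_ (phv x p b)) []; exists p, q, (transp ev b), e; split=> //.
  by rewrite phv_cast.
by rewrite phv_cast; case: _ / ev e.
Qed.

Lemma act_hom_of x y (g : @hom G x y) : exists j l, [/\ lev (harr g) j l, psrc (harr g) = y & prng (harr g) = x].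
Proof.
have [j [l gl]] := lev_exists (harr g); exists j, l; split=> //.
  exact: (eqP (hom_src g)).
exact: (eqP (hom_rng g)).
Qed.

Lemma under_sheafy : sheafy (under A).
Proof.
split.
- exact: under_etale.
- move=> x; apply: germ_eq (@under_germ x 0 (x 0) 0 erefl).
  by apply/nbhs_ipath; exists 0 => z _; exact: zmod0 (@phv_zmod z 0 (x 0)).
- move=> x s t gs gt.
  have [n [a [b [Ea Eb]]]] := phv_common 0 (s x : dlim A x) (t x).
  have ga := @under_germ x (0 + n) _ a erefl; have gb := @under_germ x (0 + n) _ b erefl.
  have sa := germ_agree gs (osec_cvg ga) Ea; have tb := germ_agree gt (osec_cvg gb) Eb.
  apply: germ_eq (@under_germ x (0 + n) _ (a - b) erefl).
  by move: sa tb; apply: filterS2 => z -> ->; rewrite phv_zmod.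
- move=> x y g s t; have [j [l [gl gy gx]]] := act_hom_of g.
  have [n [a [b [-> ->]]]] := phv_common l (s : dlim A y) t.
  by rewrite -phv_zmod !(uact_phv _ erefl (levD n gl)) phv_zmod.
- move=> x s; have [n [a ->]] := phv_at 0 (s : dlim A x).
  by apply: uact_phv => //; split; rewrite /pdeg/= ?subrr.
- move=> x y z g h s; have [j [m [l [gl hl]]]] := lev_pair (hom_composable g h).
  have gz : psrc (harr h) = z by exact: (eqP (hom_src h)).
  have gy : psrc (harr g) = y by exact: (eqP (hom_src g)).
  have hy : prng (harr h) = y by exact: (eqP (hom_rng h)).
  have [n [a ->]] := phv_at l (s : dlim A z).
  have hln := levD n hl; have gln := levD n gl.
  rewrite (uact_phv _ erefl hln) (uact_phv _ _ gln); last first.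
    by have := lev_at 0 hln; rewrite !addr0 hy gz.
  by apply: uact_phv => //; exact: (lev_mul (hom_composable g h) gln hln).
- move=> g s gs; have [j [l gl]] := lev_exists g.
  have [n [b Eb]] := phv_at l (s (psrc g) : dlim A (psrc g)).
  have gln := levD n gl.
  have eb : psrc g (l + n) = prng g (j + n) by have := lev_at 0 gln; rewrite !addr0.
  exists (fun z => phv z (j + n) b); first exact: under_germ.
  have N1 : \forall z \near psrc g, s z = phv z (l + n) b.
    exact: germ_agree gs (osec_cvg (@under_germ (psrc g) (l + n) _ b erefl)) Eb.
  have N2 : \forall h \near g, s (psrc h) = phv (psrc h) (l + n) b by exact: (psrc_cont N1).
  have N3 : \forall h \near g, near_at g (j + n) (l + n) h.
    by apply/nbhs_parrow; exists (j + n), (l + n).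
  move: N2 N3; apply: filterS2 => h Es [hl _ E]; rewrite Es; apply: uact_phv => //.
  by rewrite -[l + n in LHS]add0r -[l + n in RHS]add0r -!src_sg E.
Qed.

End Module.
End UnderSheaf.

(** * The free resolution of the constant module *)

Section FreeModules.
Variable C : category.
Implicit Types (u v w : obj C) (a b : mor C) (t : seq (mor C)).
Let cC := categoryP C.

Lemma src_last_merge d i t : ischain (rng (head d t)) t -> (i.+1 < size t)%N ->
  src (last d (merge i t)) = src (last d t).
Proof.
elim: i t d => [|i IH] [|a [|b t]] d //=.
  move=> /and3P[_ /eqP ab _] _.
  by case: t => //=; rewrite (cat_src_comp cC).
move=> /and3P[_ /eqP ab ct] it.
have -> : last a (merge i (b :: t)) = last d (merge i (b :: t)).
  by case: i it {IH} => [|i]; case: (t).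
by rewrite IH//= -?ab ?eqxx.
Qed.

Lemma endsatP v t d : reflect [/\ t <> [::], ischain (rng (head d t)) t & src (last d t) = v]
  (endsat v t).
Proof.
case: t => [|a t] /=; first by constructor; case.
by rewrite eqxx; apply: (iffP andP) => [[? /eqP]|[_ ? ->]].
Qed.

Lemma endsat_merge v i t : endsat v t -> (i.+1 < size t)%N -> endsat v (merge i t).
Proof.
case: t => [//|d t] /(endsatP _ _ d)[_ ct lt] it; apply/(endsatP _ _ d).
have cm := ischain_merge i ct; split.
- by move=> E; have := size_merge it; rewrite E; case: (t) it.
- by move: cm; case: (merge i (d :: t)) => [|e s]//= /andP[_ ->]; rewrite eqxx.
- by rewrite src_last_merge.
Qed.

Lemma endsat_behead v t : endsat v t -> (1 < size t)%N -> endsat v (behead t).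
Proof. by case: t => [|a [|b t]]//= /andP[/and3P[_ _ ->] ->]; rewrite eqxx. Qed.

Lemma endsat_rcons v w t a : endsat v t -> rng a = v -> src a = w -> endsat w (rcons t a).
Proof.
case: t => [//|b t] + ra sa; rewrite /= !eqxx /= last_rcons sa eqxx andbT.
move=> /andP[]; elim: t b => [|c t IH] b /=; first by rewrite ra eq_sym => _ ->.
by move=> /andP[-> ct] lt; apply: IH.
Qed.

Lemma endsat_of_rcons w t a : (0 < size t)%N -> endsat w (rcons t a) ->
  endsat (rng a) t /\ src a = w.
Proof.
case: t => [//|b t] _; rewrite /= last_rcons eqxx /= => /andP[ct /eqP ->]; split=> //.
elim: t b ct => [|c t IH] b /=; first by rewrite andbT => /eqP ->.
by move=> /andP[-> /IH].
Qed.

Lemma mullast_rcons t a b : mullast (rcons t a) b = rcons t (comp a b).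
Proof. by elim: t => //= c t <-; case: t. Qed.

Lemma behead_mullast t a : (1 < size t)%N -> behead (mullast t a) = mullast (behead t) a.
Proof. by case: t => [|b [|c t]]. Qed.

Lemma merge_mullast v w i t (a : hom v w) : endsat v t -> (i.+1 < size t)%N ->
  merge i (mullast t a) = mullast (merge i t) a.
Proof.
elim: i t => [|i IH] [|b [|c t]]//.
  case: t => [|d t]//= /andP[/and3P[_ /eqP cb _] /eqP sc] _.
  by rewrite (cat_compA cC)// sc; exact/esym/eqP/hom_rng.
move=> e it; have e' : endsat v (c :: t) by exact: (endsat_behead e).
have := IH _ e' it; rewrite /= => ->.
by have := size_merge (t := c :: t) it; case: (merge i (c :: t)) => //; case: (t) it.
Qed.

Lemma merge_rcons i t a : (i.+1 < size t)%N -> merge i (rcons t a) = rcons (merge i t) a.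
Proof. by elim: i t => [|i IH] [|b [|c t]]//= it; rewrite -IH. Qed.

Lemma merge_rcons_last t a b : merge (size t) (rcons (rcons t a) b) = rcons t (comp a b).
Proof. by elim: t => //= c t ->. Qed.

Lemma behead_rcons t a : (0 < size t)%N -> behead (rcons t a) = rcons (behead t) a.
Proof. by case: t. Qed.

Lemma PgenT n v t : size t = n.+1 -> endsat v t ->
  exists2 u : chainto n.+1 v, val u = t & Pgen n v t = << u >>.
Proof.
move=> st et; have h : (size t == n.+1) && endsat v t by rewrite st eqxx.
exists (exist (fun t => is_true ((size t == n.+1) && endsat v t)) t h) => //.
by rewrite -PgenE.
Qed.

Lemma P_ext n v (V : zmodType) (f f' : Pob (C := C) n v -> V) :
  zmod_morphism f -> zmod_morphism f' ->
  (forall t, size t = n.+1 -> endsat v t -> f (Pgen n v t) = f' (Pgen n v t)) ->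
  f =1 f'.
Proof.
move=> fB f'B ff'; apply: zmod_freeg_ext => // t; rewrite -PgenE.
by have /andP[/eqP st et] := valP t; exact: ff'.
Qed.

Lemma Pmap_zmod n v w (a : hom v w) : zmod_morphism (Pmap (n := n) a).
Proof. exact: flift_zmod. Qed.

Lemma PmapE n v w (a : hom v w) t : size t = n.+1 -> endsat v t ->
  Pmap a (Pgen n v t) = Pgen n w (mullast t a).
Proof. by move=> st et; have [u <- ->] := PgenT st et; exact: Pmap_gen. Qed.

Lemma Pd_zmod n v : zmod_morphism (@Pd C n v).
Proof. exact: flift_zmod. Qed.

Lemma PdE n v t : size t = n.+2 -> endsat v t ->
  Pd (Pgen n.+1 v t) = Pgen n v (behead t) +
    \sum_(i < n.+1) Pgen n v (merge i t) *~ (-1) ^+ i.+1 :> Pmod n v.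
Proof.
move=> st et; have [u <- ->] := PgenT st et.
by rewrite /Pd fliftU big_add1 big_mkord.
Qed.

Lemma Pd0_zmod v : zmod_morphism (@Pd0 C v).
Proof. exact: flift_zmod. Qed.

Lemma Pd0E v t : size t = 1%N -> endsat v t -> Pd0 (Pgen 0 v t) = 1.
Proof. by move=> st et; have [u _ ->] := PgenT st et; rewrite /Pd0 fliftU. Qed.

Lemma bd_endsat n v t (i : 'I_n.+1) : size t = n.+2 -> endsat v t ->
  [/\ size (merge i t) = n.+1, endsat v (merge i t),
      size (behead t) = n.+1 & endsat v (behead t)].
Proof.
move=> st et; split.
- by rewrite size_merge ?st//= ltnS ltn_ord.
- by apply: endsat_merge; rewrite ?st//= ltnS ltn_ord.
- by rewrite size_behead st.
- by apply: endsat_behead; rewrite ?st.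
Qed.

Lemma Pd_natural n : is_natural (fun v => @Pd C n v).
Proof.
split=> [v|v w a D]; first exact: Pd_zmod.
apply: (P_ext (f := fun D => Pd (Pmap a D)) (f' := fun D => Pmap a (Pd D))).
- by move=> D1 D2; rewrite Pmap_zmod Pd_zmod.
- by move=> D1 D2; rewrite Pd_zmod Pmap_zmod.
move=> t st et; rewrite PmapE// !PdE ?size_mullast//; last exact: endsat_mullast.
rewrite (zmodD (Pmap_zmod a)) (zmod_sum (Pmap_zmod a)); congr (_ + _).
  have [_ _ s1 e1] := bd_endsat ord0 st et.
  by rewrite PmapE// behead_mullast// st.
apply: eq_bigr => i _; have [s1 e1 _ _] := bd_endsat i st et.
rewrite (zmodMz (Pmap_zmod a)) PmapE// merge_mullast//.
by rewrite st ltnS ltn_ord.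
Qed.

Lemma Pd0_natural : is_natural (@Pd0 C : modfam (Pmod 0) (const_rmodule C int)).
Proof.
split=> [v|v w a D]; first exact: Pd0_zmod.
apply: (P_ext (f := fun D => Pd0 (Pmap a D)) (f' := @Pd0 C v)).
- by move=> D1 D2; rewrite Pmap_zmod Pd0_zmod.
- exact: Pd0_zmod.
by move=> t st et; rewrite PmapE// !Pd0E ?size_mullast//; exact: endsat_mullast.
Qed.

(** The contracting homotopy at a vertex. It adds the identity at the end, where the module acts, so
    the last face returns t, with sign (-1)^(m+1) when t has degree m. *)
Definition Phtp n v : Pob n v -> Pob n.+1 v :=
  flift (fun t : chainto n.+1 v => Pgen n.+1 v (rcons (val t) (idm v))).

Lemma Phtp_zmod n v : zmod_morphism (@Phtp n v).
Proof. exact: flift_zmod. Qed.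

Lemma PhtpE n v t : size t = n.+1 -> endsat v t ->
  Phtp (Pgen n v t) = Pgen n.+1 v (rcons t (idm v)).
Proof. by move=> st et; have [u <- ->] := PgenT st et; rewrite /Phtp fliftU. Qed.

Lemma endsat_id v t : endsat v t -> endsat v (rcons t (idm v)).
Proof. by move=> et; apply: endsat_rcons et _ _; rewrite ?(cat_rng_id cC) ?(cat_src_id cC). Qed.

Lemma merge_last_id v t n : size t = n.+1 -> endsat v t -> merge n (rcons t (idm v)) = t.
Proof.
case/lastP: t => // t a; rewrite size_rcons => -[<-] et.
rewrite merge_rcons_last; congr rcons; have /eqP : src (last a (rcons t a)) == v.
  by case: t et => [|b t] /= /andP[_]; rewrite ?last_rcons.
by rewrite last_rcons => <-; exact: (cat_idr cC).
Qed.

Lemma PhtpS n v (D : Pob n.+1 v) :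
  Pd (Phtp D) = Phtp (Pd D) + D *~ (-1) ^+ n.+2 :> Pob n.+1 v.
Proof.
have hB := @Phtp_zmod n v.
apply: (P_ext (f := fun D => Pd (Phtp D)) (f' := fun D => Phtp (Pd D) + D *~ (-1) ^+ n.+2)).
- by move=> D1 D2; rewrite Phtp_zmod Pd_zmod.
- by move=> D1 D2; rewrite Pd_zmod Phtp_zmod mulrzBl opprD addrACA.
move=> t st et; rewrite PhtpE// !PdE ?size_rcons ?st//; last exact: endsat_id.
rewrite (zmodD hB) (zmod_sum hB) big_ord_recr -addrA; congr (_ + (_ + _)).
- have [_ _ s1 e1] := bd_endsat ord0 st et.
  by rewrite PhtpE// behead_rcons ?st.
- apply: eq_bigr => i _; have [s1 e1 _ _] := bd_endsat i st et.
  rewrite -[nat_of_ord (widen_ord _ i)]/(nat_of_ord i).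
  by rewrite (zmodMz hB) PhtpE// merge_rcons// st ltnS ltn_ord.
- by rewrite -[nat_of_ord ord_max]/n.+1 merge_last_id.
Qed.

Lemma Phtp0 v (D : Pob 0 v) : Pd (Phtp D) = Pgen 0 v [:: idm v] *~ Pd0 D - D :> Pob 0 v.
Proof.
apply: (P_ext (f := fun D => Pd (Phtp D)) (f' := fun D => Pgen 0 v [:: idm v] *~ Pd0 D - D)).
- by move=> D1 D2; rewrite Phtp_zmod Pd_zmod.
- by move=> D1 D2; rewrite Pd0_zmod mulrzBr subr_subACA.
move=> t st et; rewrite PhtpE// PdE ?size_rcons ?st//; last exact: endsat_id.
rewrite Pd0E// big_ord_recl big_ord0 addr0 mulr1z; congr (_ + _).
  by case: t st et => [|a []].
by rewrite [merge _ _](merge_last_id st et) mulrN1z.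
Qed.

Lemma Pd0_Pd v (D : Pob 1 v) : Pd0 (Pd D) = 0.
Proof.
apply: (P_ext (f := fun D => Pd0 (Pd D)) (f' := fun=> 0)) => //.
  by move=> a b; rewrite Pd_zmod Pd0_zmod.
move=> t st et; rewrite PdE// big_ord_recl big_ord0 addr0 (zmodD (@Pd0_zmod v)).
rewrite !(zmodMz (@Pd0_zmod v)).
by have [s1 c1 s2 c2] := bd_endsat ord0 st et; rewrite !Pd0E.
Qed.

(* Every generator is P(lam) h[t], so naturality reduces d d = 0 to the homotopy
   formula. *)
Lemma Pd_Pd n v (D : Pob n.+2 v) : Pd (Pd D) = 0 :> Pob n v.
Proof.
elim: n v D => [|n IH] v D.
all: apply: (P_ext (f := fun D => Pd (Pd D)) (f' := fun=> 0)) => //;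
  [by move=> a b; rewrite !Pd_zmod|by move=> a b; rewrite subrr|].
all: case/lastP => // t a; rewrite size_rcons => -[st] et.
all: have [et' sa] : endsat (rng a) t /\ src a = v by apply: endsat_of_rcons et; rewrite st.
all: have hs : src a == v by rewrite sa.
all: have -> : rcons t a = mullast (rcons t (idm (rng a))) (Hom (eqxx (rng a)) hs)
  by rewrite mullast_rcons (cat_idl cC).
all: rewrite -PmapE ?size_rcons ?st//; last exact: endsat_id.
all: rewrite -PhtpE// !(Pd_natural _).2 PhtpS (zmodD (@Pd_zmod _ _)) (zmodMz (@Pd_zmod _ _)).
  rewrite Phtp0 Pd0_Pd mulr0z sub0r addrC subrr; exact: zmod0 (Pmap_zmod _).
rewrite PhtpS IH (zmod0 (@Phtp_zmod _ _)) add0r [(-1) ^+ n.+3]exprS mulN1r mulrNz subrr.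
exact: zmod0 (Pmap_zmod _).
Qed.

Lemma Pd_exact n v (D : Pob n.+1 v) : Pd D = 0 :> Pob n v -> exists D' : Pob n.+2 v, Pd D' = D.
Proof.
move=> D0; exists (Phtp D *~ (-1) ^+ n.+2).
rewrite (zmodMz (@Pd_zmod _ _)) PhtpS D0 (zmod0 (@Phtp_zmod _ _)) add0r.
by rewrite -mulrzA -expr2 sqrr_sign mulr1z.
Qed.

Lemma Pd_exact0 v (D : Pob 0 v) : Pd0 D = 0 -> exists D' : Pob 1 v, Pd D' = D.
Proof.
move=> D0; exists (- Phtp D).
by rewrite (zmodN (@Pd_zmod _ _)) Phtp0 D0 mulr0z sub0r opprK.
Qed.

End FreeModules.

(** * Functoriality of the associated sheaf and exactness of the resolution it gives *)

Section UnderMaps.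
Variables (k : nat) (L : kgraph k).
Implicit Types (x y z : ipath L) (j l m n p q : degree k) (A B : rmodule L).
Local Notation G := (path_groupoid L).

(** The map is defined on a chosen representative; naturality lets it be computed on any other one
    after both are raised to a common level. *)
Lemma under_map_phv A B (f : modfam A B) x p v (a : A v) : is_natural f -> v = x p ->
  under_map f (phv x p a) = phv x p (f v a).
Proof.
move=> [fB fn] ev; rewrite /under_map -phvE; set s := phv x p a.
have E : phv x (dlim_deg s) (dlim_val s) = phv x p a by rewrite phvE phi_val.
have [n [m [u [h [h' [E1 hE hE' ab]]]]]] := phv_eq erefl ev E.
by rewrite -(phv_map _ hE) -fn ab fn E1 phv_map.
Qed.

Lemma under_map_shmor A B (f : modfam A B) : is_natural f -> is_shmor (@under_map k L A B f).
Proof.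
move=> fN; have [fB fn] := fN; split.
- apply: shmor_cont; first exact: under_etale.
  move=> x s; have [n [a ->]] := phv_at 0 (s : dlim A x).
  exists (fun z => phv z (0 + n) a); split=> //; first exact: under_germ.
  apply: germ_eq (@under_germ _ _ B x (0 + n) _ (f _ a) erefl).
  apply/nbhs_ipath; exists (0 + n) => z zx; rewrite under_map_phv//.
  by rewrite -[(0 + n) in LHS]add0r -[(0 + n) in RHS]add0r -!src_sg zx.
- move=> x s t; have [n [a [b [-> ->]]]] := phv_common 0 (s : dlim A x) t.
  by rewrite -phv_zmod !under_map_phv// fB phv_zmod.
- move=> x y g s; have [j [l [gl gy gx]]] := act_hom_of g.
  have [n [a ->]] := phv_at l (s : dlim A y).
  have gln := levD n gl.
  rewrite (uact_phv _ erefl gln) !under_map_phv ?(uact_phv _ erefl gln)//.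
  by have := lev_at 0 gln; rewrite !addr0 gx gy.
Qed.

Lemma under_const_phv (V : zmodType) x p v (a : const_rmodule L V v) : v = x p ->
  under_const (phv x p a) = a.
Proof.
move=> ev; rewrite /under_const; set s := phv x p a.
have E : phv x (dlim_deg s) (dlim_val s) = phv x p a by rewrite phvE phi_val.
by have [n [m [u [h [h' [_ _ _ ab]]]]]] := phv_eq erefl ev E.
Qed.

Lemma under_const_shmor (V : zmodType) : is_shmor (@under_const k L V).
Proof.
set A := const_rmodule L V; split.
- apply: shmor_cont; first exact: under_etale.
  move=> x s; have [n [a ->]] := phv_at 0 (s : dlim A x).
  exists (fun z => phv z (0 + n) a); split=> //; first exact: under_germ.
  apply: germ_eq (@const_germ G V a x).
  apply/nbhs_ipath; exists (0 + n) => z zx; rewrite under_const_phv//.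
  by rewrite -[(0 + n) in LHS]add0r -[(0 + n) in RHS]add0r -!src_sg zx.
- move=> x s t; have [n [a [b [-> ->]]]] := phv_common 0 (s : dlim A x) t.
  by rewrite -phv_zmod !under_const_phv.
- move=> x y g s; have [j [l [gl gy gx]]] := act_hom_of g.
  have [n [a ->]] := phv_at l (s : dlim A y).
  have gln := levD n gl.
  rewrite (uact_phv _ erefl gln) !under_const_phv//.
  by have := lev_at 0 gln; rewrite !addr0 gx gy.
Qed.

Lemma under_aug_phv x p v (D : Pob 0 v) : v = x p ->
  raug (@underP k L) (phv (A := Pmod 0) x p D : @underP k L 0%N x) = Pd0 D.
Proof.
move=> ev; rewrite /= (under_map_phv _ (@Pd0_natural L) ev).
exact: under_const_phv.
Qed.

Lemma phv0 A x p v : phv (A := A) x p (0 : A v) = 0.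
Proof. exact: zmod0 (@phv_zmod _ _ A x p v). Qed.

(** If d D vanishes in the limit at x, it already vanishes after pushing along a finite segment;
    there exactness at the vertex provides the preimage. *)
Lemma underP_resolution : resolution (@underP k L).
Proof.
split.
- by move=> n; exact: under_sheafy.
- by move=> n; exact: under_map_shmor (@Pd_natural L n).
- have h := is_shmor_comp (under_map_shmor (@Pd0_natural L)) (@under_const_shmor int).
  exact: h.
- move=> n x s; have [m [D ->]] := phv_at 0 (s : dlim (Pmod n.+1) x).
  rewrite /= (under_map_phv _ (@Pd_natural L n) erefl); split=> [D0|[s' _ E]].
    rewrite -(phv0 (Pmod n) x (0 + m) (x (0 + m))) in D0.
    have [a [b [u [h [h' [E hE _ Dh]]]]]] := phv_eq erefl erefl D0.
    have [D' E'] : exists D', Pd D' = Pmap h D.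
      apply: Pd_exact; rewrite (Pd_natural L n).2.
      by rewrite [LHS]Dh raddf0.
    exists (phv (A := Pmod n.+2) x (0 + m + a) D') => //.
    rewrite (under_map_phv _ (@Pd_natural L n.+1)).
      by rewrite E' -(phv_map D hE).
    by rewrite -(eqP (hom_src h)) hE src_sg.
  have [m' [D' E']] := phv_at 0 (s' : dlim (Pmod n.+2) x).
  rewrite -(under_map_phv D (@Pd_natural L n) erefl) -E E'.
  rewrite !(under_map_phv _ (@Pd_natural L _) erefl).
  by rewrite [Pd (Pd D')]Pd_Pd phv0.
- move=> x s; have [m [D ->]] := phv_at 0 (s : dlim (Pmod 0) x).
  rewrite under_aug_phv//; split=> [D0|[s' _ E]].
    have [D' E'] := Pd_exact0 D0.
    exists (phv (A := Pmod 1) x (0 + m) D') => //.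
    by rewrite /= (under_map_phv _ (@Pd_natural L 0) erefl) E'.
  have [m' [D' E']] := phv_at 0 (s' : dlim (Pmod 1) x).
  rewrite -(under_aug_phv D erefl) -E E' /= (under_map_phv _ (@Pd_natural L 0) erefl).
  by rewrite -[LHS]/(raug (@underP k L) _) under_aug_phv// Pd0_Pd.
- move=> x m; exists (phv (A := Pmod 0) x 0 (Pgen 0 (x 0) [:: idm (x 0)] *~ m)).
  rewrite under_aug_phv// (zmodMz (@Pd0_zmod _ _)) Pd0E ?intz//=.
  by rewrite !eqxx (cat_src_id (categoryP L)) eqxx.
Qed.

End UnderMaps.

(** * The morphism psi *)

Section PsiMap.
Variables (k : nat) (L : kgraph k).
Implicit Types (x y z w : ipath L) (j l m p q : degree k) (lam mu a b : mor L).
Implicit Types (t s : seq (mor L)) (g h : parrow L).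
Local Notation G := (path_groupoid L).
Let cL := categoryP L.

Lemma shift0 x : shift 0 x = x.
Proof. by apply: ipath_ext => n; rewrite sg_shift addr0. Qed.

(** The first arrow of the generator identified with phi^x_p([..., lam]). For p = 0 it is one step
    of [climb]. *)
Definition descend x p lam : parrow L :=
  pmk x (zdeg p - zdeg (kdeg lam)) (pathcat lam (shift p x)).

Lemma descendP x p lam : src lam = x p ->
  [/\ prng (descend x p lam) = x, psrc (descend x p lam) = pathcat lam (shift p x) &
      lev (descend x p lam) p (kdeg lam)].
Proof.
move=> sl; apply: pmkP.
by rewrite shift_pathcat//= add0r.
Qed.

Lemma descend0 y lam : pmk y (- zdeg (kdeg lam)) (pathcat lam y) = descend y 0 lam.
Proof. by rewrite /descend shift0; congr pmk; deg_lia. Qed.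

Lemma descend_cont x p lam : src lam = x p -> {for x, continuous (fun z => descend z p lam)}.
Proof.
move=> sl O; have [r1 s1 l1] := descendP sl.
move=> /(nbhs_parrow_at l1)[n On].
apply/nbhs_ipath; exists (p + n) => z zx; apply: On.
have sz : src lam = z p.
  by rewrite sl -[p in RHS]add0r -src_sg (sg_prefix zx) src_sg add0r.
have [r2 s2 l2] := descendP sz; split; first exact: levD.
  by rewrite r1 r2.
have H y (sy : src lam = y p) : src lam = (shift p y) 0 by rewrite /= add0r.
rewrite s1 s2 !sgD (sg_pathcat0 (H _ sl)) (sg_pathcat0 (H _ sz)).
by rewrite (sg_pathcat (H _ sl)) (sg_pathcat (H _ sz)) !sg_shift !add0r (sg_suffix zx).
Qed.

(** Raising the level from p to p + n replaces the last entry lam by lam x(p, p + n) and leaves the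
    arrow unchanged. Hence psi does not depend on the representative in the direct limit. *)
Lemma descend_up x p n lam : src lam = x p ->
  descend x (p + n) (comp lam (sg x p n)) = descend x p lam.
Proof.
move=> sl; have sc : src lam = rng (sg x p n) by rewrite rng_sg.
rewrite /descend kdeg_comp// kdeg_sg; congr pmk; first by deg_lia.
rewrite pathcat_comp//; last by rewrite src_sg /= add0r.
by rewrite addrC -shiftD -[p in sg x p n]add0r -sg_shift pathcat_shift.
Qed.

(** Composition of arrows reverses the order of the morphisms: stepping along lam and then along mu
    is stepping along mu lam. *)
Lemma pmul_descend x p mu lam : src lam = x p -> src mu = rng lam ->
  pmul (descend x p lam) (descend (pathcat lam (shift p x)) 0 mu) = descend x p (comp mu lam).
Proof.
move=> sl ml; have sl' : src lam = (shift p x) 0 by rewrite /= add0r.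
have [r1 s1 [d1 _]] := descendP sl.
have sm : src mu = (pathcat lam (shift p x)) 0 by rewrite pathcat0.
have [r2 s2 [d2 _]] := descendP sm.
have sc : src (comp mu lam) = x p by rewrite (cat_src_comp cL).
have [r3 s3 [d3 _]] := descendP sc.
have E : psrc (descend x p lam) = prng (descend (pathcat lam (shift p x)) 0 mu) by rewrite s1 r2.
apply: parrow_eq; rewrite ?prng_mul ?psrc_mul ?pdeg_mul//.
- by rewrite r1 r3.
- by rewrite d1 d2 d3 kdeg_comp//; deg_lia.
- by rewrite s2 s3 shift0 pathcat_comp.
Qed.

Fixpoint climbable y t : Prop :=
  if t is lam :: t' then src lam = y 0 /\ climbable (pathcat lam y) t' else True.

Definition tip y t := foldl (fun z lam => pathcat lam z) y t.

Lemma climb_cat y s t : climb y (s ++ t) = climb y s ++ climb (tip y s) t.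
Proof. by elim: s y => //= a s IH y; rewrite IH. Qed.

Lemma climbable_cat y s t : climbable y (s ++ t) <-> climbable y s /\ climbable (tip y s) t.
Proof.
elim: s y => [|a s IH] y /=; first by split=> [|[]].
by rewrite IH; tauto.
Qed.

Lemma size_climb y t : size (climb y t) = size t.
Proof. by elim: t y => //= a t IH y; rewrite IH. Qed.

Lemma climb_chain y t : climbable y t -> ischain (C := G) y (climb y t).
Proof.
elim: t y => //= a t IH y [ay ct]; rewrite descend0.
have [r1 s1 _] := descendP ay; apply/andP; split; first exact/eqP.
by have := IH _ ct; rewrite -{1}(shift0 y) -s1.
Qed.

Lemma endsat_climbable v y t : y 0 = v -> endsat v t -> climbable y (rev t).
Proof.
elim/last_ind: t v y => //= t a IH v y yv et; rewrite rev_rcons /=.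
case: t et IH => [|b t] et IH.
  by split=> //; move: et; rewrite /= yv !eqxx /= => /eqP.
have [//|et' sa] := endsat_of_rcons _ et.
by rewrite sa; split=> //; apply: (IH (rng a)) => //; rewrite pathcat0// sa.
Qed.

Lemma climb_cont y t g0 i : climbable y t -> (i < size t)%N ->
  {for y, continuous (fun w => nth g0 (climb w t) i)}.
Proof.
elim: t y i => [//|a t IH] y [|i] /= [ay ct] it.
  apply: (cont_near_eq (s := fun w => descend w 0 a)); last exact: descend_cont.
  by apply/nbhs_ipath; exists 0 => w _; rewrite descend0.
apply: (@continuous_comp _ _ _ (fun w => pathcat a w) (fun w => nth g0 (climb w t) i)); last exact: IH.
apply: (cont_near_eq (s := fun w => psrc (descend w 0 a))).
  apply/nbhs_ipath; exists 0 => w; rewrite !sg0 => wy.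
  have aw : src a = w 0 by rewrite ay -(cat_rng_id cL (w 0)) wy (cat_rng_id cL).
  by have [_ -> _] := descendP aw; rewrite shift0.
apply: (@continuous_comp _ _ _ (fun w => descend w 0 a) (@psrc k L)).
  exact: descend_cont.
exact: psrc_cont.
Qed.

Lemma merge_cat (C : category) (s t : seq (mor C)) (c d : mor C) :
  merge (size s) (s ++ c :: d :: t) = s ++ comp c d :: t.
Proof. by elim: s => [|a s] //=; case: s => [|b s] //= ->. Qed.

(** Reversal moves the adjacent entries i and i + 1 to the positions size t - i - 2 and size t - i -
    1, where [pmul_descend] composes them. *)
Lemma climb_rev_merge y t i : climbable y (rev t) -> (i.+1 < size t)%N ->
  climb y (rev (merge i t)) = merge (C := G) (size t - i.+2) (climb y (rev t)).
Proof.
move=> ct it; have [t1 [a [b [t2 [si tE]]]]] : exists t1 a b t2,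
    size t1 = i /\ t = t1 ++ a :: b :: t2.
  have H : (0 < size t)%N by exact: ltn_trans it.
  case: t it {ct} H => [//|c t] it _.
  exists (take i (c :: t)), (nth c (c :: t) i), (nth c (c :: t) i.+1), (drop i.+2 (c :: t)).
  split; first by rewrite size_takel// ltnW// ltnW.
  by rewrite -!drop_nth ?cat_take_drop// ltnW.
subst t; rewrite -[in LHS]si merge_cat !rev_cat !rev_cons -!cats1 -!catA /= in ct *.
move: ct => /climbable_cat[_ /= [bw [aw _]]].
rewrite !climb_cat /=.
have -> : (size (t1 ++ [:: a, b & t2]) - i.+2)%N = size (climb y (rev t2)).
  by rewrite size_climb size_rev size_cat /= si addnS addnS subSS subSS addKn.
set w := tip y (rev t2) in bw aw *.
have ab : src a = rng b by rewrite aw pathcat0.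
rewrite (@merge_cat G) !descend0 pathcat_comp//; congr (_ ++ _ :: _).
by have := @pmul_descend w 0 a b bw ab; rewrite shift0 => <-.
Qed.

Section Stalks.
Variable n : nat.

Definition psil x p t : gP_stalk (G := G) n x :=
  if t is lam :: t' then psi_gen n x (descend x p (last lam t')) (belast lam t') else 0.

(** The map psi read at a prescribed level p, instead of the level of the representative that [psi]
    uses. *)
Definition psiv x p v (D : Pob n v) : gP_term G n x :=
  flift (fun t : chainto n.+1 v => psil x p (val t)) D.

Lemma psiv_zmod x p v : zmod_morphism (@psiv x p v).
Proof. exact: flift_zmod. Qed.

Lemma psil_rcons x p t lam : psil x p (rcons t lam) = psi_gen n x (descend x p lam) t.
Proof.
case: t => [|a t] //=; rewrite last_rcons; congr psi_gen.
by elim: t a => //= b t IH a; rewrite IH.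
Qed.

Lemma psivE x p v t : size t = n.+1 -> endsat v t -> psiv x p (Pgen n v t) = psil x p t.
Proof. by move=> st et; have [u <- ->] := PgenT st et; rewrite /psiv fliftU. Qed.

Lemma psi_valid x p v t a : v = x p -> size (rcons t a) = n.+1 -> endsat v (rcons t a) ->
  [/\ src a = x p, size t = n & climbable (pathcat a (shift p x)) (rev t)].
Proof.
move=> vx; rewrite size_rcons => -[st] et.
have := @endsat_climbable v (shift p x) _ _ et; rewrite rev_rcons /= add0r.
by move=> /(_ (esym vx))[].
Qed.

Lemma psiv_map x p m v u (h : hom v u) D : harr h = sg x p m ->
  psiv x (p + m) (Pmap h D) = psiv x p D.
Proof.
move=> hE; have vx : v = x p by rewrite -(eqP (hom_rng h)) hE rng_sg.
apply: (P_ext (f := fun D => psiv x (p + m) (Pmap h D)) (f' := @psiv x p v)).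
- by move=> D1 D2; rewrite Pmap_zmod psiv_zmod.
- exact: psiv_zmod.
case/lastP => // t a st et; rewrite PmapE//.
rewrite !psivE ?size_mullast//; last exact: endsat_mullast.
rewrite mullast_rcons !psil_rcons hE descend_up//.
by have [] := psi_valid vx st et.
Qed.

Lemma psi_phv x p v (D : Pob n v) : v = x p -> psi (phv (A := Pmod n) x p D) = psiv x p D.
Proof.
move=> vx; set s := phv (A := Pmod n) x p D.
rewrite -[LHS]/(psiv x (dlim_deg s) (dlim_val s)).
have E : phv x (dlim_deg s) (dlim_val s) = phv (A := Pmod n) x p D by rewrite phvE phi_val.
have [a [b [u [h [h' [E1 hE hE' ab]]]]]] := phv_eq erefl vx E.
rewrite -(psiv_map _ hE) -(psiv_map _ hE') -E1; congr psiv.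
exact: ab.
Qed.

Lemma psi_chain x p t a : src a = x p -> size t = n ->
  climbable (pathcat a (shift p x)) (rev t) ->
  size (descend x p a :: climb (psrc (descend x p a)) (rev t)) = n.+1 /\
  ischain (C := G) x (descend x p a :: climb (psrc (descend x p a)) (rev t)).
Proof.
move=> sa st ct; have [r1 s1 l1] := descendP sa; split.
  by rewrite /= size_climb size_rev st.
apply/andP; split; first exact/eqP.
by have := climb_chain ct; rewrite -{1 2}s1.
Qed.

Lemma psi_shmor : is_shmor (@psi k L n).
Proof.
split.
- apply: shmor_cont; first exact: under_etale.
  move=> x s; have [m [D ->]] := phv_at 0 (s : dlim (Pmod n) x).
  exists (fun z => phv (A := Pmod n) z (0 + m) D); split=> //; first exact: under_germ.
  set p := 0 + m in D *.
  have gD : germ (A := gP_term G n) (fun z => psiv z p D) x.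
    have sG := gP_sheafy (path_etale L) n.
    elim/freeg_ind: D => [|t|D1 D2 g1 g2].
    + apply: germ_eq (germ0 sG x); apply/nbhs_ipath; exists 0 => z _.
      by rewrite (zmod0 (@psiv_zmod _ _ _)).
    + rewrite -PgenE; have /andP[/eqP st et] := valP t.
      case/lastP: (val t) st et => // t' a st et.
      have [sa st' ct] := psi_valid erefl st et.
      have N : \forall z \near x, src a = (z : ipath L) p /\ climbable (pathcat a (shift p z)) (rev t').
        apply/nbhs_ipath; exists p => z zx.
        have zp : x p = z p by rewrite -[p in LHS]add0r -[p in RHS]add0r -!src_sg zx.
        by have [] := psi_valid zp st et.
      have g1 : germ (A := gP_term G n) (fun z => gP_gen (G := G) n z
          (descend z p a :: climb (psrc (descend z p a)) (rev t')) *~ (-1) ^+ uphalf n) x.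
        apply: germMz => //; apply: (gP_gen_germ (path_etale L) (g0 := pid x)).
          by move: N; apply: filterS => z [az cz]; exact: psi_chain.
        have cs : {for x, continuous (fun z => psrc (descend z p a))}.
          apply: (@continuous_comp _ _ _ (fun z => descend z p a) (@psrc k L)).
            exact: descend_cont.
          exact: psrc_cont.
        case=> [|i] ib /=; first exact: descend_cont.
        apply: (@continuous_comp _ _ _ (fun z => psrc (descend z p a))
          (fun w => nth (pid x) (climb w (rev t')) i)) => //.
        apply: climb_cont; last by rewrite size_rev st'.
        by have [_ -> _] := descendP sa.
      apply: germ_eq g1; apply/nbhs_ipath; exists 0 => z _.
      by rewrite psivE// psil_rcons.
    + apply: germ_eq (germB sG g1 g2); apply/nbhs_ipath; exists 0 => z _.
      by rewrite psiv_zmod.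
  apply: germ_eq gD; apply/nbhs_ipath; exists p => z zx; rewrite psi_phv//.
  by rewrite -[p in LHS]add0r -[p in RHS]add0r -!src_sg zx.
- move=> x s t; have [m [a [b [-> ->]]]] := phv_common 0 (s : dlim (Pmod n) x) t.
  by rewrite -phv_zmod !psi_phv// psiv_zmod.
- move=> x y g s; have [j [l [gl0 gy gx]]] := act_hom_of g.
  have [m [D ->]] := phv_at l (s : dlim (Pmod n) y).
  have gl := levD m gl0; set p := j + m in gl; set q := l + m in D gl *.
  have yx : y q = x p by have := lev_at 0 gl; rewrite !addr0 gx gy.
  rewrite (uact_phv _ erefl gl) !psi_phv//.
  apply: (P_ext (f := @psiv x p _) (f' := fun D => act (gP_term G n) g (psiv y q D))).
  + exact: psiv_zmod.
  + by move=> D1 D2; rewrite psiv_zmod gP_act_zmod.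
  case/lastP => // t a st et; rewrite !psivE// !psil_rcons /psi_gen.
  have [sa st' ct] := psi_valid erefl st et.
  have [r1 s1 [d1 _]] := descendP sa.
  have sa' : src a = x p by rewrite sa yx.
  have [r2 s2 [d2 _]] := descendP sa'.
  have xy : shift p x = shift q y by have [_] := gl; rewrite gx gy.
  rewrite (zmodMz (@gP_act_zmod G n _ _ g)); congr (_ *~ _).
  have [c1 c2] := psi_chain sa st' ct.
  rewrite gP_act_gen//= s1 s2 xy; congr (gP_gen _ _ (_ :: _)).
  have E : psrc (harr g) = prng (descend y q a) by rewrite r1.
  apply: parrow_eq; rewrite ?prng_mul ?psrc_mul ?pdeg_mul//.
  + by rewrite r2 gx.
  + by rewrite d2 d1; have [-> _] := gl; deg_lia.
  + by rewrite s1 s2 xy.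
Qed.

End Stalks.
End PsiMap.

(** * Compatibility of psi with boundaries and augmentations *)

Section PsiChainMap.
Variables (k : nat) (L : kgraph k).
Implicit Types (x y z : ipath L) (p q : degree k) (lam a b : mor L) (t s : seq (mor L)).
Local Notation G := (path_groupoid L).

Lemma climb_take y s t : climb y s = take (size s) (climb y (s ++ t)).
Proof. by rewrite climb_cat take_size_cat// size_climb. Qed.

(** Dropping the first entry of a tuple has sign +1 in the free resolution; after reversal it is the
    truncation, whose sign in the bar resolution is (-1)^(n+1). *)
Lemma psi_sign n : (-1) ^+ uphalf n = (-1) ^+ uphalf n.+1 * (-1) ^+ n.+1 :> int.
Proof.
rewrite uphalf_half [uphalf n.+1]/= !exprS exprD signr_odd !mulN1r mulrNN.
exact: mulrC.
Qed.

Lemma merge_sign n i : (i <= n)%N ->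
  (-1) ^+ (n - i) * (-1) ^+ n.+1 = (-1) ^+ i.+1 :> int.
Proof.
move=> ni; rewrite -exprD -[LHS]signr_odd -[RHS]signr_odd; congr (_ ^+ nat_of_bool _).
by rewrite oddD oddB//=; case: (odd n); case: (odd i).
Qed.

Lemma psi_bd_gen n x p t : size t = n.+2 -> endsat (x p) t ->
  gP_bd (psil n.+1 x p t) = psil n x p (behead t) +
    \sum_(i < n.+1) psil n x p (merge i t) *~ (-1) ^+ i.+1 :> gP_term G n x.
Proof.
case/lastP: t => // t a st et.
have [sa st' ct] := psi_valid erefl st et.
have [c1 c2] := psi_chain sa st' ct.
have [r1 s1 _] := descendP sa.
rewrite psil_rcons /psi_gen (zmodMz (@gP_bd_zmod G n x)) gP_bd_gen//.
set g := descend x p a in c1 c2 r1 s1 *; set y := pathcat a (shift p x) in ct s1.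
rewrite mulrzDl -mulrzA; congr (_ + _).
  rewrite behead_rcons ?st'// psil_rcons /psi_gen mulrC -psi_sign; congr (_ *~ _).
  congr gP_gen; rewrite /=; congr (_ :: _).
  case: t st' {st et ct c1 c2} => [//|b t] [st'] /=.
  by rewrite rev_cons -cats1 [RHS](climb_take _ _ [:: b]) size_rev st'.
(* The face i on the side of tuples corresponds to the face n - i on the side of arrows. *)
rewrite mulrz_suml (reindex_inj rev_ord_inj); apply: eq_bigr => i _.
rewrite -[nat_of_ord (rev_ord i)]/(n.+1 - i.+1)%N subSS -mulrzA.
have -> : (-1) ^+ (n - i) * (-1) ^+ uphalf n.+1 = (-1) ^+ uphalf n * (-1) ^+ i.+1 :> int.
  rewrite -(@merge_sign n i); last by rewrite -ltnS.
  by rewrite [in RHS]psi_sign [RHS]mulrACA -expr2 sqrr_sign mulr1 mulrC.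
(* For i < n the two merged entries lie before a, and two climbing arrows are composed. *)
have [ni|ni] := ltnP i n.
  rewrite merge_rcons ?st'// psil_rcons /psi_gen -mulrzA; congr (_ *~ _).
  congr gP_gen; rewrite -/g s1.
  rewrite (climb_rev_merge ct) ?st'//.
  by rewrite subSS -(subnSK ni).
(* For i = n the last entry a absorbs its neighbour b, and the first arrow is composed with the
   first climbing one. *)
have {ni} -> : nat_of_ord i = n by apply/eqP; rewrite eqn_leq ni -ltnS ltn_ord.
case/lastP: t st st' ct c1 c2 et => // t b st st' ct c1 c2 et.
rewrite subnn; have <- : size t = n by move: st'; rewrite size_rcons => -[].
rewrite merge_rcons_last psil_rcons /psi_gen -mulrzA; congr (_ *~ _).
rewrite s1 rev_rcons /= descend0; congr gP_gen.
have ba : src b = rng a by move: ct; rewrite rev_rcons /= => -[-> _]; rewrite pathcat0//= add0r.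
rewrite -(pmul_descend sa ba); congr (_ :: climb _ _).
have sb : src b = (pathcat a (shift p x)) 0 by rewrite pathcat0//= add0r.
have [r2 s2 _] := descendP sb.
by rewrite psrc_mul ?s2 ?shift0// r2.
Qed.

Lemma psi_bd n x (s : @underP k L n.+1 x) : psi (rbd (@underP k L) n s) = gP_bd (psi s).
Proof.
have [m [D ->]] := phv_at 0 (s : dlim (Pmod n.+1) x).
rewrite /= (under_map_phv _ (@Pd_natural L n) erefl) !psi_phv//.
set p := 0 + m in D *.
apply: (P_ext (f := fun D => psiv x p (Pd D)) (f' := fun D => gP_bd (psiv x p D))).
- by move=> D1 D2; rewrite Pd_zmod psiv_zmod.
- by move=> D1 D2; rewrite psiv_zmod gP_bd_zmod.
move=> t st et; rewrite PdE// psivE// psi_bd_gen// (zmodD (@psiv_zmod _ _ _ _ _ _)).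
rewrite (zmod_sum (@psiv_zmod _ _ _ _ _ _)); congr (_ + _).
  by have [_ _ s1 e1] := bd_endsat ord0 st et; rewrite psivE.
apply: eq_bigr => i _; rewrite (zmodMz (@psiv_zmod _ _ _ _ _ _)).
by have [s1 e1 _ _] := bd_endsat i st et; rewrite psivE.
Qed.

Lemma psi_aug x (s : @underP k L 0%N x) : gP_aug (psi s) = raug (@underP k L) s.
Proof.
have [m [D ->]] := phv_at 0 (s : dlim (Pmod 0) x).
rewrite under_aug_phv// psi_phv//; set p := 0 + m in D *.
apply: (P_ext (f := fun D => gP_aug (psiv x p D)) (f' := @Pd0 L (x p))).
- by move=> D1 D2; rewrite psiv_zmod gP_aug_zmod.
- exact: Pd0_zmod.
case/lastP => // t a st et; rewrite psivE// Pd0E// psil_rcons /psi_gen mulr1z.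
have [sa st' ct] := psi_valid erefl st et; have [c1 c2] := psi_chain sa st' ct.
exact: gP_aug_gen.
Qed.

(** The generator (x, p - q, y) is the image of phi^x_p([y(0, q)]). In degree 0 this makes a cochain
    determined by its composite with psi, as the comparison of the maps rho needs. *)
Lemma psi0_surj x (D : gP_term G 0 x) : exists s : @underP k L 0%N x, psi s = D.
Proof.
have [_ pB _] := @psi_shmor k L 0.
elim/freeg_ind: D => [|t|D1 D2 [s1 <-] [s2 <-]].
- by exists 0; exact: zmod0 (pB x).
- rewrite -gP_genE; case E : (val t) (chain_size t) (chain_ischain t) => [|g []]//= _.
  move=> /andP[/eqP gx _]; have [p [q gl]] := lev_exists g.
  have xq : x p = psrc g q by have := lev_at 0 gl; rewrite !addr0 [prng g]gx.
  have sl : src (sg (psrc g) 0 q) = x p by rewrite src_sg add0r xq.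
  exists (phv (A := Pmod 0) x p (Pgen 0 (x p) [:: sg (psrc g) 0 q])).
  rewrite psi_phv// psivE//=; last by rewrite sl !eqxx.
  rewrite /psi_gen /= mulr1z; congr gP_gen; congr (_ :: _).
  rewrite /descend kdeg_sg (_ : shift p x = shift q (psrc g)); last first.
    by have [_ <-] := gl; rewrite [prng g]gx.
  by rewrite pathcat_shift [RHS](pmk_eta gl) [prng g]gx.
- by exists (s1 - s2); exact: pB.
Qed.

End PsiChainMap.

(** * Cohomology classes as sets, and the equality of the two maps rho *)

Section SubComplexes.

(** A [cochain_complex] is bare data; these conditions make being cohomologous an equivalence
    relation on cocycles. *)
Record subgroup_complex (C : cochain_complex) : Prop := SubgroupComplex {
  cmem0 : forall n, cmem (0 : cgrp C n);
  cmemB : forall n (a b : cgrp C n), cmem a -> cmem b -> cmem (a - b);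
  cdiffB : forall n (a b : cgrp C n), cdiff (a - b) = cdiff a - cdiff b }.

Variables (C : cochain_complex) (sC : subgroup_complex C) (n : nat).
Implicit Types a b c : cgrp C n.

Lemma cob0 : coboundaries (0 : cgrp C n).
Proof.
case: n => // m; exists 0; first exact: cmem0.
by have := cdiffB sC (0 : cgrp C m) 0; rewrite !subrr.
Qed.

Lemma cobB a b : coboundaries a -> coboundaries b -> coboundaries (a - b).
Proof.
case: n a b => [a b -> ->|m _ _ [a am <-] [b bm <-]]; first by rewrite /= subrr.
by exists (a - b); [exact: cmemB|exact: cdiffB].
Qed.

Lemma cob_sym a b : coboundaries (a - b) -> coboundaries (b - a).
Proof. by move=> ab; rewrite -opprB -sub0r; apply: cobB => //; exact: cob0. Qed.

Lemma cob_trans a b c : coboundaries (a - b) -> coboundaries (b - c) -> coboundaries (a - c).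
Proof. by move=> ab /cob_sym cb; have := cobB ab cb; rewrite opprB addrA subrK. Qed.

Lemma cls_self c : cocycles c -> cls c c.
Proof. by move=> cc; split=> //; rewrite subrr; exact: cob0. Qed.

Lemma cls_trans a b c : cls b a -> coboundaries (b - c) -> cls c a.
Proof. by move=> [ca ab] bc; split=> //; exact: cob_trans bc. Qed.

Lemma cohomology_cocycle (K : set (cgrp C n)) c : cohomology C n K -> K c -> cocycles c.
Proof. by move=> [c0 _ <-] []. Qed.

Lemma cohomology_cls (K : set (cgrp C n)) c c' : cohomology C n K -> K c ->
  cocycles c' -> coboundaries (c' - c) -> K c'.
Proof. by move=> [c0 h0 <-] [cc c_c0] cc' c'c; split=> //; exact: cob_trans c_c0. Qed.

End SubComplexes.

Section HomComplex.
Variable G : groupoid.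
Implicit Types (A B : sheaf G) (x y z : unit_space G).

Lemma shmor0 A B : sheafy A -> sheafy B -> is_shmor (0 : shfam A B).
Proof.
move=> sA sB; split.
- apply: shmor_cont; first exact: sheafy_etale.
  move=> x a; have [s gs sx] := etale_stalk a (sheafy_etale sA).
  by exists s; split=> //; exact: germ0.
- by move=> x a b; rewrite [LHS]/(0 : B x) [RHS]subrr.
- by move=> x y g a; exact/esym/(zmod0 (actB sB g)).
Qed.

Lemma shmorB A B (f g : shfam A B) : sheafy A -> sheafy B ->
  is_shmor f -> is_shmor g -> is_shmor (f - g).
Proof.
move=> sA sB mf mg; have [cf fB fe] := mf; have [cg gB ge] := mg; split.
- apply: shmor_cont; first exact: sheafy_etale.
  move=> x a; have [s gs sx] := etale_stalk a (sheafy_etale sA).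
  by exists s; split=> //; apply: germB => //; exact: germ_shmor gs.
- by move=> x a b; rewrite -[LHS]/(f x (a - b) - g x (a - b)) fB gB subr_subACA.
- move=> x y h a.
  by rewrite -[LHS]/(f x (act A h a) - g x (act A h a)) fe ge -(actB sB h).
Qed.

Lemma hom_subgroup_complex (Q : augcomplex G) A : (forall n, sheafy (Q n)) -> sheafy A ->
  subgroup_complex (hom_complex Q A).
Proof. by move=> sQ sA; split=> n; [exact: shmor0|move=> a b; exact: shmorB|]. Qed.

End HomComplex.

Section PartTwo.
Variables (k : nat) (L : kgraph k) (A : rmodule L).
Local Notation G := (path_groupoid L).
Local Notation GP := (gP G).
Local Notation UP := (@underP k L).
Local Notation uA := (under A).

Lemma gP_complex : subgroup_complex (hom_complex GP uA).
Proof.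
apply: hom_subgroup_complex; last exact: under_sheafy.
by move=> n; exact: (gP_sheafy (path_etale L)).
Qed.

Lemma underP_complex : subgroup_complex (hom_complex UP uA).
Proof. by apply: hom_subgroup_complex; [move=> n|]; exact: under_sheafy. Qed.

Lemma shmor_psi n (c : shfam (gP_term G n) uA) : is_shmor c ->
  is_shmor ((fun x s => c x (psi s)) : shfam (UP n) uA).
Proof. by move=> mc; exact: is_shmor_comp (@psi_shmor k L n) mc. Qed.

Lemma cocycle_psi n (c : cgrp (hom_complex GP uA) n) : cocycles c ->
  cocycles ((fun x s => c x (psi s)) : cgrp (hom_complex UP uA) n).
Proof.
move=> [mc c0]; split; first exact: shmor_psi.
apply: shfam_ext => x q.
rewrite -[LHS]/(c x (psi (rbd UP n q))) psi_bd.
by have := congr1 (fun f : shfam (GP n.+1) uA => f x (psi q)) c0.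
Qed.

Lemma psi_yoneda_step n (c1 : cgrp (hom_complex GP uA) n.+1)
    (c : cgrp (hom_complex UP uA) n.+1) : cocycles c1 ->
  cls ((fun x s => c1 x (psi s)) : cgrp (hom_complex UP uA) n.+1) c ->
  ext_step (yoneda_seq (c : shfam (UP n.+1) uA)) (yoneda_seq (c1 : shfam (GP n.+1) uA)).
Proof.
move=> [mc1 c10] [[mc c0] [b mb cb]].
have z1 x (q : GP n.+2 x) : c1 x (gP_bd q) = 0.
  exact: (congr1 (fun f : shfam (GP n.+2) uA => f x q) c10).
have z x (q : UP n.+2 x) : c x (rbd UP n.+1 q) = 0.
  exact: (congr1 (fun f : shfam (UP n.+2) uA => f x q) c0).
(* Here c - c1 psi = b d, whereas [yoneda_seq_step] expects c1 psi = c + (correction) d, so the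
   correction is - b. *)
have mNb : is_shmor (- b : shfam (UP n) uA).
  rewrite -sub0r; apply: shmorB => //; try exact: under_sheafy.
  by apply: shmor0; exact: under_sheafy.
apply: (@yoneda_seq_step G (grng_cont (path_etale L)) (gsrc_cont (path_etale L))
  UP GP (fun n => @psi k L n) (@underP_resolution k L) (gP_resolution (path_etale L))
  (fun n => @psi_shmor k L n) (@psi_bd k L) (@psi_aug k L) uA n c c1 (- b)
  (@under_sheafy k L A) mc mc1 mNb z z1) => x q.
have := congr1 (fun f : shfam (UP n.+1) uA => f x q) cb.
rewrite -[LHS]/(b x (rbd UP n q)) -[RHS]/(c x q - c1 x (psi q)) => E.
by rewrite -[(- b) x _]/(- b x (rbd UP n q)) E opprB addrC subrK.
Qed.

Lemma rho_psi n (K : set (cgrp (hom_complex GP uA) n)) :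
  cohomology (hom_complex GP uA) n K ->
  rho UP uA n (psi_star A n K) = rho GP uA n K.
Proof.
move=> hK; have cK c := cohomology_cocycle hK (c := c).
have sC := underP_complex.
case: n K hK cK => [|n] K hK cK; apply/funext => E; apply/propext; split.
- move=> [mE [c [c' [c1 Kc1 ->] [_ cc']] cE]]; split=> //; exists c1 => // x D.
  have [s <-] := psi0_surj D.
  rewrite -[raug _ _]/(gP_aug (psi s)) psi_aug -cE.
  have -> : c = fun x s => c1 x (psi s); last by [].
  by apply/eqP; rewrite -subr_eq0; apply/eqP; exact: cc'.
- move=> [mE [c Kc cE]]; split=> //; exists (fun x s => c x (psi s)).
    exists (fun x s => c x (psi s)); first by exists c.
    by apply: cls_self => //; exact/cocycle_psi/cK.
  by move=> x s; rewrite cE -[raug _ _]/(gP_aug (psi s)) psi_aug.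
- move=> [xE [c [c' [c1 Kc1 ->] cc'] cE]]; split=> //; exists c1 => //.
  apply: rst_trans cE; apply: rst_sym; apply: rst_step.
  exact: psi_yoneda_step (cK _ Kc1) cc'.
- move=> [xE [c1 Kc1 cE]]; split=> //; exists (fun x s => c1 x (psi s)).
    exists (fun x s => c1 x (psi s)); first by exists c1.
    by apply: cls_self => //; exact/cocycle_psi/cK.
  apply: rst_trans cE; apply: rst_step; apply: (psi_yoneda_step (cK _ Kc1)).
  by apply: cls_self => //; exact/cocycle_psi/cK.
Qed.

End PartTwo.

Lemma addr_sub3 (V : zmodType) (a b c a' b' c' : V) :
  a - a' + (b - b') + (c - c') = a + b + c - (a' + b' + c').
Proof. by rewrite [a - a' + _]addrACA [LHS]addrACA !opprD. Qed.

(** * Continuous cochains *)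

Section ContinuousCochains.
Variables (G : groupoid) (eG : etale_groupoid G) (A : sheaf G) (sA : sheafy A).
Implicit Types (x y z : unit_space G) (g h : arrow G) (t : seq (arrow G)).
Local Notation chainfrom n z := (@chainfrom G n z).
Local Notation chain_of n z t := (@chain_of G n z t).
Arguments eta_cochain {G A n} f i _.

Lemma cevalE n (f : ccochain A n) x (u : chainfrom n x) : ceval f x (val u) = f x u.
Proof. by rewrite /ceval valK. Qed.

Lemma ceval_chain n (f : ccochain A n) x t : size t = n -> ischain (C := G) x t ->
  ceval f x t = f x (chain_of n x t).
Proof. by move=> st ct; rewrite -cevalE (@val_chain_of G _ _ _ st ct). Qed.

Lemma cevalB n (f g : ccochain A n) x t : ceval (f - g) x t = ceval f x t - ceval g x t.
Proof. by rewrite /ceval; case: insub => // ; rewrite subr0. Qed.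

(** Stated for a family F over all stalks, so that the stalk at s(g) can be replaced by the one at y
    without a transport. *)
Lemma act_at_hom x y (g : @hom G x y) (F : forall z, A z) :
  act_at x (g := harr g) (F (gsrc (harr g))) = act A g (F y).
Proof.
case: g => g gx gy /=; have e : gsrc g = y by exact/eqP.
subst y; rewrite /act_at; case: pselect => // gx'; congr (act A _ _).
exact: hom_inj.
Qed.

Lemma act_at_of g (F : forall z, A z) :
  act_at (grng g) (g := g) (F (gsrc g)) = act A (@hom_of G g) (F (gsrc g)).
Proof. exact: (act_at_hom (@hom_of G g) F). Qed.

Lemma act_at_zmod x g : zmod_morphism (@act_at G A x g).
Proof.
move=> a b; rewrite /act_at; case: pselect => [gx|_]; last by rewrite subr0.
exact: actB.
Qed.

Lemma act_at_comp x g h (F : forall z, A z) : grng g = x -> gsrc g = grng h ->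
  act_at x (g := gmul g h) (F (gsrc (gmul g h))) =
  act_at x (g := g) (act_at (gsrc g) (g := h) (F (gsrc h))).
Proof.
move=> <- gh; have hs : grng h == gsrc g by rewrite gh.
pose h' : @hom G (gsrc g) (gsrc h) := Hom (C := G) hs (eqxx _).
rewrite (act_at_hom (comph (@hom_of G g) h') F) act_comp//.
by rewrite (act_at_of g (fun z => act_at z (g := h) (F (gsrc h)))) (act_at_hom h' F).
Qed.

Lemma eta_zmod n (f : ccochain A n) x : zmod_morphism (@eta_cochain G A n f x).
Proof. exact: flift_zmod. Qed.

Lemma eta_gen n (f : ccochain A n) x g t : size t = n -> ischain (C := G) x (g :: t) ->
  eta_cochain f x (gP_gen n x (g :: t)) = act_at x (g := g) (ceval f (gsrc g) t).
Proof.
move=> st ct; have st' : size (g :: t) = n.+1 by rewrite /= st.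
rewrite gP_gen_chain// /eta_cochain fliftU.
by have -> := @val_chain_of G _ _ _ st' ct.
Qed.

(** The face [gh, t] of [g, h, t] gives the action term g . (h . f(t)) of the coboundary; the other
    faces match its remaining terms one by one, with the same signs. *)
Lemma eta_bd n (f : ccochain A n) x (D : gP_term G n.+1 x) :
  eta_cochain (cc_diff f) x D = eta_cochain f x (gP_bd D).
Proof.
apply: (gP_ext (f := eta_cochain (cc_diff f) x) (f' := fun D => eta_cochain f x (gP_bd D))).
- exact: eta_zmod.
- by move=> a b; rewrite gP_bd_zmod eta_zmod.
case=> [|g [|h t]] //; case=> st ct.
have /andP[/eqP gx ght] : (grng g == x) && ischain (C := G) (gsrc g) (h :: t) by [].
have /andP[/eqP hg ct'] : (grng h == gsrc g) && ischain (C := G) (gsrc h) t by [].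
have sht : size (h :: t) = n.+1 by rewrite /= st.
have sght : size [:: g, h & t] = n.+2 by rewrite /= st.
have aB := @act_at_zmod x g.
rewrite eta_gen// (ceval_chain (cc_diff f) sht ght).
have -> : cc_diff f (chain_of n.+1 (gsrc g) (h :: t)) =
    act_at (gsrc g) (g := h) (ceval f (gsrc h) t)
    + \sum_(i < n) ceval f (gsrc g) (merge (C := G) i (h :: t)) *~ (-1) ^+ i.+1
    + ceval f (gsrc g) (take n (h :: t)) *~ (-1) ^+ n.+1.
  by rewrite /cc_diff (@val_chain_of G n.+1 (gsrc g) (h :: t) sht ght) big_add1 big_mkord.
rewrite gP_bd_gen// (zmodD (@eta_zmod n f x)) (zmod_sum (@eta_zmod n f x)) (zmodMz (@eta_zmod n f x)).
rewrite !(zmodD aB) (zmod_sum aB) (zmodMz aB).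
rewrite big_ord_recl [RHS]addrC; congr (_ + _ + _).
- rewrite (zmodMz (@eta_zmod n f x)) mulr1z.
  have m0 : ischain (C := G) x (merge (C := G) 0 [:: g, h & t]) by exact: ischain_merge.
  rewrite -[merge _ _]/(gmul g h :: t) eta_gen//.
  by rewrite (act_at_comp (fun z => ceval f z t) gx (esym hg)).
- apply: eq_bigr => i _; rewrite !(zmodMz (@eta_zmod n f x)) (zmodMz aB) lift0; congr (_ *~ _).
  have mi : ischain (C := G) x (merge (C := G) i.+1 [:: g, h & t]) by exact: ischain_merge.
  have sm : size (merge (C := G) i (h :: t)) = n.
    by rewrite (@size_merge G) ?sht// ltnS ltn_ord.
  by rewrite -(eta_gen f sm mi).
- congr (_ *~ _).
  have tn : ischain (C := G) x (take n.+1 [:: g, h & t]) by exact: ischain_take.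
  rewrite -[take n.+1 _]/(g :: take n (h :: t)) eta_gen// size_takel// sht.
  exact: leqnSn.
Qed.

Lemma cc_contP n (f : ccochain A n) : continuous (ccochain_map f) <->
  forall (e : forall z, chainfrom n z) x, tgerm e x -> germ (fun z => f z (e z)) x.
Proof.
split=> [cf e x ge|H [x u]].
  apply: germ_of_cont; first exact: sheafy_etale.
  exact: (@continuous_comp _ _ _ (tsec e) (ccochain_map f) x (osec_cvg ge) (cf _)).
have [e ge <-] := etale_tuple eG u => O On.
have : nbhs (tsec e x) (ccochain_map f @^-1` O); last by [].
by rewrite (osec_nbhs ge); exact: (osec_cvg (H e x ge) On).
Qed.

(** Near each tuple the value has to follow a section of A along the range. Cochains given by
    formulas on basic open sets have this form. *)
Lemma cc_cont_local n (f : ccochain A n) :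
  (forall x (u : chainfrom n x), exists2 s : forall z, A z, germ s x &
    \forall v \near (GTuple u), f _ (gchain v) = s (gstart v)) ->
  continuous (ccochain_map f).
Proof.
move=> H; apply/cc_contP => e x ge; have [s gs E] := H x (e x).
have N : \forall z \near x, f z (e z) = s z by exact: (osec_cvg ge E).
by apply: germ_eq gs; apply: filterS N.
Qed.

Lemma cont_subgroup_complex : subgroup_complex (cont_complex A).
Proof.
split=> n.
- apply/cc_contP => e x _; exact: germ0.
- move=> a b /cc_contP ca /cc_contP cb; apply/cc_contP => e x ge.
  by apply: germB => //; [exact: ca|exact: cb].
- move=> a b; apply: functional_extensionality_dep => x; apply/funext => u.
  rewrite -[RHS]/(cc_diff a u - cc_diff b u) /cdiff /= /cc_diff.
  case: (val u) => [|g t]; first by rewrite subr0.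
  rewrite cevalB act_at_zmod cevalB mulrzBl.
  have -> : \sum_(1 <= i < n.+1) ceval (a - b) x (merge (C := G) i.-1 (g :: t)) *~ (-1) ^+ i =
     \sum_(1 <= i < n.+1) ceval a x (merge (C := G) i.-1 (g :: t)) *~ (-1) ^+ i -
     \sum_(1 <= i < n.+1) ceval b x (merge (C := G) i.-1 (g :: t)) *~ (-1) ^+ i.
    by rewrite -sumrB; apply: eq_bigr => i _; rewrite cevalB mulrzBl.
  exact: addr_sub3.
Qed.

(** Splits a section of tuples into its head and a section of shorter tuples based at the source of
    the head, because eta lets the head act on the value at the tail. *)
Lemma gtail_germ n (e : forall z, chainfrom n.+1 z) x g0 : tgerm e x ->
  exists2 e1 : forall z, chainfrom n z, tgerm e1 (gsrc (head g0 (val (e x)))) &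
  \forall z \near x, val (e z) = head g0 (val (e z)) :: val (e1 (gsrc (head g0 (val (e z))))).
Proof.
move=> ge; pose hd z := head g0 (val (e z)).
have eE z : val (e z) = hd z :: behead (val (e z)).
  by have := chain_size (e z); rewrite /hd; case: (val (e z)).
have ch z : ischain (C := G) (gsrc (hd z)) (behead (val (e z))).
  by have := chain_ischain (e z); rewrite eE => /andP[].
have sz z : size (behead (val (e z))) = n by rewrite size_behead [size _]chain_size.
have nh z i : nth g0 (behead (val (e z))) i = nth g0 (val (e z)) i.+1 by rewrite nth_behead.
have [e1 ge1 E1] := etale_tuple eG (chain_of n (gsrc (hd x)) (behead (val (e x)))).
exists e1 => //.
pose T z : gtuple G n := GTuple (chain_of n (gsrc (hd z)) (behead (val (e z)))).
have ch0 : {for x, continuous hd}.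
  by apply: cont_near_eq (tgerm_gnth (g0 := g0) ge (ltn0Sn n)); apply: nearW => z; rewrite /hd nth0.
have cT : {for x, continuous T}.
  apply: gtuple_cvg => [|i ib].
    by apply: (@continuous_comp _ _ _ hd (@gsrc G)) => //; exact: gsrc_cont.
  apply: cont_near_eq (tgerm_gnth (g0 := g0) (i := i.+1) ge ib); apply: nearW => z.
  rewrite /gnth /T /= -nh (@val_chain_of G _ _ _ (sz z) (ch z)).
  by apply: set_nth_default; rewrite sz.
have N : nbhs (T x) [set u | u = tsec e1 (gstart u)].
  rewrite [T x](_ : _ = tsec e1 (gsrc (hd x))); last by rewrite /T -E1.
  by rewrite (osec_nbhs ge1); exact: nearW.
have N' : \forall z \near x, T z = tsec e1 (gstart (T z)) by exact: (cT _ N).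
apply: filterS N' => z Tz.
rewrite {1}eE; congr (_ :: _); have := congr1 (fun u : gtuple G n => val (gchain u)) Tz.
by rewrite /T /= (@val_chain_of G _ _ _ (sz z) (ch z)) => ->.
Qed.

Lemma eta_shmor n (f : ccochain A n) : continuous (ccochain_map f) -> is_shmor (@eta_cochain G A n f).
Proof.
move=> /cc_contP cf; apply: (gP_shmor eG) => //; first exact: eta_zmod.
- move=> e x ge; have [e1 ge1 E] := gtail_germ (gid x) ge.
  set g := head _ _ in ge1.
  have gs := cf e1 _ ge1; have [t gt tE] := germ_act sA gs.
  have gx : grng g = x.
    have := chain_ischain (e x); rewrite /g; have := chain_size (e x).
    by case: (val (e x)) => [|a l]//= _ /andP[/eqP].
  rewrite gx in gt; apply: germ_eq gt.
  have ch0 : {for x, continuous (fun z => head (gid x) (val (e z)))}.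
    apply: cont_near_eq (tgerm_gnth (g0 := gid x) ge (ltn0Sn n)); apply: nearW => z.
    by rewrite nth0.
  have N : \forall z \near x, act A (@hom_of G (head (gid x) (val (e z))))
      (f _ (e1 (gsrc (head (gid x) (val (e z)))))) = t (grng (head (gid x) (val (e z)))).
    exact: (ch0 _ tE).
  move: N E; apply: filterS2 => z tz Ez.
  rewrite -gP_genE Ez eta_gen; last 2 first.
  + exact: chain_size.
  + by rewrite -Ez; exact: chain_ischain.
  rewrite cevalE; set h := head _ _ in tz *.
  have hz : grng h = z.
    by have := chain_ischain (e z); rewrite Ez => /andP[/eqP].
  have key w : grng h = w -> act_at w (f (gsrc h) (e1 (gsrc h))) = t w.
    by move=> <-; rewrite (act_at_of h (fun w => f w (e1 w))).
  exact: esym (key _ hz).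
- move=> x y h t st ct; case: t st ct => [//|g t] [st] ct.
  have [sh ch] := hom_mulhead h (congr1 S st : size (g :: t) = n.+1) ct.
  rewrite [mulhead _ _]/= !eta_gen//.
  have /andP[/eqP gy ct'] : (grng g == y) && ischain (C := G) (gsrc g) t by [].
  have hy : gsrc (harr h) = y by exact/eqP/(hom_src h).
  have hx : grng (harr h) = x by exact/eqP/(hom_rng h).
  have hg : gsrc (harr h) = grng g by rewrite gy.
  rewrite (act_at_comp (fun z => ceval f z t) hx hg).
  exact: (act_at_hom h (fun z => act_at z (g := g) (ceval f (gsrc g) t))).
Qed.

End ContinuousCochains.

(** * The Kumjian-Pask-Sims maps *)

Section CategoricalCochains.
Variables (C : category) (A : rmodule C).
Implicit Types (u v w : obj C) (a b : mor C) (t : seq (mor C)).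
Let cC := categoryP C.

Lemma hom_idr u v (h : hom u v) : comp (harr h) (idm v) = harr h.
Proof. by have := cat_idr cC (harr h); rewrite (eqP (hom_src h)). Qed.

(** The generator [t, h] is the image of [t, id] under P(h), so naturality applies. *)
Lemma catcochain_map n (c : modfam (Pmod n) A) u v t (h : hom u v) : is_natural c ->
  size t = n -> endsat v (rcons t (harr h)) ->
  c v (Pgen n v (rcons t (harr h))) = mmap A h (catcochain c u t).
Proof.
move=> [_ cn] st et; have hu : rng (harr h) = u by exact/eqP/(hom_rng h).
have et' : endsat u (rcons t (idm u)).
  case: t st et => [|b t] st et.
    by rewrite /= !eqxx (cat_src_id cC) eqxx.
  by apply: endsat_id; have [//|] := endsat_of_rcons _ et; rewrite hu.
rewrite /catcochain -cn /= PmapE ?size_rcons ?st// mullast_rcons.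
by have := cat_idl cC (harr h); rewrite hu => ->.
Qed.

(** The cocycle condition at the generator [h, id]; the identities in degrees 1 and 2 below come
    from [a, h, id] and [a, b, h, id]. *)
Lemma cocycle0_map (c : modfam (Pmod 0) A) u v (h : hom u v) : is_natural c ->
  (forall v D, c v (Pd D) = 0) -> mmap A h (catcochain c u [::]) = catcochain c v [::].
Proof.
move=> cN c0; have hu : rng (harr h) = u by exact/eqP/(hom_rng h).
have hv : src (harr h) = v by exact/eqP/(hom_src h).
have et : endsat v [:: harr h; idm v].
  by rewrite /= hv (cat_rng_id cC) (cat_src_id cC) !eqxx.
have := c0 v (Pgen 1 v [:: harr h; idm v]); rewrite PdE// !big_ord_recl big_ord0 addr0 /=.
have cB := cN.1 v; rewrite !(zmodD cB) !(zmodMz cB) expr1 mulrN1z.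
rewrite hom_idr.
have eh : endsat v (rcons [::] (harr h)) by rewrite /= hv !eqxx.
by rewrite (catcochain_map cN _ eh)// => /eqP; rewrite subr_eq0 => /eqP.
Qed.

Lemma cocycle1_comp (c : modfam (Pmod 1) A) a u w (h : hom u w) : is_natural c ->
  (forall v D, c v (Pd D) = 0) -> src a = u ->
  catcochain c w [:: comp a h] = catcochain c w [:: harr h] + mmap A h (catcochain c u [:: a]).
Proof.
move=> cN c0 au; have hu : rng (harr h) = u by exact/eqP/(hom_rng h).
have hw : src (harr h) = w by exact/eqP/(hom_src h).
have et : endsat w [:: a; harr h; idm w].
  by rewrite /= au hu hw (cat_rng_id cC) (cat_src_id cC) !eqxx.
have := c0 w (Pgen 2 w [:: a; harr h; idm w]).
rewrite PdE// !big_ord_recl big_ord0 addr0 /=.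
have cB := cN.1 w; rewrite !(zmodD cB) !(zmodMz cB) expr1 mulrN1z sqrrN expr1n mulr1z.
rewrite hom_idr.
have eh : endsat w (rcons [:: a] (harr h)) by rewrite /= hu hw au !eqxx.
rewrite [c w (Pgen 1 w [:: a; harr h])](catcochain_map cN _ eh)// /catcochain /= => E.
apply/eqP; rewrite -subr_eq0 -oppr_eq0 opprB -E.
by rewrite addrAC addrA.
Qed.

Lemma cocycle1_id (c : modfam (Pmod 1) A) v : is_natural c ->
  (forall v D, c v (Pd D) = 0) -> catcochain c v [:: idm v] = 0.
Proof.
move=> cN c0; have := cocycle1_comp (idh v) cN c0 (cat_src_id cC v).
rewrite mmap_id /=; have -> : comp (idm v) (idm v) = idm v.
  by rewrite -{1}(cat_rng_id cC v) (cat_idl cC).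
by move=> /eqP; rewrite -subr_eq0 opprD addNKr oppr_eq0 => /eqP.
Qed.

Lemma cocycle2_comp (c : modfam (Pmod 2) A) a b u w (h : hom u w) : is_natural c ->
  (forall v D, c v (Pd D) = 0) -> src a = rng b -> src b = u ->
  mmap A h (catcochain c u [:: a; b]) = catcochain c w [:: b; harr h] -
    catcochain c w [:: comp a b; harr h] + catcochain c w [:: a; comp b h].
Proof.
move=> cN c0 ab bu; have hu : rng (harr h) = u by exact/eqP/(hom_rng h).
have hw : src (harr h) = w by exact/eqP/(hom_src h).
have et : endsat w [:: a; b; harr h; idm w].
  by rewrite /= ab bu hu hw (cat_rng_id cC) (cat_src_id cC) !eqxx.
have := c0 w (Pgen 3 w [:: a; b; harr h; idm w]).
rewrite PdE// !big_ord_recl big_ord0 addr0 /=.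
have cB := cN.1 w; rewrite !(zmodD cB) !(zmodMz cB) expr1 mulrN1z sqrrN expr1n mulr1z.
rewrite hom_idr.
have eh : endsat w (rcons [:: a; b] (harr h)) by rewrite /= ab hu hw bu !eqxx.
rewrite exprSr sqrrN expr1n mul1r mulrN1z.
rewrite [c w (Pgen 2 w [:: a; b; harr h])](catcochain_map cN _ eh)// /catcochain /= => E.
by apply/eqP; rewrite eq_sym -subr_eq0 -!addrA E.
Qed.

End CategoricalCochains.

(** * Evaluation of psi and kappa at generators, and degree 0 *)

Section KappaLow.
Variables (k : nat) (L : kgraph k) (A : rmodule L).
Implicit Types (x y z w : ipath L) (j l m p q r : degree k) (lam a b : mor L).
Implicit Types (g h : parrow L).
Local Notation G := (path_groupoid L).
Local Notation uA := (under A).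
Let cL := categoryP L.
Arguments eta_cochain {G A n} f i _.

Lemma prefix_at x z p : sg z 0 p = sg x 0 p -> z p = x p.
Proof. by move=> E; rewrite -[p in LHS]add0r -[p in RHS]add0r -!src_sg E. Qed.

Lemma near_prefix x p : \forall z \near x, sg z 0 p = sg x 0 p.
Proof. by apply/nbhs_ipath; exists p. Qed.

Lemma act_at_phv x g p q v (b : A v) : prng g = x -> lev g p q -> v = psrc g q ->
  act_at (A := uA) (G := G) x (g := g) (phv (psrc g) q b : uA (psrc g)) = phv x p b.
Proof.
move=> gx gl vq; rewrite /act_at; case: pselect => [gx'|[]]; last exact/eqP.
exact: uact_phv.
Qed.

Lemma fam_germ (F : forall v, A v) x p : germ (A := uA) (fun z => phv z p (F (x p))) x.
Proof. exact: under_germ. Qed.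

(* The generator [g, t] is sent to g . phi^y_0(c(t)), y = s(g), by the cochain
   corresponding to f and by the one corresponding to c. *)
Lemma eta_psi_under n (c : modfam (Pmod n) A) (f : ccochain uA n) : is_natural c ->
  (forall y t, size t = n -> (t <> [::] -> endsat (y 0) t) ->
     ceval f y (climb y (rev t)) *~ (-1) ^+ uphalf n = phv y 0 (catcochain c (y 0) t)) ->
  forall x (s : under (Pmod n) x), eta_cochain f x (psi s) = under_map c s.
Proof.
move=> cN H x s; have [m [D ->]] := phv_at 0 (s : dlim (Pmod n) x).
rewrite psi_phv// under_map_phv//; set p := 0 + m in D *.
apply: (P_ext (f := fun D => eta_cochain f x (psiv x p D)) (f' := fun D => phv x p (c (x p) D))).
- by move=> D1 D2; rewrite psiv_zmod eta_zmod.
- by move=> D1 D2; rewrite (cN.1 (x p)) phv_zmod.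
case/lastP => // t a st et; rewrite psivE// psil_rcons /psi_gen.
have [sa st' ct] := psi_valid erefl st et; have [c1 c2] := psi_chain sa st' ct.
have [r1 s1 l1] := descendP sa.
set g := descend x p a in c1 c2 r1 s1 l1 *.
rewrite (zmodMz (@eta_zmod _ _ _ f x)) eta_gen//; last by rewrite size_climb size_rev.
rewrite -(zmodMz (@act_at_zmod G uA (under_sheafy A) x g)) H//; last first.
  move=> t0; have y0 : psrc g 0 = rng a by rewrite s1 pathcat0//= add0r.
  by rewrite y0; have [|//] := endsat_of_rcons _ et; case: (t) t0.
have y0 : rng a == psrc g 0 by rewrite s1 pathcat0//= add0r.
have ax : src a == x p by exact/eqP.
pose h : hom (psrc g 0) (x p) := Hom y0 ax.
have eh : endsat (x p) (rcons t (harr h)) by [].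
rewrite -[a in RHS]/(harr h) (catcochain_map cN st' eh).
have hE : harr h = sg (psrc g) 0 (kdeg a).
  have sy : src a = (shift p x) 0 by rewrite /= add0r.
  by have := sg_pathcat0 sy; rewrite -s1 => ->.
(* With y = s(g), the value at y is raised from level 0 to level d(a) along a = y(0, d(a)); then g
   carries the level d(a) of y to the level p of x. *)
rewrite -[in LHS](phv_map _ hE) add0r; apply: act_at_phv => //.
by have := lev_at 0 l1; rewrite !addr0 r1.
Qed.

Section Degree0.
Variable c : modfam (Pmod 0) A.
Hypotheses (cN : is_natural c) (c0 : forall v (D : Pmod 1 v), c (Pd D) = 0).

Definition kap0 : ccochain uA 0 := fun x _ => phv x 0 (catcochain c (x 0) [::]).

Lemma kap0P : is_kappa0 c kap0.
Proof. by move=> y; rewrite ceval_chain// /kap0 phvE. Qed.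

Lemma kap0_up x p : phv x 0 (catcochain c (x 0) [::]) = phv x p (catcochain c (x p) [::]).
Proof.
rewrite -(@phv_map _ _ _ x 0 p _ _ (seg x (ledeg_addl 0 p)))//.
by rewrite (cocycle0_map _ cN c0) add0r.
Qed.

Lemma kappa0_eval f y : is_kappa0 c f -> ceval f y [::] = phv y 0 (catcochain c (y 0) [::]).
Proof. by move=> /(_ y) ->; rewrite phvE. Qed.

Lemma kappa0_cocycle f : is_kappa0 c f -> cocycles (f : cgrp (cont_complex uA) 0).
Proof.
move=> kf; have fE x (u : @chainfrom G 0 x) : f x u = phv x 0 (catcochain c (x 0) [::]).
  by rewrite -(kappa0_eval _ kf) -cevalE; case: (val u) (chain_size u).
split.
  apply: (cc_cont_local (path_etale L) (under_sheafy A)) => x u.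
  exists (fun z => phv z 0 (catcochain c (z 0) [::])); last first.
    have : \forall v \near (GTuple u : gtuple G 0), True by exact: filterT.
    by apply: filterS => v _; exact: fE.
  apply: germ_eq (fam_germ (fun v => catcochain c v [::]) x 0).
  by move: (near_prefix x 0); apply: filterS => z /prefix_at ->.
apply: functional_extensionality_dep => x; apply/funext => u.
rewrite -[LHS]/(cc_diff f u) /cc_diff.
case: (val u) (chain_size u) (chain_ischain u) => [|g [|? ?]] //= _ /andP[/eqP gx _].
rewrite big_geq// addr0 !(kappa0_eval _ kf) expr1 mulrN1z.
have [p [q gl]] := lev_exists g.
rewrite (kap0_up (psrc g) q) (act_at_phv _ gx gl)// (kap0_up x p).
have -> : psrc g q = x p by have := lev_at 0 gl; rewrite !addr0 [prng g]gx.
exact: subrr.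
Qed.

End Degree0.
End KappaLow.

(** * The map kappa in degree 1 *)

Section KappaOne.
Variables (k : nat) (L : kgraph k) (A : rmodule L).
Implicit Types (x y z w : ipath L) (j l m p q r : degree k) (lam a b : mor L).
Implicit Types (g h : parrow L).
Local Notation G := (path_groupoid L).
Local Notation uA := (under A).
Let cL := categoryP L.
Variable c : modfam (Pmod 1) A.
Hypotheses (cN : is_natural c) (c0 : forall v (D : Pmod 2 v), c (Pd D) = 0).

Definition pot1 g l j v : A v :=
  catcochain c v [:: sg (prng g) 0 l] - catcochain c v [:: sg (psrc g) 0 j].

(** Raising the level appends the same segment to both initial segments, and the two new terms of
    the cocycle identity cancel. *)
Lemma pot1_up g l j r : lev g l j ->
  phv (prng g) l (pot1 g l j (prng g l)) =
  phv (prng g) (l + r) (pot1 g (l + r) (j + r) (prng g (l + r))).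
Proof.
move=> gl; pose h := seg (prng g) (ledeg_addl l r).
have hE : harr h = sg (prng g) l r by [].
rewrite -(phv_map _ hE) /pot1 raddfB; congr phv.
have E1 := @cocycle1_comp L A c (sg (prng g) 0 l) _ _ h cN c0 _.
have E2 := @cocycle1_comp L A c (sg (psrc g) 0 j) _ _ h cN c0 _.
rewrite !sgD !add0r -(lev_sg r gl) -hE E1 ?E2 ?src_sg ?add0r//.
  by rewrite opprD addrACA subrr add0r.
by have := lev_at 0 gl; rewrite !addr0.
Qed.

Lemma pot1_indep g l j l' j' : lev g l j -> lev g l' j' ->
  phv (prng g) l (pot1 g l j (prng g l)) = phv (prng g) l' (pot1 g l' j' (prng g l')).
Proof.
move=> gl gl'; rewrite (pot1_up l' gl) (pot1_up l gl').
have -> : l + l' = l' + l by rewrite addrC.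
by have -> : j + l' = j' + l by have := lev_join gl gl'; deg_lia.
Qed.

Lemma seg0E x l : harr (seg x (ledeg0 l)) = sg x 0 l.
Proof. by rewrite /= (fmor_sg x (ledeg0 l) (n := l))// add0r. Qed.

Lemma kappa1_eval f g l j : is_kappa1 c f -> lev g l j ->
  ceval f (prng g) [:: g] = phv (prng g) l (pot1 g l j (prng g l)).
Proof.
move=> kf gl; have := kf _ _ _ _ gl.2; rewrite -(pmk_eta gl) => ->.
by rewrite !seg0E phvE.
Qed.

Lemma kappa1_exists : exists f, is_kappa1 c f.
Proof.
have /choice[lv Hlv] g : exists jl : degree k * degree k, lev g jl.1 jl.2.
  by have [j [l gl]] := lev_exists g; exists (j, l).
pose f : ccochain uA 1 := fun x u => if val u is g :: _ then
  phv x (lv g).1 (pot1 g (lv g).1 (lv g).2 ((x : ipath L) (lv g).1)) else 0.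
exists f => y z j l yz; have [r1 s1 gl] := pmkP yz.
set g := pmk _ _ _ in r1 s1 gl *.
rewrite !seg0E.
have ch : ischain (C := G) y [:: g] by rewrite /= andbT; exact/eqP.
rewrite (ceval_chain f (erefl : size [:: g] = 1%N) ch) /f.
rewrite (@val_chain_of G 1 y [:: g])// -phvE.
have := pot1_indep (Hlv g) gl; rewrite r1 => ->.
by rewrite /pot1 r1 s1.
Qed.

(** At common levels j, m, l of g and h the three differences telescope. Continuity holds since the
    formula only involves initial segments. *)
Lemma kappa1_cocycle f : is_kappa1 c f -> cocycles (f : cgrp (cont_complex uA) 1).
Proof.
move=> kf; split.
  apply: (cc_cont_local (path_etale L) (under_sheafy A)) => x u.
  have [g ug] : exists g, val u = [:: g].
    by case: (val u) (chain_size u) => [|g [|? ?]]//; exists g.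
  have gx : prng g = x by have := chain_ischain u; rewrite ug /= => /andP[/eqP].
  have [l [j gl]] := lev_exists g.
  exists (fun z => phv z l (pot1 g l j (x l))).
    exact: under_germ.
  have N : \forall h \near g, near_at g l j h by apply/nbhs_parrow; exists l, j.
  have u0 : @gnth G 1 (GTuple u) 0 = g by rewrite /gnth /= ug.
  have N' : \forall v \near (GTuple u : gtuple G 1), near_at g l j (@gnth G 1 v 0).
    by apply: (@gnth_cont G 1 0 isT (GTuple u)); rewrite u0.
  apply: filterS N' => -[z v].
  have [h vh] : exists h, val v = [:: h].
    by case: (val v) (chain_size v) => [|h [|? ?]]//; exists h.
  have E := cevalE f v; rewrite vh in E.
  have hz : prng h = z by have := chain_ischain v; rewrite vh /= => /andP[/eqP].
  rewrite /gnth /= vh /= => -[hl E1 E2]; rewrite -E -{}hz -gx (kappa1_eval kf hl) /pot1 E1 E2.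
  by rewrite (prefix_at E1).
apply: functional_extensionality_dep => x; apply/funext => u.
rewrite -[LHS]/(cc_diff f u) /cc_diff.
case: (val u) (chain_size u) (chain_ischain u) => [|g [|h [|? ?]]] //= _.
move=> /and3P[/eqP gx /eqP hg _].
have gh : psrc g = prng h by [].
have [j [m [l [gl hl]]]] := lev_pair gh.
rewrite big_nat1 /= expr1 mulrN1z sqrrN expr1n mulr1z.
have E1 := kappa1_eval kf hl; rewrite -gh in E1.
rewrite E1 (act_at_phv _ gx gl)//.
have E2 := kappa1_eval kf (lev_mul gh gl hl); rewrite prng_mul// gx in E2.
have E3 := kappa1_eval kf gl; rewrite gx in E3.
have xm : psrc g m = x j by have := lev_at 0 gl; rewrite !addr0 [prng g]gx.
rewrite E2 E3 xm -phv_zmod -(zmodD (@phv_zmod _ _ _ _ _ _)).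
rewrite /pot1 prng_mul// psrc_mul// -gh subr_subACA subrr subr0.
rewrite addrA subrK subrr.
exact: phv0.
Qed.

(** The climbing arrow has level (0, d(a)), so the formula gives c(id) - c(a) = - c(a), and the sign
    of psi_1 restores c(a). *)
Lemma kappa1_star f y t : is_kappa1 c f -> size t = 1%N ->
  (t <> [::] -> endsat (y 0) t) ->
  ceval f y (climb y (rev t)) *~ (-1) ^+ uphalf 1 = phv y 0 (catcochain c (y 0) t).
Proof.
move=> kf; case: t => [|a []]//= _ /(_ _)/wrap[]// /andP[_ /eqP ay].
rewrite descend0; have [r1 s1 l1] := descendP ay; have := kappa1_eval kf l1.
rewrite r1 => ->; rewrite expr1 mulrN1z -(zmodN (@phv_zmod _ _ _ _ _ _)); congr phv.
have ay' : src a = (shift 0 y) 0 by rewrite shift0.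
rewrite /pot1 r1 s1 sg0 (cocycle1_id _ cN c0) sub0r opprK.
by rewrite (sg_pathcat0 ay').
Qed.

End KappaOne.

(** * A partition of the path groupoid *)

Section Partition.
Variables (k : nat) (L : kgraph k).
Implicit Types (x y z : ipath L) (j l m n p q : degree k) (lam : mor L) (g h : parrow L).

Definition posd (a : zdegree k) : degree k :=
  [ffun i => if a i is Posz m then m else 0%N].
Definition negd (a : zdegree k) : degree k :=
  [ffun i => if a i is Negz m then m.+1 else 0%N].
Lemma posdE a i : posd a i = if a i is Posz m then m else 0%N. Proof. exact: ffunE. Qed.
Lemma negdE a i : negd a i = if a i is Negz m then m.+1 else 0%N. Proof. exact: ffunE. Qed.
Definition diag N : degree k := [ffun=> N].

Definition dlev g N := `[< lev g (posd (pdeg g) + diag N) (negd (pdeg g) + diag N) >].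

Lemma dlev_exists g : exists N, dlev g N.
Proof.
have [j [l gl]] := lev_exists g.
(* N bounds every coordinate of j, so the given level (j, l) can be raised to (n^+ + N, n^- + N). *)
pose N := (\sum_i j i)%N; exists N; apply/asboolP.
have [E _] := gl; have Ei i := zdegK E i.
have jN i : (j i <= N)%N by rewrite /N (bigD1 i)//= leq_addr.
have := levD [ffun i => (posd (pdeg g) i + N - j i)%N] gl.
have -> : j + [ffun i => (posd (pdeg g) i + N - j i)%N] = posd (pdeg g) + diag N.
  apply: degP => i; have := jN i; rewrite !degE !ffunE; lia.
have -> : l + [ffun i => (posd (pdeg g) i + N - j i)%N] = negd (pdeg g) + diag N.
  apply: degP => i; have := jN i; have := Ei i; rewrite !degE !ffunE.
  by case: (pdeg g i) => m; lia.
by [].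
Qed.

(* The least N such that sigma^(n^+ + N)(r(g)) = sigma^(n^- + N)(s(g)), where
   n is the degree of g and N stands for (N, ..., N). *)
Definition height g := ex_minn (dlev_exists g).

Definition pleft g := sg (prng g) 0 (posd (pdeg g) + diag (height g)).
Definition pright g := sg (psrc g) 0 (negd (pdeg g) + diag (height g)).

Lemma lev_height g : lev g (posd (pdeg g) + diag (height g)) (negd (pdeg g) + diag (height g)).
Proof. by rewrite /height; case: ex_minnP => N /asboolP. Qed.

Lemma height_min g N : lev g (posd (pdeg g) + diag N) (negd (pdeg g) + diag N) -> (height g <= N)%N.
Proof. by move=> gN; rewrite /height; case: ex_minnP => M _; apply; apply/asboolP. Qed.

Lemma diagD M N : diag (M + N) = diag M + diag N.
Proof. by apply: degP => i; rewrite degE !ffunE. Qed.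

(** The level of g is a level of h, so h has at most the height of g. As both agree up to that
    level, a smaller level of h would also be one of g, so the heights are equal. This makes the
    basic sets disjoint. *)
Lemma near_height g h :
  near_at g (posd (pdeg g) + diag (height g)) (negd (pdeg g) + diag (height g)) h ->
  (pleft h, pright h) = (pleft g, pright g).
Proof.
move=> H; have [hl E1 E2] := H; have gl := lev_height g.
have dd : pdeg h = pdeg g := etrans hl.1 (esym gl.1).
have hN : (height h <= height g)%N by apply: height_min; rewrite dd.
have hh := lev_height h; rewrite dd in hh.
suff gN : (height g <= height h)%N.
  have -> : pleft h = pleft g.
    by rewrite /pleft dd (_ : height h = height g) ?E1//; apply/eqP; rewrite eqn_leq hN gN.
  by rewrite /pright dd (_ : height h = height g) ?E2//; apply/eqP; rewrite eqn_leq hN gN.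
apply: height_min; have E : height g = (height h + (height g - height h))%N by rewrite subnKC.
have G' : near_at h (posd (pdeg g) + diag (height g)) (negd (pdeg g) + diag (height g)) g.
  by split=> //; rewrite ?E1 ?E2.
by rewrite E diagD !addrA in G'; have [] := near_atW hh G'.
Qed.

Definition standard_pairs : set (mor L * mor L) := range (fun g => (pleft g, pright g)).

Lemma standard_partition : row_finite_no_sources L -> kps_partition standard_pairs.
Proof.
move=> hL; have ps g : src (pleft g) = src (pright g).
  by rewrite /pleft /pright !src_sg ![0 + _]addrC; exact: lev_at (lev_height g).
have Zp g h : Zarrow (pleft g, pright g) h <->
    near_at g (posd (pdeg g) + diag (height g)) (negd (pdeg g) + diag (height g)) h.
  exact: Zarrow_sg (lev_height g).
have Zg g : Zarrow (pleft g, pright g) g by apply/Zp; split=> //; exact: lev_height.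
split.
- by move=> _ [g _ <-] /=.
- split.
  + by apply/seteqP; split=> // g _; exists (pleft g, pright g) => //; exists g.
  + move=> _ _ [g _ <-] [h _ <-] [f [/Zp/near_height <- /Zp/near_height <-]].
    by [].
  + by move=> _ [g _ <-]; exists g.
(* The pair (lam, s(lam)) belongs to the arrow (lam y, d(lam), y): its degree has no negative part
   and its height is 0. *)
- move=> lam; have [y y0] := path_exists hL (src lam).
  have ly : src lam = y 0 by [].
  have E : shift (kdeg lam) (pathcat lam y) = shift 0 y.
    by rewrite shift_pathcat//; apply: ipath_ext => n; rewrite sg_shift addr0.
  have [r1 s1 l1] := pmkP E; set g := pmk _ _ _ in r1 s1 l1.
  have dp : posd (pdeg g) = kdeg lam.
    by rewrite l1.1; apply: degP => i; rewrite posdE !degE subr0.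
  have dn : negd (pdeg g) = 0.
    by rewrite l1.1; apply: degP => i; rewrite negdE !degE subr0.
  have d0 : diag 0 = 0 by apply: degP => i; rewrite !ffunE.
  have h0 : height g = 0%N.
    by apply/eqP; rewrite -leqn0; apply: height_min; rewrite dp dn d0 !addr0.
  exists g => //; rewrite /pleft /pright h0 dp dn d0 !addr0 r1 s1 sg_pathcat0//.
  by rewrite sg0 ly.
Qed.

End Partition.

(** * Inversion of 2-cocycles *)

Section TwoCocycles.
Variables (G : groupoid) (eG : etale_groupoid G) (cinv : continuous (@ginv G)).
Variables (A : sheaf G) (sA : sheafy A).
Implicit Types (w x y z : unit_space G) (g h : arrow G).
Local Notation chain_of n z t := (@chain_of G n z t).
Local Notation hom x y := (@hom G x y).

Lemma ginv_rng x y (g : hom x y) : rng (c := G) (ginv (harr g)) == y.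
Proof. by apply/eqP; rewrite [LHS]grng_inv; exact/eqP/(hom_src g). Qed.

Lemma ginv_src x y (g : hom x y) : src (c := G) (ginv (harr g)) == x.
Proof. by apply/eqP; rewrite [LHS]gsrc_inv; exact/eqP/(hom_rng g). Qed.

Definition invh x y (g : hom x y) : hom y x := Hom (ginv_rng g) (ginv_src g).

Lemma comph_inv x y (g : hom x y) : comph g (invh g) = @idh G x.
Proof.
apply: hom_inj; rewrite /= gmulV; congr gid.
exact: (eqP (hom_rng g)).
Qed.

Lemma comph_invl x y (g : hom x y) : comph (invh g) g = @idh G y.
Proof.
apply: hom_inj; rewrite /= gmulVg; congr gid.
exact: (eqP (hom_src g)).
Qed.

Lemma comphA w x y z (g : hom w x) (h : hom x y) (j : hom y z) :
  comph g (comph h j) = comph (comph g h) j.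
Proof. by apply: hom_inj; apply: (cat_compA (groupoidP G)); exact: (@hom_composable G). Qed.

Lemma comph_idl x y (g : hom x y) : comph (@idh G x) g = g.
Proof.
apply: hom_inj => /=; have := cat_idl (groupoidP G) (harr g).
by have -> : grng (harr g) = x by exact/eqP/(hom_rng g).
Qed.

Lemma comph_idr x y (g : hom x y) : comph g (@idh G y) = g.
Proof.
apply: hom_inj => /=; have := cat_idr (groupoidP G) (harr g).
by have -> : gsrc (harr g) = y by exact/eqP/(hom_src g).
Qed.

Lemma invh_comp x y z (g : hom x y) (h : hom y z) :
  invh (comph g h) = comph (invh h) (invh g).
Proof.
rewrite -[RHS]comph_idr -(comph_inv (comph g h)) [RHS]comphA.
rewrite -[comph (comph (invh h) (invh g)) (comph g h)]comphA.
by rewrite [comph (invh g) _]comphA comph_invl comph_idl comph_invl comph_idl.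
Qed.

Lemma act_inv x y (g : hom x y) (a : A x) : act A g (act A (invh g) a) = a.
Proof. by rewrite -(act_comp sA) comph_inv (act_id sA). Qed.

Lemma hom_chain2 x y z (g : hom x y) (h : hom y z) :
  ischain (C := G) x [:: harr g; harr h].
Proof.
apply/and3P; split=> //; first exact: (hom_rng g).
by apply/eqP; rewrite (eqP (hom_rng h)); exact/esym/eqP/(hom_src g).
Qed.

Lemma cc_diff1 (B : ccochain A 1) x y z (g : hom x y) (h : hom y z) :
  ceval (cc_diff B) x [:: harr g; harr h] =
  act A g (ceval B y [:: harr h]) - ceval B x [:: harr (comph g h)] + ceval B x [:: harr g].
Proof.
have ch := hom_chain2 g h.
rewrite (ceval_chain _ (erefl : size [:: harr g; harr h] = 2%N) ch) /cc_diff.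
rewrite (@val_chain_of G 2 x [:: harr g; harr h])// big_nat1 /= expr1 mulrN1z sqrrN expr1n mulr1z.
by rewrite (act_at_hom g (fun z => ceval B z [:: harr h])).
Qed.

Lemma cc_diff2 (f : ccochain A 2) w x y z (a : hom w x) (b : hom x y) (c : hom y z) :
  cc_diff f = 0 ->
  act A a (ceval f x [:: harr b; harr c]) = ceval f w [:: harr (comph a b); harr c]
    - ceval f w [:: harr a; harr (comph b c)] + ceval f w [:: harr a; harr b].
Proof.
move=> f0.
have ch : ischain (C := G) w [:: harr a; harr b; harr c].
  by have /= /and3P[-> -> _] := hom_chain2 a b; have /= /and3P[_ -> _] := hom_chain2 b c.
have := congr1 (fun F : ccochain A 3 => F w (chain_of 3 w [:: harr a; harr b; harr c])) f0.
rewrite /cc_diff (@val_chain_of G 3 w [:: harr a; harr b; harr c])// big_ltn// big_nat1 /=.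
rewrite expr1 mulrN1z sqrrN expr1n mulr1z exprSr sqrrN expr1n mul1r mulrN1z.
rewrite (act_at_hom a (fun z => ceval f z [:: harr b; harr c])).
rewrite -[RHS]/(0 : A w) => E.
by apply/eqP; rewrite -subr_eq0 -[X in _ == X]E !opprD opprK !addrA.
Qed.

Variable f : ccochain A 2.
Hypotheses (f0 : cc_diff f = 0).
Hypothesis f1 : forall x y (g : hom x y), ceval f x [:: harr g; gid y] = 0.

Definition invcochain : ccochain A 1 := fun x u => if val u is g :: _ then
  act_at x (g := g) (ceval f (gsrc g) [:: ginv g; g]) else 0.

Lemma invcochainE x y (g : hom x y) :
  ceval invcochain x [:: harr g] = act A g (ceval f y [:: harr (invh g); harr g]).
Proof.
have ch : ischain (C := G) x [:: harr g] by rewrite /= (hom_rng g).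
rewrite (ceval_chain _ (erefl : size [:: harr g] = 1%N) ch) /invcochain.
rewrite (@val_chain_of G 1 x [:: harr g])//.
exact: (act_at_hom g (fun z => ceval f z [:: ginv (harr g); harr g])).
Qed.

(* The cocycle identity at (h^-1, g^-1, g) and at (h^-1 g^-1, g, h). *)
Lemma cocycle_inv x y z (g : hom x y) (h : hom y z) :
  ceval (f - cc_diff invcochain) x [:: harr g; harr h] =
  - act A (comph g h) (ceval f z [:: harr (invh h); harr (invh g)]).
Proof.
have E1 := cc_diff2 (invh h) (invh g) g f0.
rewrite comph_invl f1 subr0 in E1.
have E2 := cc_diff2 (comph (invh h) (invh g)) g h f0.
rewrite -[comph (comph (invh h) (invh g)) g]comphA comph_invl comph_idr in E2.
have aB := actB sA (comph g h).
(* Writing f(g, h) as gh acting on its translate by (gh)^-1 lets the second cocycle identity rewrite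
   it. *)
have E3 : ceval f x [:: harr g; harr h] =
    act A (comph g h) (act A (comph (invh h) (invh g)) (ceval f x [:: harr g; harr h])).
  by rewrite -invh_comp act_inv.
rewrite cevalB cc_diff1 !invcochainE E3 E2 invh_comp.
have E4 : ceval f z [:: harr (comph (invh h) (invh g)); harr g] =
    act A (invh h) (ceval f y [:: harr (invh g); harr g])
    - ceval f z [:: harr (invh h); harr (invh g)].
  by rewrite E1 addrK.
rewrite E4 (zmodD aB) aB aB -[act A g (act A h _)](act_comp sA).
have -> : act A (comph g h) (act A (invh h) (ceval f y [:: harr (invh g); harr g])) =
    act A g (ceval f y [:: harr (invh g); harr g]).
  by rewrite (act_comp sA) act_inv.
by rewrite addrA [LHS]addrAC subrr sub0r.
Qed.

Hypothesis cf : continuous (ccochain_map f).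

Lemma invcochain_cont : continuous (ccochain_map invcochain).
Proof.
apply: (cc_cont_local eG sA) => x u.
have [g ug] : exists g, val u = [:: g].
  by case: (val u) (chain_size u) => [|g [|? ?]]//; exists g.
have gx : grng g = x by have := chain_ischain u; rewrite ug /= => /andP[/eqP].
have ch h : ischain (C := G) (gsrc h) [:: ginv h; h].
  by rewrite /= grng_inv gsrc_inv !eqxx.
pose T h : gtuple G 2 := GTuple (chain_of 2 (gsrc h) [:: ginv h; h]).
have cT : {for g, continuous T}.
  apply: gtuple_cvg => [|i ib]; first exact: gsrc_cont.
  have vT h : val (chain_of 2 (gsrc h) [:: ginv h; h]) = [:: ginv h; h].
    by rewrite (@val_chain_of G 2 (gsrc h) [:: ginv h; h])//; exact: ch.
  case: i ib => [|[|i]]// _.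
    by apply: (cont_near_eq (s := @ginv G)); [apply: nearW => h; rewrite /gnth /= vT|exact: cinv].
  apply: (cont_near_eq (s := id)); [by apply: nearW => h; rewrite /gnth /= vT|exact: cvg_id].
have [s gs sE] := etale_stalk (ceval f (gsrc g) [:: ginv g; g]) (sheafy_etale sA).
have N1 : \forall h \near g, ceval f (gsrc h) [:: ginv h; h] = s (gsrc h).
  have N : nbhs (ccochain_map f (T g)) [set e | e = sec s (tpt e)].
    have -> : ccochain_map f (T g) = sec s (gsrc g).
      by rewrite /ccochain_map /sec sE (ceval_chain f (erefl : size [:: ginv g; g] = 2%N) (ch g)).
    by rewrite (osec_nbhs gs); exact: nearW.
  have : \forall h \near g, ccochain_map f (T h) = sec s (tpt (ccochain_map f (T h))).
    have C := @continuous_comp _ _ _ T (ccochain_map f) g cT (@cf _).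
    exact: (C _ N).
  apply: filterS => h /(@total_inj _ (stalk A)) <-.
  exact: (ceval_chain f (erefl : size [:: ginv h; h] = 2%N) (ch h)).
have [t gt tE] := germ_act sA gs.
exists t; first by rewrite -gx.
pose O := [set h | ceval invcochain (grng h) [:: h] = t (grng h)].
have N2 : \forall h \near g, O h.
  move: N1 tE; apply: filterS2 => h Eh; rewrite /O /= => <-.
  by rewrite -Eh -[h in [:: h]]/(harr (@hom_of G h)) invcochainE.
have u0 : @gnth G 1 (GTuple u) 0 = g by rewrite /gnth /= ug.
have N3 : \forall v \near (GTuple u : gtuple G 1),
    O (@gnth G 1 v 0).
  by apply: (@gnth_cont G 1 0 isT (GTuple u)); rewrite u0.
apply: filterS N3 => -[z v].
have [h vh] : exists h, val v = [:: h].
  by case: (val v) (chain_size v) => [|h [|? ?]]//; exists h.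
have E := cevalE invcochain v; rewrite vh in E.
have hz : grng h = z by have := chain_ischain v; rewrite vh /= => /andP[/eqP].
by rewrite /O /gnth /= vh /= hz E.
Qed.

End TwoCocycles.

(** The coboundary of a coboundary: the letters g, h, i stand for the contributions of three arrows,
    and n, l, m for those of hi, gh and ghi. *)
Lemma alternating_cancel (V : zmodType) (g h i m n l : V) :
  h + i - n + (g + n - m - (l + i - m)) - (g + h - l) = 0.
Proof.
rewrite [g + n - m - _]subr_subACA subrr subr0 addrACA; apply/eqP.
rewrite subr_eq add0r -opprD subr_eq [n + _]addrC -[l + i + n]addrA [g + h - l + _]addrA subrK.
by rewrite addrACA [h + g]addrC.
Qed.

(** The last clause of [is_kappa2], isolated for comparison with [kap2_eval], where the auxiliary
    morphisms are segments of the paths themselves. *)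
Definition kps_formula (k : nat) (L : kgraph k) (A : rmodule L) (c : modfam (Pmod 2) A)
    (P : set (mor L * mor L)) (f : ccochain (under A) 2) : Prop :=
  forall (g h : parrow L) (mg ng mh nh mgh ngh a b c' : mor L) (y : ipath L),
    psrc g = prng h ->
    P (mg, ng) -> Zarrow (mg, ng) g ->
    P (mh, nh) -> Zarrow (mh, nh) h ->
    P (mgh, ngh) -> Zarrow (mgh, ngh) (pmul g h) ->
    src mg = rng a -> src mh = rng b -> src mgh = rng c' -> src a = y 0 ->
    comp ng a = comp mh b -> comp mg a = comp mgh c' ->
    comp nh b = comp ngh c' ->
    prng g = pathcat (comp mg a) y -> psrc g = pathcat (comp ng a) y ->
    prng h = pathcat (comp mh b) y -> psrc h = pathcat (comp nh b) y ->
    let x := prng g in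
    let p := kdeg (comp mg a) in
    let C := catcochain c (x p) in
    ceval f x [:: g; h] =
    phi A x p (C [:: mg; a] - C [:: ng; a] + C [:: mh; b] - C [:: nh; b]
               - C [:: mgh; c'] + C [:: ngh; c']).

(** * The map kappa in degree 2 *)

Section KappaTwo.
Variables (k : nat) (L : kgraph k) (A : rmodule L).
Implicit Types (x y z w : ipath L) (j l m n p q r a b e : degree k) (lam mu nu : mor L).
Implicit Types (g h : parrow L).
Local Notation G := (path_groupoid L).
Local Notation uA := (under A).
Let cL := categoryP L.

Lemma pinv_lev g j l : lev g j l -> lev (pinv g) l j.
Proof. by move=> [E1 E2]; split; rewrite ?pdeg_inv ?prng_inv ?psrc_inv// E1 opprB. Qed.

Lemma pinv_cont : continuous (@pinv k L).
Proof.
move=> g O /nbhs_parrow[j [l [gl Og]]].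
have gg : pinv (pinv g) = g.
  by apply: parrow_eq; rewrite ?prng_inv ?psrc_inv ?pdeg_inv ?prng_inv ?psrc_inv ?opprK.
have gl' := pinv_lev gl; rewrite gg in gl'.
apply/nbhs_parrow; exists l, j; split=> // h [hl E1 E2]; apply: Og.
by split; rewrite ?prng_inv ?psrc_inv//; exact: pinv_lev.
Qed.

(** The pair (mu_g, nu_g) of the partition whose basic set contains g. [mnU] makes it constant on
    that set and [mnid] encodes that the pairs (lam, s(lam)) belong to the partition. *)
Variable mn : parrow L -> mor L * mor L.
Hypotheses (mnZ : forall g, Zarrow (mn g) g) (mns : forall g, src (mn g).1 = src (mn g).2).
Hypothesis mnU : forall g h, Zarrow (mn g) h -> mn h = mn g.
Hypothesis mnid : forall lam g, Zarrow (lam, idm (src lam)) g -> mn g = (lam, idm (src lam)).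

Definition dmu g := kdeg (mn g).1.
Definition dnu g := kdeg (mn g).2.

Lemma mnP g : [/\ lev g (dmu g) (dnu g), sg (prng g) 0 (dmu g) = (mn g).1 &
  sg (psrc g) 0 (dnu g) = (mn g).2].
Proof. by have := mnZ g; rewrite {1}[mn g]surjective_pairing => /(ZarrowP g (mns g)). Qed.

Lemma mn_lev g : lev g (dmu g) (dnu g). Proof. by have [] := mnP g. Qed.
Lemma mn_mu g : sg (prng g) 0 (dmu g) = (mn g).1. Proof. by have [] := mnP g. Qed.
Lemma mn_nu g : sg (psrc g) 0 (dnu g) = (mn g).2. Proof. by have [] := mnP g. Qed.

Lemma mu_sg g a : comp (mn g).1 (sg (prng g) (dmu g) a) = sg (prng g) 0 (dmu g + a).
Proof. by rewrite -mn_mu sgD add0r. Qed.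

Lemma nu_sg g a : comp (mn g).2 (sg (prng g) (dmu g) a) = sg (psrc g) 0 (dnu g + a).
Proof. by rewrite -mn_nu (lev_sg a (mn_lev g)) sgD add0r. Qed.

Lemma src_mu g : src (mn g).1 = prng g (dmu g).
Proof. by rewrite -mn_mu src_sg add0r. Qed.

(* Levels at which the six terms of the formula for kappa^2 can be read. *)
Definition compat g h a b e := [/\ dmu g + a = dmu (pmul g h) + e,
  dnu g + a = dmu h + b & dnu h + b = dnu (pmul g h) + e].

(** With these values the first two conditions are identities, and the third is the equation between
    the degrees of g, h and gh. *)
Lemma compat_std g h : psrc g = prng h ->
  compat g h (dmu h + dmu (pmul g h)) (dnu g + dmu (pmul g h)) (dmu g + dmu h).
Proof.
move=> gh.
have [E1 _] := mn_lev g; have [E2 _] := mn_lev h; have [E3 _] := mn_lev (pmul g h).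
rewrite pdeg_mul// E1 E2 in E3.
by split; deg_lia.
Qed.

Lemma compat_exists g h : psrc g = prng h -> exists a b e, compat g h a b e.
Proof. by move=> /compat_std; exists (dmu h + dmu (pmul g h)), (dnu g + dmu (pmul g h)), (dmu g + dmu h). Qed.

Lemma compat_exists3 g h f : psrc g = prng h -> psrc h = prng f -> exists a b d e s t,
  [/\ compat g h a b e, compat (pmul g h) f e d t, compat g (pmul h f) a s t &
      compat h f b d s].
Proof.
move=> gh hf; have g_hf : psrc g = prng (pmul h f) by rewrite prng_mul.
have gh_f : psrc (pmul g h) = prng f by rewrite psrc_mul.
have [Eg _] := mn_lev g; have [Eh _] := mn_lev h; have [Ef _] := mn_lev f.
have [Egh _] := mn_lev (pmul g h); have [Ehf _] := mn_lev (pmul h f).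
have [Egf _] := mn_lev (pmul (pmul g h) f).
rewrite pdeg_mul// in Egh; rewrite pdeg_mul// in Ehf; rewrite !pdeg_mul// in Egf.
rewrite Eg Eh in Egh; rewrite Eh Ef in Ehf; rewrite Eg Eh Ef in Egf; clear Eg Eh Ef.
have ghf : pmul g (pmul h f) = pmul (pmul g h) f by exact: (cat_compA (groupoidP G)).
rewrite /compat ghf; move: Egh Ehf Egf.
move: (dmu g) (dnu g) (dmu h) (dnu h) (dmu f) (dnu f) => m1 n1 m2 n2 m3 n3.
move: (dmu (pmul g h)) (dnu (pmul g h)) (dmu (pmul h f)) (dnu (pmul h f)) => m4 n4 m5 n5.
move: (dmu _) (dnu _) => m6 n6 Egh Ehf Egf.
(* All six pairs are read at one vertex: at degree m1 + ... + m6 along r(g), at n1 + m2 + ... + m6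
   along r(h), and at n1 + n2 + m3 + ... + m6 along r(f). Each witness is what its own mu leaves of
   that degree. *)
exists (m2 + m3 + m4 + m5 + m6), (n1 + m3 + m4 + m5 + m6), (n2 + n1 + m4 + m5 + m6).
exists (m1 + m2 + m3 + m5 + m6), (n1 + m2 + m3 + m4 + m6), (m1 + m2 + m3 + m4 + m5).
by do !split; deg_lia.
Qed.

Variable c : modfam (Pmod 2) A.
Hypotheses (cN : is_natural c) (c0 : forall v (D : Pmod 3 v), c (Pd D) = 0).

(** The two terms of the formula that belong to g alone, alpha being the segment of r(g) that
    follows mu_g. The cochain [kap2] is formally the coboundary of these contributions. *)
Definition pot2 g a v : A v :=
  catcochain c v [:: (mn g).1; sg (prng g) (dmu g) a] -
  catcochain c v [:: (mn g).2; sg (prng g) (dmu g) a].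

Definition kap2 g h a b e v : A v := pot2 g a v + pot2 h b v - pot2 (pmul g h) e v.

(** The cocycle identities at (mu_g, alpha, h) and (nu_g, alpha, h) share the term c(alpha, h). What
    remains as correction involves only the initial segments of r(g) and s(g). *)
Lemma pot2_up g a r u v (h : hom u v) : harr h = sg (prng g) (dmu g + a) r ->
  mmap A h (pot2 g a u) = pot2 g (a + r) v +
    (catcochain c v [:: sg (psrc g) 0 (dnu g + a); harr h] -
     catcochain c v [:: sg (prng g) 0 (dmu g + a); harr h]).
Proof.
move=> hE; have hu : prng g (dmu g + a) = u.
  by rewrite -(rng_sg _ _ r) -hE; exact/eqP/(hom_rng h).
have su : src (sg (prng g) (dmu g) a) = u by rewrite src_sg.
have s1 : src (mn g).1 = rng (sg (prng g) (dmu g) a) by rewrite rng_sg src_mu.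
have s2 : src (mn g).2 = rng (sg (prng g) (dmu g) a) by rewrite -mns.
have E : comp (sg (prng g) (dmu g) a) (harr h) = sg (prng g) (dmu g) (a + r) by rewrite hE sgD.
have E1 := cocycle2_comp h cN c0 s1 su; have E2 := cocycle2_comp h cN c0 s2 su.
rewrite E mu_sg in E1; rewrite E nu_sg in E2.
rewrite /pot2 raddfB /= E1 E2 opprD addrACA addrC; congr (_ + _).
by rewrite opprB addrC addrA subrK.
Qed.

(** The corrections of g, h and gh telescope along r(g), s(g) = r(h) and s(h). *)
Lemma kap2_up g h a b e r : psrc g = prng h -> compat g h a b e ->
  phv (prng g) (dmu g + a) (kap2 g h a b e (prng g (dmu g + a))) =
  phv (prng g) (dmu g + (a + r)) (kap2 g h (a + r) (b + r) (e + r) (prng g (dmu g + (a + r)))).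
Proof.
move=> gh [Ep Eq El]; pose i := seg (prng g) (ledeg_addl (dmu g + a) r).
have iE : harr i = sg (prng g) (dmu g + a) r by [].
have iE' : harr i = sg (prng h) (dmu h + b) r.
  by rewrite -Eq -gh iE; apply: lev_sg; exact/levD/mn_lev.
have iE'' : harr i = sg (prng (pmul g h)) (dmu (pmul g h) + e) r by rewrite prng_mul// -Ep.
rewrite -(phv_map _ iE) addrA /kap2 raddfB raddfD /=.
rewrite (pot2_up iE) (pot2_up iE') (pot2_up iE'') prng_mul// psrc_mul// -gh -Ep -Eq -El.
move: (catcochain c _ _) (catcochain c _ _) (catcochain c _ _) => s t u.
congr phv; rewrite [X in X - _]addrACA [u - t + _]addrC [s - u + _]addrA subrK.
by rewrite opprD [LHS]addrACA subrr addr0.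
Qed.

Lemma kap2_indep g h a b e a' b' e' : psrc g = prng h ->
  compat g h a b e -> compat g h a' b' e' ->
  phv (prng g) (dmu g + a) (kap2 g h a b e (prng g (dmu g + a))) =
  phv (prng g) (dmu g + a') (kap2 g h a' b' e' (prng g (dmu g + a'))).
Proof.
move=> gh H H'; rewrite (kap2_up a' gh H) (kap2_up a gh H').
have [E1 E2 E3] := H; have [E1' E2' E3'] := H'.
have -> : a + a' = a' + a by rewrite addrC.
have -> : b + a' = b' + a by deg_lia.
by have -> : e + a' = e' + a by deg_lia.
Qed.

Definition kap2_eval (f : ccochain uA 2) := forall g h a b e,
  psrc g = prng h -> compat g h a b e ->
  ceval f (prng g) [:: g; h] =
  phv (prng g) (dmu g + a) (kap2 g h a b e (prng g (dmu g + a))).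

Lemma near_mn g a h : near_at g (dmu g + a) (dnu g + a) h -> mn h = mn g.
Proof.
move=> /(near_atW (mn_lev g))/(Zarrow_sg _ (mn_lev g)).
by rewrite mn_mu mn_nu -surjective_pairing; exact: mnU.
Qed.

Lemma near_pot2 g a h v : near_at g (dmu g + a) (dnu g + a) h -> pot2 h a v = pot2 g a v.
Proof.
move=> H; have E := near_mn H; have [_ E1 _] := H.
by rewrite /pot2 /dmu E -/(dmu g) (sg_suffix E1).
Qed.

Section Cocycle.
Variable f : ccochain uA 2.
Hypothesis fE : kap2_eval f.

(** Near (g, h) the three pairs of the partition are constant and the segments used agree, so the
    value follows a section. *)
Lemma kap2_cont : continuous (ccochain_map f).
Proof.
apply: (cc_cont_local (path_etale L) (under_sheafy A)) => x u.
have [g [h ug]] : exists g h, val u = [:: g; h].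
  by case: (val u) (chain_size u) => [|g [|h [|? ?]]]//; exists g, h.
have [gx gh] : prng g = x /\ psrc g = prng h.
  by have := chain_ischain u; rewrite ug /= => /and3P[/eqP ? /eqP ? _].
have [a [b [e H]]] := compat_exists gh.
exists (fun z => phv z (dmu g + a) (kap2 g h a b e (x (dmu g + a)))).
  exact: under_germ.
pose N1 g' := near_at g (dmu g + a) (dnu g + a) g'.
pose N2 h' := near_at h (dmu h + b) (dnu h + b) h'.
have M1 : \forall v \near (GTuple u : gtuple G 2), N1 (@gnth G 2 v 0).
  apply: (@gnth_cont G 2 0 isT (GTuple u)); rewrite [gnth _ _](_ : _ = g) /gnth /= ?ug//.
  by apply/nbhs_parrow; exists (dmu g + a), (dnu g + a); split=> //; exact/levD/mn_lev.
have M2 : \forall v \near (GTuple u : gtuple G 2), N2 (@gnth G 2 v 1).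
  apply: (@gnth_cont G 2 1 isT (GTuple u)); rewrite [gnth _ _](_ : _ = h) /gnth /= ?ug//.
  by apply/nbhs_parrow; exists (dmu h + b), (dnu h + b); split=> //; exact/levD/mn_lev.
move: M1 M2; apply: filterS2 => -[z v].
have [g' [h' vg]] : exists g h, val v = [:: g; h].
  by case: (val v) (chain_size v) => [|g' [|h' [|? ?]]]//; exists g', h'.
have [gz gh'] : prng g' = z /\ psrc g' = prng h'.
  by have := chain_ischain v; rewrite vg /= => /and3P[/eqP ? /eqP ? _].
have := cevalE f v; rewrite vg /gnth /= vg /= => <- H1 H2.
have [gl' E1 _] := H1; have [hl' _ E2] := H2; have [Ep Eq El] := H.
have H3 : near_at (pmul g h) (dmu (pmul g h) + e) (dnu (pmul g h) + e) (pmul g' h').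
  rewrite -Ep -El; split; rewrite ?prng_mul ?psrc_mul//.
  by apply: lev_mul hl' => //; rewrite -Eq.
have H' : compat g' h' a b e by rewrite /compat /dmu /dnu !(near_mn H1, near_mn H2, near_mn H3).
rewrite -gz (fE gh' H') /kap2 (near_pot2 _ H1) (near_pot2 _ H2) (near_pot2 _ H3).
rewrite /dmu (near_mn H1) -/(dmu g) -gx.
by rewrite (prefix_at E1).
Qed.

Lemma kap2_cocycle : cocycles (f : cgrp (cont_complex uA) 2).
Proof.
split; first exact: kap2_cont.
apply: functional_extensionality_dep => x; apply/funext => u.
rewrite -[LHS]/(cc_diff f u) /cc_diff.
case: (val u) (chain_size u) (chain_ischain u) => [|g [|h [|i [|? ?]]]] //= _.
move=> /and4P[/eqP gx /eqP hg /eqP ih _].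
have gh : psrc g = prng h by []. have hi : psrc h = prng i by [].
have g_hi : psrc g = prng (pmul h i) by rewrite prng_mul.
have gh_i : psrc (pmul g h) = prng i by rewrite psrc_mul.
have [a [b [d [e [s [t [H1 H2 H3 H4]]]]]]] := compat_exists3 gh hi.
rewrite big_ltn// big_nat1 /= expr1 mulrN1z sqrrN expr1n mulr1z exprSr sqrrN expr1n mul1r mulrN1z.
have F1 := fE gh H1; have F2 := fE gh_i H2; have F3 := fE g_hi H3; have F4 := fE hi H4.
rewrite gx in F1 F3; rewrite prng_mul// gx in F2.
have [Ep Eq El] := H1; rewrite -Ep in F2; rewrite -Eq -gh in F4.
have gl := levD a (mn_lev g).
have v : psrc g (dnu g + a) = x (dmu g + a) by have := lev_at 0 gl; rewrite !addr0 [prng g]gx.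
rewrite F4 (act_at_phv _ gx gl)// F1 F2 F3 v.
have PB := @phv_zmod k L A x (dmu g + a) (x (dmu g + a)).
rewrite [- phv _ _ _ + _]addrC -PB -(zmodD PB) -PB /kap2.
have -> : pmul g (pmul h i) = pmul (pmul g h) i by exact: (cat_compA (groupoidP G)).
rewrite alternating_cancel; exact: phv0.
Qed.

Lemma mn_pid y : mn (pid y) = (idm (y 0), idm (y 0)).
Proof.
have E := @mnid (idm (y 0)) (pid y); rewrite (cat_src_id cL) in E; apply: E.
have i0 : src (idm (y 0)) = src (idm (y 0)) by [].
by apply/(ZarrowP _ i0); split; rewrite ?kdeg_id -?sg0//; split=> //; rewrite subrr.
Qed.

(** The pair of a unit has mu = nu, so its contribution vanishes; those of g and of g s(g) are equal
    and cancel. *)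
Lemma kap2_idr (x y : unit_space G) (g : @hom G x y) : ceval f x [:: harr g; gid y] = 0.
Proof.
have gx : prng (harr g) = x by exact/eqP/(hom_rng g).
have gy : psrc (harr g) = prng (pid y) by exact/eqP/(hom_src g).
have [a [b [e H]]] := compat_exists gy; have [E1 _ _] := H.
have gid_r : pmul (harr g) (pid y) = harr g.
  by have := cat_idr (groupoidP G) (harr g); have -> : gsrc (harr g) = y by exact/eqP/(hom_src g).
rewrite gid_r in E1; have ae := degI E1.
have := fE gy H; rewrite gx => ->; rewrite /kap2 gid_r -ae.
by rewrite {2}/pot2 mn_pid subrr addr0 subrr phv0.
Qed.

Hypothesis nc : normalized c.

Lemma mn_climb g lam : lev g (kdeg lam) 0 -> sg (prng g) 0 (kdeg lam) = lam ->
  mn g = (lam, idm (src lam)).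
Proof.
move=> gl E; apply: mnid; apply/ZarrowP; first by rewrite (cat_src_id cL).
split; rewrite ?kdeg_id// sg0.
by have := lev_at 0 gl; rewrite !addr0 => <-; rewrite -{2}E src_sg add0r.
Qed.

(** The inverses of the climbing arrows and their product have the pairs (l1, s(l1)), (l2, s(l2))
    and (l1 l2, s(l2)). Of the six terms of the formula only c(l1, l2) survives normalisation. *)
Lemma kap2_star y t : size t = 2%N -> (t <> [::] -> endsat (y 0) t) ->
  ceval (f - cc_diff (invcochain f)) y (climb y (rev t)) *~ (-1) ^+ uphalf 2 =
  phv y 0 (catcochain c (y 0) t).
Proof.
case: t => [|l1 [|l2 []]]//= _ /(_ _)/wrap[]// /andP[/and3P[_ /eqP r2 _] /eqP s2].
rewrite !descend0; set w := pathcat l2 y.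
have w0 : src l1 = w 0 by rewrite pathcat0.
have [p1 q1 v1] := descendP s2; have [p2 q2 v2] := descendP w0.
rewrite shift0 -/w in q1; rewrite shift0 in q2.
set g1 := descend y 0 l2 in p1 q1 v1 *; set g2 := descend w 0 l1 in p2 q2 v2 *.
set z := pathcat l1 w in q2 *.
have z0 : src (comp l1 l2) = y 0 by rewrite (cat_src_comp cL).
have zE : z = pathcat (comp l1 l2) y by rewrite pathcat_comp.
have h1r : rng (c := G) (g1 : mor G) == y by exact/eqP.
have h1s : src (c := G) (g1 : mor G) == w by exact/eqP.
have h2r : rng (c := G) (g2 : mor G) == w by exact/eqP.
have h2s : src (c := G) (g2 : mor G) == z by exact/eqP.
have f0 : cc_diff f = 0 by have [] := kap2_cocycle.
have := cocycle_inv (under_sheafy A) f0 kap2_idr (Hom h1r h1s) (Hom h2r h2s).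
rewrite [harr (Hom h1r h1s)]/= [harr (Hom h2r h2s)]/= => ->.
rewrite [harr (invh _)]/= [harr (invh (Hom h1r h1s))]/=.
rewrite expr1 mulrN1z opprK.
have v1' := pinv_lev v1; have v2' := pinv_lev v2.
have i21 : psrc (pinv g2) = prng (pinv g1) by rewrite psrc_inv prng_inv p2 q1.
have m2 : mn (pinv g2) = (l1, idm (src l1)).
  by apply: mn_climb; rewrite // prng_inv q2 sg_pathcat0.
have m1 : mn (pinv g1) = (l2, idm (src l2)).
  by apply: mn_climb; rewrite // prng_inv q1 sg_pathcat0.
have dl : kdeg (comp l1 l2) = kdeg l1 + kdeg l2 by rewrite kdeg_comp.
have lv : lev (pmul (pinv g2) (pinv g1)) (kdeg (comp l1 l2)) 0.
  apply: lev_mul i21 _ v1'; have := levD (kdeg l2) v2'.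
  by rewrite dl add0r.
have m21 : mn (pmul (pinv g2) (pinv g1)) = (comp l1 l2, idm (src (comp l1 l2))).
  by apply: mn_climb; rewrite // prng_mul// prng_inv q2 zE sg_pathcat0.
(* At these levels alpha = l2, while beta and gamma are identities. *)
have H : compat (pinv g2) (pinv g1) (kdeg l2) 0 0.
  by split; rewrite /dmu /dnu ?m1 ?m2 ?m21 /= ?kdeg_id ?dl ?addr0 ?add0r.
have := fE i21 H; rewrite prng_inv q2 => ->.
have zp : z (dmu (pinv g2) + kdeg l2) = y 0.
  by rewrite /dmu m2 /= -dl zE -[kdeg (comp _ _)]add0r pathcat_at.
rewrite zp.
have lc : lev (pmul g1 g2) 0 (dmu (pinv g2) + kdeg l2).
  apply: (lev_mul (m := kdeg l2)) => //; first by rewrite q1.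
  by have := levD (kdeg l2) v2; rewrite add0r /dmu m2.
rewrite (@uact_phv _ _ A y z (comph (Hom h1r h1s) (Hom h2r h2s)) 0 _ (y 0) _ (esym zp) lc); congr phv.
rewrite /kap2 /pot2 /dmu m1 m2 m21 /= prng_mul// !prng_inv q1 q2.
have s10 : sg z (kdeg l1) (kdeg l2) = l2.
  have := sg_pathcat w0 0 (kdeg l2); rewrite add0r -/z => ->; exact: sg_pathcat0.
have s20 : sg w (kdeg l2) 0 = idm (y 0).
  by rewrite sg0; have := pathcat_at s2 0; rewrite add0r -/w => ->.
have s30 : sg z (kdeg (comp l1 l2)) 0 = idm (y 0).
  by rewrite sg0 zE; have := pathcat_at z0 0; rewrite add0r => ->.
have [n1 n2] := nc l2; have [_ n3] := nc (comp l1 l2); have [n4 _] := nc (idm (y 0)).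
rewrite r2 s2 in n1 n2; rewrite z0 in n3; rewrite (cat_src_id cL) (cat_rng_id cL) in n4.
by rewrite s10 s20 s30 z0 s2 n1 n2 n3 n4 !subr0 !addr0.
Qed.

End Cocycle.
Section Formula.
Variable P : set (mor L * mor L).
Hypotheses (mnP' : forall g, P (mn g)).

(** The formula is applied with alpha, beta, gamma the segments that follow the three mu, and with y
    the common tail. *)
Lemma kap2_of_formula (f : ccochain uA 2) : kps_formula c P f -> kap2_eval f.
Proof.
move=> F g h a b e gh H; have [Ep Eq El] := H.
pose y := shift (dmu g + a) (prng g).
have gl := levD a (mn_lev g); have hl := levD b (mn_lev h).
have yh : y = shift (dmu h + b) (prng h) by rewrite -Eq -gh; exact: gl.2.
have Z g' : Zarrow ((mn g').1, (mn g').2) g' by rewrite -surjective_pairing; exact: mnZ.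
have P' g' : P ((mn g').1, (mn g').2) by rewrite -surjective_pairing; exact: mnP'.
have := F g h _ _ _ _ _ _ (sg (prng g) (dmu g) a) (sg (prng h) (dmu h) b)
  (sg (prng g) (dmu (pmul g h)) e) y gh (P' g) (Z g) (P' h) (Z h) (P' _) (Z (pmul g h)).
have mgh := mu_sg (pmul g h) e; have ngh := nu_sg (pmul g h) e.
rewrite prng_mul// in mgh ngh; rewrite psrc_mul// in ngh.
rewrite !mu_sg !nu_sg mgh ngh !src_mu !rng_sg !src_sg prng_mul// -Ep -Eq -El gh => -> //=.
- by rewrite kdeg_sg -phvE /kap2 /pot2 prng_mul// opprD opprK !addrA.
- by rewrite [0 + _]add0r.
- by rewrite /y pathcat_shift.
- by rewrite yh Eq pathcat_shift.
- by rewrite yh Eq pathcat_shift.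
- by rewrite yh; have [_ ->] := hl; rewrite pathcat_shift.
Qed.

Lemma formula_of_kap2 (f : ccochain uA 2) :
  (forall g (m : mor L * mor L), P m -> Zarrow m g -> m = mn g) -> kap2_eval f ->
  kps_formula c P f.
Proof.
move=> U F g h mg ng mh nh mgh ngh a b c' y gh /U Pg /Pg Eg /U Ph /Ph Eh /U Pgh /Pgh Egh.
move=> mga mhb mghc ay nm mm nn rg sg' rh sh x p C.
(* Conversely, alpha, beta and gamma are forced to be segments: the path starts with m d, and
   cancellation identifies the part after m. *)
have tail (m d : mor L) z : src m = rng d -> src (comp m d) = y 0 -> z = pathcat (comp m d) y ->
    sg z (kdeg m) (kdeg d) = d.
  move=> md dy zE; have := sg_pathcat0 dy; rewrite -zE kdeg_comp// sgD add0r => E.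
  have sr : src (sg z 0 (kdeg m)) = rng (sg z (kdeg m) (kdeg d)) by rewrite src_sg rng_sg add0r.
  have [|Ea Eb] := comp_cancel sr md E; [by rewrite kdeg_sg|exact: Eb].
have ya : src (comp mg a) = y 0 by rewrite (cat_src_comp cL).
have nga : src ng = rng a by have := mns g; rewrite -Eg /= => <-.
have nhb : src nh = rng b by have := mns h; rewrite -Eh /= => <-.
have nghc : src ngh = rng c' by have := mns (pmul g h); rewrite -Egh /= => <-.
have yb : src (comp mh b) = y 0 by rewrite -nm (cat_src_comp cL).
have yc : src (comp mgh c') = y 0 by rewrite -mm.
have H : compat g h (kdeg a) (kdeg b) (kdeg c').
  by split; rewrite /dmu /dnu -?Eg -?Eh -?Egh -!kdeg_comp//= ?nm ?mm ?nn.
have -> := F g h _ _ _ gh H.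
have rgh : prng (pmul g h) = pathcat (comp mgh c') y by rewrite prng_mul// rg mm.
rewrite -phvE /kap2 /pot2 /dmu -Eg -Eh -Egh /= -kdeg_comp//.
rewrite (tail _ _ _ mga ya rg) (tail _ _ _ mhb yb rh) (tail _ _ _ mghc yc rgh).
by rewrite opprD opprK !addrA.
Qed.

End Formula.

End KappaTwo.

Section KappaTwoClass.
Variables (k : nat) (L : kgraph k) (A : rmodule L).
Local Notation G := (path_groupoid L).
Local Notation uA := (under A).

Lemma partition_choice (P : set (mor L * mor L)) : kps_partition P ->
  exists mn : parrow L -> mor L * mor L, [/\ forall g, P (mn g), forall g, Zarrow (mn g) g,
    forall g, src (mn g).1 = src (mn g).2 & forall g m, P m -> Zarrow m g -> m = mn g].
Proof.
move=> [Ps [Pc Pt _] _].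
have /choice[mn mnE] g : exists m, P m /\ Zarrow m g.
  have : [set: parrow L] g by []. by rewrite -Pc => -[m Pm mg]; exists m.
exists mn; split=> [g|g|g|g m Pm mg]; [by have [] := mnE g|by have [] := mnE g| |].
  by have [/Ps] := mnE g.
by have [Pn ng] := mnE g; apply: Pt => //; exists g.
Qed.

Variable c : modfam (Pmod 2) A.
Hypotheses (cN : is_natural c) (c0 : forall v (D : Pmod 3 v), c (Pd D) = 0).

Lemma kappa2_cocycle f : is_kappa2 c f -> cocycles (f : cgrp (cont_complex uA) 2).
Proof.
move=> [_ [P kP F]]; have [mn [mnP mnZ mns mnU]] := partition_choice kP.
have U g h : Zarrow (mn g) h -> mn h = mn g by move=> H; exact/esym/mnU.
have fE := kap2_of_formula mnZ mns mnP F. exact: (kap2_cocycle mnZ mns U fE).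
Qed.

Lemma invcochain_kappa2 f : is_kappa2 c f -> continuous (ccochain_map (invcochain f)).
Proof. by move=> /kappa2_cocycle[cf _]; apply: (invcochain_cont (path_etale L)) cf; [exact: pinv_cont|exact: under_sheafy]. Qed.

Lemma kappa2_star f (y : ipath L) t : is_kappa2 c f -> size t = 2%N -> (t <> [::] -> endsat (y 0) t) ->
  ceval (f - cc_diff (invcochain f)) y (climb y (rev t)) *~ (-1) ^+ uphalf 2 =
  phv y 0 (catcochain c (y 0) t).
Proof.
move=> [nc [P kP F]]; have [mn [mnP mnZ mns mnU]] := partition_choice kP.
have U g h : Zarrow (mn g) h -> mn h = mn g by move=> H; exact/esym/mnU.
have V lam g : Zarrow (lam, idm (src lam)) g -> mn g = (lam, idm (src lam)).
  by move=> H; apply/esym/mnU => //; have [_ _] := kP; apply.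
have fE := kap2_of_formula mnZ mns mnP F.
exact: (kap2_star mnZ mns U V fE nc).
Qed.

Lemma kappa2_exists : row_finite_no_sources L -> normalized c -> exists f, is_kappa2 c f.
Proof.
move=> hL nc; have kP := standard_partition hL; have [mn [mnP mnZ mns mnU]] := partition_choice kP.
pose dm := dmu mn; pose dn := dnu mn.
pose f : ccochain uA 2 := fun x u => if val u is [:: g; h] then
  let a := dm h + dm (pmul g h) in
  phv x (dm g + a) (kap2 mn c g h a (dn g + dm (pmul g h)) (dm g + dm h) ((x : ipath L) (dm g + a)))
  else 0.
exists f; split=> //; exists (standard_pairs (L := L)) => //.
apply: (formula_of_kap2 (mn := mn) mns mnU) => g h a b e gh H.
have ch : ischain (C := G) (prng g) [:: g; h].
  by apply/and3P; split=> //; apply/eqP.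
rewrite (ceval_chain f (erefl : size [:: g; h] = 2%N) ch) /f.
rewrite (@val_chain_of G 2 (prng g) [:: g; h])//.
exact: (kap2_indep mnZ mns cN c0 gh (compat_std mnZ mns gh) H).
Qed.

End KappaTwoClass.

(** * Comparison of cohomology classes *)

Section Induced.

Record cochain_map (C D : cochain_complex) n (F : cgrp C n -> cgrp D n) : Prop := CochainMap {
  cmap_cocycle : forall c, cocycles c -> cocycles (F c);
  cmap_cob : forall a b, coboundaries (a - b) -> coboundaries (F a - F b) }.

Variables (C D E M : cochain_complex).
Hypotheses (sC : subgroup_complex C) (sD : subgroup_complex D) (sE : subgroup_complex E)
  (sM : subgroup_complex M).
Variables (n : nat) (R : cgrp C n -> cgrp D n -> Prop).
Variables (F : cgrp D n -> cgrp E n) (H : cgrp E n -> cgrp M n) (T : cgrp C n -> cgrp M n).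
Hypotheses (mF : cochain_map F) (mH : cochain_map H) (mT : cochain_map T).

(** The relation R may relate a cocycle to many cochains or to none. The first condition handles all
    related cochains; the second supplies a representative of the class that has one. *)
Lemma induced_square (K : set (cgrp C n)) : cohomology C n K ->
  (forall c d, cocycles c -> R c d -> cocycles d /\ coboundaries (H (F d) - T c)) ->
  (forall c, cocycles c -> exists c1, [/\ cocycles c1, coboundaries (c1 - c) & exists d, R c1 d]) ->
  induced H (induced F (induced_rel R K)) = induced T K.
Proof.
move=> hK R1 R2; apply/seteqP; split=> z.
- move=> [_ [e [_ [d' [d [c Kc cd] [_ d'd]] ->] [_ ed]] ->] zh].
  have [_ dT] := R1 _ _ (cohomology_cocycle hK Kc) cd.
  exists (T c); first by exists c.
  apply: (cls_trans sM zh); apply: (cob_trans sM (cmap_cob mH ed)).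
  exact: (cob_trans sM (cmap_cob mH (cmap_cob mF d'd))).
- move=> [_ [c Kc ->] zc]; have cc := cohomology_cocycle hK Kc.
  have [c1 [cc1 c1c [d cd]]] := R2 _ cc; have [dd dT] := R1 _ _ cc1 cd.
  exists (H (F d)).
    exists (F d) => //; exists (F d); last exact/(cls_self sE)/(cmap_cocycle mF).
    exists d => //; exists d; last exact: (cls_self sD).
    by exists c1 => //; exact: (cohomology_cls sC hK Kc).
  apply: (cls_trans sM zc); apply: (cob_trans sM (b := T c1)).
    exact/(cob_sym sM)/(cmap_cob mT).
  exact: (cob_sym sM).
Qed.

End Induced.

(** * Normalized representatives of categorical 2-cocycles *)

Section ModuleComplex.
Variables (C : category) (A : rmodule C).
Let cC := categoryP C.

Lemma mod_subgroup_complex : subgroup_complex (mod_complex A).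
Proof.
split=> n.
- split=> [v a b|v w h a]; first by rewrite [LHS]/(0 : A v) [RHS]subrr.
  by rewrite [LHS]/(0 : A w) raddf0.
- move=> a b [aB an] [bB bn]; split=> [v s t|v w h s].
    by rewrite -[LHS]/(a v (s - t) - b v (s - t)) aB bB subr_subACA.
  by rewrite -[LHS]/(a w (mmap (Pmod n) h s) - b w (mmap (Pmod n) h s)) an bn -raddfB.
- by move=> a b; apply: functional_extensionality_dep => v; apply/funext => s.
Qed.

Lemma mod_cocycle n (c : cgrp (mod_complex A) n) : cocycles c ->
  is_natural (c : modfam (Pmod n) A) /\ forall v (D : Pmod n.+1 v), c v (Pd D) = 0.
Proof.
move=> [cN c0]; split=> // v D.
exact: (congr1 (fun f : modfam (Pmod n.+1) A => f v D) c0).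
Qed.

Section Normalize.
Variable c : modfam (Pmod 2) A.
Hypotheses (cN : is_natural c) (c0 : forall v (D : Pmod 3 v), c (Pd D) = 0).

(* As a categorical cochain this is lam |-> c(s(lam), s(lam)), which cobounds the
   values c(r(lam), lam) and c(lam, s(lam)). *)
Definition normalizer : modfam (Pmod 1) A := fun v =>
  flift (fun t : chainto 2 v => if val t is [:: _; l] then
    c (Pgen 2 v [:: idm (rng l); idm (rng l); l]) else 0).

Lemma normalizerE v a l : endsat v [:: a; l] ->
  normalizer (Pgen 1 v [:: a; l]) = c (Pgen 2 v [:: idm (rng l); idm (rng l); l]).
Proof.
move=> et; have [u uE ->] := PgenT (erefl : size [:: a; l] = 2%N) et.
by rewrite /normalizer fliftU uE.
Qed.

Lemma normalizer_natural : is_natural normalizer.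
Proof.
split=> [v|v w h D]; first exact: flift_zmod.
have nB := @flift_zmod; have [cB cn] := cN.
apply: (P_ext (f := fun D => normalizer (Pmap h D)) (f' := fun D => mmap A h (normalizer D))).
- by move=> s t; rewrite Pmap_zmod; exact: flift_zmod.
- by move=> s t; rewrite -raddfB; congr (mmap A h _); exact: flift_zmod.
case=> [|a [|l []]] // _ et; have [_ sl] := endsat_of_rcons (isT : (0 < size [:: a])%N) et.
have lh : src l = rng (harr h) by rewrite sl; exact/esym/eqP/(hom_rng h).
have et' : endsat w [:: a; comp l h] := endsat_mullast h et.
rewrite PmapE// [mullast _ _]/= (normalizerE et').
rewrite normalizerE// (cat_rng_comp cC lh) -cn /= PmapE//.
by rewrite /= !(cat_src_id cC) !(cat_rng_id cC) sl !eqxx.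
Qed.

(** The cocycle identities at (r(l), r(l), l) and at (l, s(l), s(l)). *)
Lemma normalize_id l : catcochain c (src l) [:: idm (rng l); l] =
    c (Pgen 2 (src l) [:: idm (rng l); idm (rng l); l]) /\
  catcochain c (src l) [:: l; idm (src l)] =
    catcochain c (src l) [:: idm (src l); idm (src l)].
Proof.
have ii v : comp (idm v) (idm v) = idm v :> mor C by rewrite -{1}(cat_rng_id cC v) (cat_idl cC).
have si v : src (idm v) = rng (idm v) :> obj C by rewrite (cat_src_id cC) (cat_rng_id cC).
split.
- have := cocycle2_comp (hom_of l) cN c0 (si (rng l)) (cat_src_id cC (rng l)).
  rewrite -(catcochain_map (t := [:: idm (rng l); idm (rng l)]) cN)//=; last first.
    by rewrite !(cat_src_id cC) !(cat_rng_id cC) !eqxx.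
  by rewrite ii (cat_idl cC) subrr add0r => ->.
- have sl : src l = rng (idm (src l)) by rewrite (cat_rng_id cC).
  have := cocycle2_comp (idh (src l)) cN c0 sl (cat_src_id cC (src l)).
  by rewrite mmap_id /= ii (cat_idr cC) subrK.
Qed.

Definition normalization : modfam (Pmod 2) A :=
  c - (cdiff (normalizer : cgrp (mod_complex A) 1) : modfam (Pmod 2) A).

(** Since [normalizer] depends on the last entry only, its values at [l, s(l)] and [a l, s(l)] are
    equal and cancel in the coboundary, which leaves the one at [a, l]. *)
Lemma normalization_eval a l : src a = rng l ->
  catcochain normalization (src l) [:: a; l] =
  catcochain c (src l) [:: a; l] - c (Pgen 2 (src l) [:: idm (rng l); idm (rng l); l]).
Proof.
move=> al; have et : endsat (src l) [:: a; l; idm (src l)].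
  by rewrite /= al (cat_rng_id cC) (cat_src_id cC) !eqxx.
rewrite -[LHS]/(catcochain c (src l) [:: a; l] - normalizer (Pd (Pgen 2 (src l) [:: a; l; idm (src l)]))).
congr (_ - _); have [nB _] := normalizer_natural.
rewrite PdE// !big_ord_recl big_ord0 addr0 /= !(zmodD (nB _)) !(zmodMz (nB _)).
rewrite expr1 mulrN1z sqrrN expr1n mulr1z (cat_idr cC).
by rewrite !normalizerE ?addrA ?subrr ?add0r//= ?(cat_rng_id cC) ?(cat_src_id cC) ?(cat_src_comp cC)// ?al ?eqxx.
Qed.

Lemma normalization_normalized (l : mor C) :
  catcochain normalization (src l) [:: idm (rng l); l] = 0 /\
  catcochain normalization (src l) [:: l; idm (src l)] = 0.
Proof.
have [E1 E2] := normalize_id l; split.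
  by rewrite normalization_eval ?(cat_src_id cC)// E1 subrr.
have := @normalization_eval l (idm (src l)).
rewrite (cat_src_id cC) (cat_rng_id cC) => -> //.
by rewrite E2 subrr.
Qed.

End Normalize.
End ModuleComplex.

(** * The maps on cochains, and the first equality on cohomology *)

Section CochainMaps.
Variables (k : nat) (L : kgraph k) (A : rmodule L).
Local Notation G := (path_groupoid L).
Local Notation uA := (under A).
Local Notation UP := (@underP k L).
Local Notation etac n := (@eta_cochain G uA n).

Lemma under_map_bd n (b : modfam (Pmod n) A) (c : modfam (Pmod n.+1) A) :
  is_natural b -> is_natural c -> (forall v D, c v D = b v (Pd D)) ->
  forall x (s : UP n.+1 x), under_map c s = under_map b (rbd UP n s).
Proof.
move=> bN cN cb x s; have [m [D ->]] := phv_at 0 (s : dlim (Pmod n.+1) x).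
have dN := @Pd_natural L n.
rewrite [rbd _ _ _]/= (under_map_phv _ dN erefl) !under_map_phv//.
by rewrite cb.
Qed.

Lemma under_mapB n (a b : modfam (Pmod n) A) :
  (under_map (a - b) : shfam (UP n) uA) = (under_map a : shfam (UP n) uA) - under_map b.
Proof. by apply: shfam_ext => x s; exact: phi_zmod. Qed.

Lemma theta_map n : @cochain_map (mod_complex A) (hom_complex UP uA) n (fun c => under_map c).
Proof.
split=> [c /mod_cocycle[cN c0]|].
  split; first exact: under_map_shmor.
  apply: shfam_ext => x s; rewrite -[LHS]/(under_map c (rbd UP n s)).
  have zN : is_natural (0 : modfam (Pmod n.+1) A) := cmem0 (mod_subgroup_complex A) n.+1.
  rewrite -(under_map_bd cN zN) => [|v D]; first exact: zmod0 (@phi_zmod _ _ A x _).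
  by rewrite c0.
case: n => [a b|n a b [c cm ab]].
  by move=> /eqP; rewrite [a - b == 0]subr_eq0 => /eqP ->; exact: subrr.
have cN : is_natural (c : modfam (Pmod n) A) by [].
exists (under_map (c : modfam (Pmod n) A)); first exact: under_map_shmor.
have dN : is_natural (a - b : modfam (Pmod n.+1) A).
  rewrite -ab; split=> [v s t|v w h s] /=; first by rewrite Pd_zmod (cN.1 v).
  by rewrite (@Pd_natural L n).2 cN.2.
rewrite -[RHS](@under_mapB n.+1); apply: shfam_ext => x s.
by rewrite -[LHS]/(under_map c (rbd UP n s)) -(under_map_bd cN dN)// => v D; rewrite -ab.
Qed.

Lemma eta_cochainB n (a b : ccochain uA n) :
  etac n (a - b) = (etac n a : shfam (gP_term G n) uA) - etac n b.
Proof.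
have sA := under_sheafy A; apply: shfam_ext => x; apply: zmod_freeg_ext.
- exact: eta_zmod.
- move=> s t; rewrite -[LHS]/(eta_cochain a (s - t) - eta_cochain b (s - t)).
  by rewrite !eta_zmod subr_subACA.
move=> u; rewrite -[RHS]/(eta_cochain a << u >> - eta_cochain b << u >>) /eta_cochain !fliftU.
case: (val u) => [|g t]; first by rewrite subr0.
by rewrite cevalB act_at_zmod.
Qed.

Lemma eta_map n : @cochain_map (cont_complex uA) (hom_complex (gP G) uA) n (@eta_cochain G uA n).
Proof.
have eG := path_etale L; have sA := under_sheafy A.
split=> [c [cc c0]|].
  split; first exact: eta_shmor.
  apply: shfam_ext => x s; rewrite -[LHS]/(eta_cochain (c : ccochain uA n) (gP_bd s)) -(eta_bd sA).
  have := eta_cochainB (0 : ccochain uA n.+1) 0; rewrite !subrr => E.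
  by rewrite [cc_diff c]c0 E.
case: n => [a b|n a b [c cm ab]].
  by move=> /eqP; rewrite [a - b == 0]subr_eq0 => /eqP ->; exact: subrr.
exists (etac n c); first exact: eta_shmor.
rewrite -[RHS](@eta_cochainB n.+1) -ab; apply: shfam_ext => x s.
exact: (esym (eta_bd sA c s)).
Qed.

Lemma psi_map n : @cochain_map (hom_complex (gP G) uA) (hom_complex UP uA) n
  (fun c x s => c x (psi s)).
Proof.
split=> [c|]; first exact: cocycle_psi.
case: n => [a b|n a b [c cm ab]].
  by move=> /eqP; rewrite [a - b == 0]subr_eq0 => /eqP ->; exact: subrr.
exists (fun x s => c x (psi s)); first exact: shmor_psi.
apply: shfam_ext => x s; rewrite -[LHS]/(c x (psi (rbd UP n s))) psi_bd.
exact: (congr1 (fun f : shfam (gP G n.+1) uA => f x (psi s)) ab).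
Qed.

Definition eta_psi n (f : ccochain uA n) : shfam (UP n) uA := fun x s => eta_cochain f (psi s).

Lemma eta_psi_cohomologous n (hn : (n <= 2)%N) (c : modfam (Pmod n) A) (f : ccochain uA n) :
  cocycles (c : cgrp (mod_complex A) n) -> is_kappa c f ->
  cocycles (f : cgrp (cont_complex uA) n) /\
  coboundaries (eta_psi f - under_map c : cgrp (hom_complex UP uA) n).
Proof.
move=> /mod_cocycle[cN c0].
have eq0 (g : ccochain uA n) : (forall y t, size t = n -> (t <> [::] -> endsat ((y : ipath L) 0) t) ->
    ceval g y (climb y (rev t)) *~ (-1) ^+ uphalf n = phv y 0 (catcochain c (y 0) t)) ->
    eta_psi g = under_map c.
  by move=> H; apply: shfam_ext => x s; exact: eta_psi_under.
case: n hn c f cN c0 eq0 => [|[|[|//]]] _ c f cN c0 eq0 kf.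
- split; first exact: (kappa0_cocycle cN c0 kf).
  rewrite eq0 ?subrr// => y [|//] _ _; exact: kappa0_eval.
- split; first exact: (kappa1_cocycle kf).
  rewrite eq0 ?subrr; first exact/cob0/underP_complex.
  by move=> y t st et; apply: kappa1_star.
- have [cf f0] := kappa2_cocycle kf; split=> //.
  pose b := invcochain f.
  have cb : continuous (ccochain_map b) := invcochain_kappa2 kf.
  exists (eta_psi b).
    by apply: shmor_psi; apply: eta_shmor => //; [exact: path_etale|exact: under_sheafy].
  rewrite -(eq0 (f - cc_diff b)) => [|y t st et]; last exact: kappa2_star.
  apply: shfam_ext => x s.
  rewrite -[LHS]/(eta_cochain b (psi (rbd UP 1 s))) psi_bd -(eta_bd (under_sheafy A)).
  rewrite -[RHS]/(eta_cochain f (psi s) - eta_cochain (f - cc_diff b) (psi s)) eta_cochainB.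
  rewrite -[X in _ - X]/(eta_cochain f (psi s) - eta_cochain (cc_diff b) (psi s)).
  by rewrite opprB addrC subrK.
Qed.

Lemma kappa_representable n (hn : (n <= 2)%N) (c : cgrp (mod_complex A) n) :
  row_finite_no_sources L -> cocycles c ->
  exists c1 : cgrp (mod_complex A) n, [/\ cocycles c1, coboundaries (c1 - c) &
    exists f, is_kappa (c1 : modfam (Pmod n) A) (f : ccochain uA n)].
Proof.
move=> hL cc; have sM := mod_subgroup_complex A.
case: n hn c cc => [|[|[|//]]] _ c cc; have [cN c0] := mod_cocycle cc.
- by exists c; split=> //; [rewrite subrr|exists (kap0 c); exact: kap0P].
- exists c; split=> //; first by rewrite subrr; exact: cob0.
  exact: kappa1_exists.
- have bN := normalizer_natural cN.
  have cob : coboundaries (normalization c - c : cgrp (mod_complex A) 2).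
    apply: (cob_sym sM); rewrite /normalization opprB addrC subrK.
    by exists (normalizer c).
  have c1c : cocycles (normalization c : cgrp (mod_complex A) 2).
    have [cc1 c1d] := cc; split; first by apply: (cmemB sM (n := 2)) => //; split=> [v s t|v w h s] /=;
      [rewrite Pd_zmod (bN.1 v)|rewrite (@Pd_natural L 1).2 bN.2].
    rewrite /normalization (cdiffB sM (n := 2)) c1d sub0r.
    apply: functional_extensionality_dep => v; apply/funext => D.
    rewrite -[LHS]/(- normalizer c (Pd (Pd D))) Pd_Pd.
    by rewrite (zmod0 (bN.1 v)) oppr0.
  exists (normalization c); split=> //.
  have [c1N c10] := mod_cocycle c1c.
  exact: (kappa2_exists c1N c10 hL (normalization_normalized cN c0)).
Qed.

End CochainMaps.

Theorem theorem4p1 (k : nat) (L : kgraph k) (hL : row_finite_no_sources L)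
    (A : rmodule L) (n : nat) (hn : (n <= 2)%N) :
  (forall K : set (cgrp (mod_complex A) n),
     cohomology (mod_complex A) n K ->
     psi_star A n (eta (under A) n (kappa A n K)) = theta A n K) /\
  (forall K : set (cgrp (hom_complex (gP (path_groupoid L)) (under A)) n),
     cohomology (hom_complex (gP (path_groupoid L)) (under A)) n K ->
     rho (underP L) (under A) n (psi_star A n K) =
     rho (gP (path_groupoid L)) (under A) n K).
Proof.
split=> K hK; last exact: rho_psi.
apply: (induced_square (mod_subgroup_complex A) (cont_subgroup_complex (path_etale L) (under_sheafy A))
  (gP_complex A) (underP_complex A) (eta_map A n) (psi_map A n) (theta_map A n) hK).
- by move=> c d cc cd; exact: (eta_psi_cohomologous hn cc cd).
- by move=> c cc; have [c1 [cc1 c1c [f kf]]] := kappa_representable hn hL cc; exists c1; split=> //; exists f.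
Qed.
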